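(* Let $M$ be a connected finite-dimensional smooth manifold, let $U\subset\mathbb{R}^m$ for some $m\in\mathbb{N}$, let $F:M\times U\to TM$ be smooth with $F(x,u)\in T_xM$ for all $(x,u)\in M\times U$, and let the set of admissible controls $\mathcal{U}$ be either $\mathcal{U}_{pc}$ or $\mathcal{U}_\infty$. If the control system $\dot x=F(x,u(t))$, $x\in M$, with admissible controls in $\mathcal{U}$, is locally controllable (i.e. $x\in\operatorname{Int}\mathcal{A}_x$ for every $x\in M$), then it is controllable (i.e. $\mathcal{A}_x=M$ for every $x\in M$).
   Context: The classes of controls are $\mathcal{U}_{pc}=\bigcup_{T\ge 0}\{u:[0,T]\to U \mid u \text{ piecewise constant}\}$ and $\mathcal{U}_\infty=\bigcup_{T\ge 0}L^\infty([0,T],U)$. Given an admissible control $u\in\mathcal{U}$ and $x\in M$, $\phi(\cdot,x,u)$ denotes the unique absolutely continuous maximal solution of $\dot x=F(x,u(t))$ with initial condition $x$ at time $0$. The attainable set from $x\in M$ is $$\mathcal{A}_x=\{\phi(T,x,u)\mid T\ge 0,\ u\in\mathcal{U},\ \phi(\cdot,x,u)\text{ is defined on }[0,T]\}.$$ $\operatorname{Int}$ denotes the interior with respect to the topology of $M$.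
   Formalization: φ(·,x,u) counts as defined only if F(·,u(t)) is locally bounded and Lipschitz on M with time-integrable constants, since uniqueness can fail for L^∞ controls when U is not closed; this is automatic for piecewise constant controls or closed U. *)

(* Defs.v *)
From HB Require Import structures.
From mathcomp Require Import all_boot all_order all_algebra.
From mathcomp Require Import all_classical all_reals all_analysis.
Set Implicit Arguments.
Unset Strict Implicit.
Unset Printing Implicit Defensive.
Import Order.TTheory GRing.Theory Num.Theory.
Import numFieldNormedType.Exports.
Local Open Scope classical_set_scope.
Local Open Scope ring_scope.

(* C^k on an open set: f is differentiable and each x |-> 'D_v f x, i.e.
   x |-> 'd f x v, is C^(k-1). In finite dimension this is equivalent to
   x |-> 'd f x being C^(k-1). *)
Fixpoint Ck_on (R : realType) (V W : normedModType R) (k : nat) (D : set V)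
    (f : V -> W) : Prop :=
  if k is k'.+1 then
    (forall x, D x -> differentiable f x) /\
    (forall v, Ck_on k' D (fun x => 'D_v f x))
  else forall x, D x -> {for x, continuous f}.

Definition smooth_on (R : realType) (V W : normedModType R) (D : set V)
    (f : V -> W) : Prop :=
  forall k, Ck_on k D f.

(* The charts are homeomorphisms from open subsets of M onto open subsets of
   R^n; chart i and chart_inv i are meaningful only on chart_dom i and on its
   image. The atlas need not be maximal. *)
Record smooth_atlas (R : realType) (n : nat) (M : topologicalType) :=
  SmoothAtlas {
    chart_index : Type;
    chart_dom : chart_index -> set M;
    chart : chart_index -> M -> 'rV[R]_n;
    chart_inv : chart_index -> 'rV[R]_n -> M;
    chart_cover : forall x, exists i, chart_dom i x;
    chart_dom_open : forall i, open (chart_dom i);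
    chart_image_open : forall i, open (chart i @` chart_dom i);
    chartK : forall i x, chart_dom i x -> chart_inv i (chart i x) = x;
    chart_continuous : forall i x, chart_dom i x ->
      {for x, continuous (chart i)};
    chart_inv_continuous : forall i x, chart_dom i x ->
      {for chart i x, continuous (chart_inv i)};
    chart_smooth : forall i j,
      smooth_on (chart i @` (chart_dom i `&` chart_dom j))
        (chart j \o chart_inv i)
  }.

(* An element of T_x M is given by its coordinates in all the charts at x,
   related by the differentials of the changes of charts. The coordinates in
   the other charts are set to 0, so that equality is equality in T_x M. *)
Record tangent_vector (R : realType) (n : nat) (M : topologicalType)
    (A : smooth_atlas R n M) (x : M) := TangentVector {
  tcoord : chart_index A -> 'rV[R]_n;
  tcoord_out : forall i, ~ chart_dom i x -> tcoord i = 0;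
  tcoord_change : forall i j, chart_dom i x -> chart_dom j x ->
    tcoord j = 'd (chart j \o chart_inv i) (chart i x) (tcoord i)
}.

(* Smoothness on M x U of a map with F(x,u) in T_x M, for an arbitrary subset U
   of R^m: near each point of M x U, F is the restriction of a smooth map
   defined on an open set. The values of F at u outside U are irrelevant. *)
Definition smooth_control_field (R : realType) (n m : nat)
    (M : topologicalType) (A : smooth_atlas R n M) (U : set 'rV[R]_m)
    (F : forall x : M, 'rV[R]_m -> tangent_vector A x) : Prop :=
  forall i x u, chart_dom i x -> U u ->
  exists (W : set ('rV[R]_n * 'rV[R]_m)%type)
         (G : 'rV[R]_n * 'rV[R]_m -> 'rV[R]_n),
    [/\ open W, W (chart i x, u), smooth_on W G &
        forall y v, chart_dom i y -> U v -> W (chart i y, v) ->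
          tcoord (F y v) i = G (chart i y, v)].

(* A control u : [0,T] -> U is a pair (T, u); u is irrelevant outside [0,T]. *)
Definition control (R : realType) (m : nat) : Type := (R * (R -> 'rV[R]_m))%type.

Definition U_pc (R : realType) (m : nat) (U : set 'rV[R]_m) :
    set (control R m) :=
  [set Tu | [/\ 0 <= Tu.1,
    (forall t : R, t \in `[0, Tu.1] -> U (Tu.2 t)) &
    exists s : seq R, itv_partition 0 Tu.1 s /\
      forall k, (k < size s)%N ->
      forall t t' : R, t \in `](nth 0 (0 :: s) k), (nth 0 s k)[ ->
        t' \in `](nth 0 (0 :: s) k), (nth 0 s k)[ -> Tu.2 t = Tu.2 t']].

(* Representatives of the classes in L^oo([0,T],U). Borel representatives with
   all their values in U always exist (for U nonempty). *)
Definition U_infty (R : realType) (m : nat) (U : set 'rV[R]_m) :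
    set (control R m) :=
  [set Tu | [/\ 0 <= Tu.1,
    (forall t : R, t \in `[0, Tu.1] -> U (Tu.2 t)),
    (forall j : 'I_m,
       measurable_fun (`[0, Tu.1]%classic : set R) (fun t => Tu.2 t 0 j)) &
    exists C : R, {ae (@lebesgue_measure R),
      forall t : R, t \in `[0, Tu.1] -> `|Tu.2 t| <= C}]].

Definition absolutely_continuous_on (R : realType) (V : normedModType R)
    (a b : R) (f : R -> V) : Prop :=
  forall e : R, 0 < e -> exists2 d : R, 0 < d &
  forall (k : nat) (l r : 'I_k -> R),
    (forall i, [/\ a <= l i, l i <= r i & r i <= b]) ->
    (forall i j, i != j -> r i <= l j \/ r j <= l i) ->
    \sum_i (r i - l i) < d -> \sum_i `|f (r i) - f (l i)| < e.

Definition absolutely_continuous_curve (R : realType) (n : nat)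
    (M : topologicalType) (A : smooth_atlas R n M) (T : R) (g : R -> M) : Prop :=
  {within `[0, T], continuous g} /\
  forall i (a b : R), 0 <= a -> a <= b -> b <= T ->
    (forall t : R, t \in `[a, b] -> chart_dom (s := A) i (g t)) ->
    absolutely_continuous_on a b (chart i \o g).

(* Local boundedness and Lipschitz continuity of F(., u(t)), with integrable
   constants: the hypotheses of the Caratheodory existence and uniqueness
   theorem for x' = F(x, u(t)). They hold for every u in U_pc U and, if U is
   closed or F extends smoothly to M x closure U, for every u in U_infty U.
   Otherwise they can fail: for F(x,u) = x / u on R x ]0,1[ and u(t) = t, the
   solution starting from 0 is not unique. *)
Definition caratheodory (R : realType) (n m : nat) (M : topologicalType)
    (A : smooth_atlas R n M) (F : forall x : M, 'rV[R]_m -> tangent_vector A x)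
    (T : R) (u : R -> 'rV[R]_m) : Prop :=
  forall x : M, exists i (N : set M) (l : R -> R),
    [/\ nbhs x N, N `<=` chart_dom (s := A) i,
        (@lebesgue_measure R).-integrable `[0, T] (EFin \o l) &
        {ae (@lebesgue_measure R), forall t : R, t \in `[0, T] ->
          forall y z, N y -> N z ->
            `|tcoord (F y (u t)) i| <= l t /\
            `|tcoord (F y (u t)) i - tcoord (F z (u t)) i|
              <= l t * `|chart i y - chart i z|}].

Definition solution (R : realType) (n m : nat) (M : topologicalType)
    (A : smooth_atlas R n M) (F : forall x : M, 'rV[R]_m -> tangent_vector A x)
    (T : R) (x : M) (u : R -> 'rV[R]_m) (g : R -> M) : Prop :=
  [/\ g 0 = x, absolutely_continuous_curve A T g &
      {ae (@lebesgue_measure R), forall t : R, t \in `]0, T[ ->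
        forall i, chart_dom (s := A) i (g t) ->
          is_derive t 1 (chart i \o g) (tcoord (F (g t) (u t)) i)}].

(* g is phi(., x, u) and is defined on [0,T]; phi(., x, u) is regarded as
   undefined when the equation is not a well-posed Caratheodory equation. *)
Definition is_phi (R : realType) (n m : nat) (M : topologicalType)
    (A : smooth_atlas R n M) (F : forall x : M, 'rV[R]_m -> tangent_vector A x)
    (T : R) (x : M) (u : R -> 'rV[R]_m) (g : R -> M) : Prop :=
  caratheodory F T u /\ solution F T x u g.

Definition attainable (R : realType) (n m : nat) (M : topologicalType)
    (A : smooth_atlas R n M) (F : forall x : M, 'rV[R]_m -> tangent_vector A x)
    (UU : set (control R m)) (x : M) : set M :=
  [set y | exists (T : R) (u : R -> 'rV[R]_m) (g : R -> M),
     [/\ UU (T, u), is_phi F T x u g & y = g T]].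

Definition locally_controllable (R : realType) (n m : nat)
    (M : topologicalType) (A : smooth_atlas R n M)
    (F : forall x : M, 'rV[R]_m -> tangent_vector A x)
    (UU : set (control R m)) : Prop :=
  forall x, (attainable F UU x)° x.

Definition controllable (R : realType) (n m : nat)
    (M : topologicalType) (A : smooth_atlas R n M)
    (F : forall x : M, 'rV[R]_m -> tangent_vector A x)
    (UU : set (control R m)) : Prop :=
  forall x, attainable F UU x = setT.

(* Main.v *)
(* Fix a point y. Local controllability makes the set P of the points from which
   y is attainable closed, and the attainable set O of y open. If O is contained
   in P, then attainability is symmetric, the attainable sets are clopen, and
   connectedness concludes. Consider the Frechet normals to P. Solutions ending
   in P start in P, and the flow of x' = F(x, u(t)) is differentiable along a
   trajectory with invertible differential, so if q is attainable from p, then P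
   has at least as many independent normals at q as at p. For p in P and u in U,
   following F(., u) backwards from p gives q in P, close enough to p to be
   attainable from p: hence p and q have equally many normals and every normal
   at p is transported from q, where it is orthogonal to F(q, u) because the
   trajectory stays in P on both sides of q. As the flow preserves F(., u), all
   the normals at p are orthogonal to F(p, u). Finally, as in the theorems of
   Nagumo and Bony, the squared distance to P along a trajectory starting at y
   satisfies a Gronwall inequality, so the trajectory remains in P. *)
Require Import Defs.
From HB Require Import structures.
From mathcomp Require Import all_boot all_order all_algebra.
From mathcomp Require Import all_classical all_reals all_analysis.
From mathcomp Require Import measurable_realfun.
From mathcomp Require Import ring lra.
Set Implicit Arguments.
Unset Strict Implicit.
Unset Printing Implicit Defensive.
Import Order.TTheory GRing.Theory Num.Theory.
Import numFieldNormedType.Exports.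
Local Open Scope classical_set_scope.
Local Open Scope ring_scope.

(** Two notions of normal meet in the proof. The Gronwall estimate for the squared distance produces
    proximal normals, but transport uses maps of which only the differential at one point is known,
    and these preserve only first-order conditions. Frechet normals fit both uses, since proximal
    normals are Frechet normals. Transport is one-way: backward trajectories carry points of [P]
    near the end to points of [P] near the start, hence normals go from the start to the end, and
    equality of the numbers of normals needs a return trajectory, supplied by local controllability
    at [p]. The flow has to be differentiated for merely measurable controls; this is done by
    duality, pairing differences of trajectories with solutions of the linear adjoint equation and
    using dominated convergence. Equations are solved on intervals so short that the integral of the
    Lipschitz constant is at most 1/2, up to dimensional factors: Picard iteration then contracts at
    once, and Gronwall inequalities need no exponential, only evaluation at a maximum. *)

Notation ACon := absolutely_continuous_on.

(** * Absolutely continuous curves and a monotonicity criterion by right increments *)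

Section absolute_continuity.
Context {R : realType}.
Implicit Types V W : normedModType R.

(** The closure properties used below (Lipschitz images, differences, pairings) are instances: in
    each of them an increment of [h] is bounded by increments of [f] and [g]. *)
Lemma ACon_dom V W V' (f : R -> V) (g : R -> W) (h : R -> V') (K a b : R) :
  ACon a b f -> ACon a b g ->
  (forall s t, a <= s -> s <= t -> t <= b ->
    `|h t - h s| <= K * (`|f t - f s| + `|g t - g s|)) ->
  ACon a b h.
Proof.
move=> ACf ACg hfg e e0.
pose K' := `|K| + 1.
have K0 : 0 < K' by rewrite ltr_wpDl.
have e20 : 0 < e / (2 * K') by rewrite divr_gt0// mulr_gt0.
have [d1 d10 H1] := ACf _ e20; have [d2 d20 H2] := ACg _ e20.
exists (Num.min d1 d2); first by rewrite lt_min d10.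
move=> k l r lr dis; rewrite lt_min => /andP[s1 s2].
have := H1 k l r lr dis s1; have := H2 k l r lr dis s2.
move=> G2 G1.
apply: (@le_lt_trans _ _ (K' * (\sum_i `|f (r i) - f (l i)| + \sum_i `|g (r i) - g (l i)|))).
  rewrite -big_split/= mulr_sumr; apply: ler_sum => i _.
  have [? ? ?] := lr i; apply: le_trans (hfg _ _ _ _ _) _ => //.
  by rewrite ler_wpM2r ?addr_ge0// /K' (le_trans (ler_norm K))// lerDl.
rewrite mulrC -ltr_pdivlMr//; apply: lt_le_trans (ltrD G1 G2) _.
by rewrite le_eqVlt; apply/orP; left; apply/eqP; field; rewrite gt_eqF.
Qed.

Lemma ACon_lip V W (f : R -> V) (g : R -> W) (K a b : R) :
  ACon a b f ->
  (forall s t, a <= s -> s <= t -> t <= b -> `|g t - g s| <= K * `|f t - f s|) ->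
  ACon a b g.
Proof.
move=> ACf gf; apply: (ACon_dom (K := `|K|) ACf ACf) => s t as_ st tb.
rewrite (le_trans (gf _ _ as_ st tb))// (le_trans (ler_wpM2r _ (ler_norm K)))//.
by rewrite ler_wpM2l// lerDl.
Qed.

Lemma ACon_eq V (f g : R -> V) (a b : R) :
  (forall t, a <= t -> t <= b -> f t = g t) -> ACon a b f -> ACon a b g.
Proof.
move=> fg ACf; apply: (ACon_lip (K := 1) ACf).
by move=> s t as_ st tb; rewrite mul1r !fg// ?(le_trans as_)// (le_trans st).
Qed.

Lemma ACon_sub V (f : R -> V) (a b a' b' : R) :
  a <= a' -> b' <= b -> ACon a b f -> ACon a' b' f.
Proof.
move=> aa' bb' ACf e e0; have [d d0 H] := ACf e e0; exists d => // k l r lr dis.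
by apply: H => // i; have [? ? ?] := lr i; split; [exact: le_trans aa' _| |exact: le_trans bb'].
Qed.

Lemma ACon_shift V (f : R -> V) (a b c : R) :
  ACon (a + c) (b + c) f -> ACon a b (fun t => f (t + c)).
Proof.
move=> ACf e e0; have [d d0 H] := ACf e e0; exists d => // k l r lr dis sd.
apply: (H k (fun i => l i + c) (fun i => r i + c)).
- by move=> i; have [? ? ?] := lr i; rewrite !lerD2r.
- by move=> i j ij; rewrite !lerD2r; exact: dis.
- by under eq_bigr do rewrite opprD addrACA subrr addr0.
Qed.

Lemma ACon_cat V (f : R -> V) (a c b : R) : a <= c -> c <= b ->
  ACon a c f -> ACon c b f -> ACon a b f.
Proof.
move=> ac cb AC1 AC2 e e0.
have e20 : 0 < e / 2 by rewrite divr_gt0.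
have [d1 d10 H1] := AC1 _ e20; have [d2 d20 H2] := AC2 _ e20.
exists (Num.min d1 d2); first by rewrite lt_min d10.
move=> k l r lr dis; rewrite lt_min => /andP[s1 s2].
(* Clipping at [c] splits the family into one in [[a, c]] and one in [[c, b]]. Clipping is monotone
   and 1-Lipschitz, so it keeps the intervals apart and does not increase the total length. *)
have S1 : \sum_i (Num.min (r i) c - Num.min (l i) c) < d1.
  apply: le_lt_trans s1; apply: ler_sum => i _; have [_ + _] := lr i.
  by clear; rewrite /Num.min; case: ltP => ?; case: ltP => ? ?; lra.
have S2 : \sum_i (Num.max (r i) c - Num.max (l i) c) < d2.
  apply: le_lt_trans s2; apply: ler_sum => i _; have [_ + _] := lr i.
  by clear; rewrite /Num.max; case: ltP => ?; case: ltP => ? ?; lra.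
have {}S1 := H1 k (fun i => Num.min (l i) c) (fun i => Num.min (r i) c) _ _ S1.
have {}S2 := H2 k (fun i => Num.max (l i) c) (fun i => Num.max (r i) c) _ _ S2.
apply: (@le_lt_trans _ _ (\sum_i `|f (Num.min (r i) c) - f (Num.min (l i) c)| +
  \sum_i `|f (Num.max (r i) c) - f (Num.max (l i) c)|)).
  rewrite -big_split; apply: ler_sum => i _ /=.
  have [_ lri _] := lr i; rewrite /Num.min /Num.max.
  have [rc|rc] := ltP (r i) c.
    by rewrite (le_lt_trans lri rc) subrr normr0 addr0.
  have [lc|lc] := ltP (l i) c; last by rewrite subrr normr0 add0r.
  by rewrite addrC -[in leLHS](subrKA (f c)) ler_normD.
rewrite (splitr e) ltrD//.
- apply: S1 => [i|i j ij]; have [al lri rb] := lr i.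
    by rewrite !le_min !ge_min al ac lri !lexx !orbT.
  rewrite !le_min !ge_min !lexx !orbT !andbT.
  by have [->|->] := dis _ _ ij; [left|right].
- apply: S2 => [i|i j ij]; have [al lri rb] := lr i.
    by rewrite !ge_max !le_max rb cb lri !lexx !orbT.
  rewrite !ge_max !le_max !lexx !orbT !andbT.
  by have [->|->] := dis _ _ ij; [left|right].
Qed.

Lemma ACon_cont V (f : R -> V) (a b : R) : ACon a b f ->
  forall e, 0 < e -> exists2 d, 0 < d &
  forall s t, a <= s -> s <= t -> t <= b -> t - s < d -> `|f t - f s| < e.
Proof.
move=> ACf e e0; have [d d0 H] := ACf e e0; exists d => // s t as_ st tb tsd.
have := H 1%N (fun=> s) (fun=> t); rewrite !big_ord1; apply => //.
by move=> i j; rewrite !ord1 eqxx.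
Qed.

(** A selection of successive intervals of [[a, t]] lying in [O], with total length [L] and total
    absolute increment [S]. It grows with [t], as the supremum argument of [ACon_dini_le] requires;
    [chain_family] recovers the indexed families of [ACon]. *)
Inductive chain V (O : set R) (f : R -> V) (a : R) : R -> R -> R -> Prop :=
| chain0 : chain O f a a 0 0
| chain_skip t s L S : chain O f a t L S -> t <= s -> chain O f a s L S
| chain_add t s L S : chain O f a t L S -> t <= s ->
    (forall x, t <= x -> x <= s -> O x) ->
    chain O f a s (L + (s - t)) (S + `|f s - f t|).

Lemma chain_ge V O (f : R -> V) a t L S : chain O f a t L S -> a <= t.
Proof. by elim=> // {t L S} t s ? ? _ /le_trans h; [exact: h|move=> /h]. Qed.

Lemma chain_family V O (f : R -> V) a t L S : chain O f a t L S ->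
  exists k (l r : 'I_k -> R),
  [/\ forall i, [/\ a <= l i, l i <= r i & r i <= t],
      forall i j, i != j -> r i <= l j \/ r j <= l i,
      \sum_i (r i - l i) = L & \sum_i `|f (r i) - f (l i)| = S].
Proof.
elim=> {t L S}.
- exists 0%N, (fun=> 0), (fun=> 0); rewrite !big_ord0; split => //.
  by case. by case.
- move=> t s L S ch [k [l [r [lr dis HL HS]]]] ts; exists k, l, r; split => // i.
  by have [? ? rt] := lr i; split => //; exact: le_trans ts.
- move=> t s L S ch [k [l [r [lr dis HL HS]]]] ts _.
  exists k.+1, (fun i => oapp l t (unlift ord0 i)), (fun i => oapp r s (unlift ord0 i)).
  split.
  + move=> i; case: unliftP => [j _|_] /=; last by split => //; exact: chain_ge ch.
    by have [? ? rt] := lr j; split => //; exact: le_trans ts.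
  + move=> i j; case: unliftP => [i' ->|->]; case: unliftP => [j' ->|->] //=.
    * by rewrite (inj_eq lift_inj); exact: dis.
    * by left; have [] := lr i'.
    * by right; have [] := lr j'.
  + rewrite big_ord_recl unlift_none/= -HL addrC; congr (_ + _).
    by apply: eq_bigr => i _; rewrite liftK.
  + rewrite big_ord_recl unlift_none/= -HS addrC; congr (_ + _).
    by apply: eq_bigr => i _; rewrite liftK.
Qed.

Notation mu := (@lebesgue_measure R).

(** With [[a, t[] half-open, an added interval is disjoint from the previous ones, so lengths add up
    exactly. *)
Lemma chain_measure V O (f : R -> V) a t L S : open O -> chain O f a t L S ->
  (L%:E <= mu (O `&` `[a, t[))%E.
Proof.
move=> oO; have mO : measurable O by exact: open_measurable.
have mI x y : measurable (O `&` `[x, y[) by apply: measurableI.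
elim=> {t L S}.
- by rewrite measure_ge0.
- move=> t s L S _ ih ts; apply: le_trans ih _; apply: le_measure; [by rewrite inE; exact: mI|by rewrite inE; exact: mI|].
  by move=> x/= [Ox]; rewrite !in_itv/= => /andP[-> /= xt]; split => //; exact: lt_le_trans ts.
- move=> t s L S ch ih ts tsO.
  have -> : O `&` `[a, s[ = (O `&` `[a, t[) `|` `[t, s[.
    apply/seteqP; split=> x/=; rewrite !in_itv/=.
      by move=> [Ox /andP[ax xs]]; have [xt|tx] := ltP x t; [left; rewrite ax|right].
    case=> [[Ox /andP[-> xt]]|/andP[tx xs]]; first by rewrite (lt_le_trans xt).
    by split; [apply: tsO => //; exact: ltW|rewrite xs (le_trans (chain_ge ch))].
  have dis : (O `&` `[a, t[) `&` `[t, s[ = set0.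
    apply/seteqP; split=> x//=; rewrite !in_itv/= => -[[_ /andP[_ xt]] /andP[tx _]].
    by move: (lt_le_trans xt tx); rewrite ltxx.
  rewrite (measureU mu (mI a t) (measurable_itv `[t, s[) dis).
  rewrite EFinD leeD//= lebesgue_measure_itv/=.
  move: ts; rewrite le_eqVlt => /predU1P[->|ts]; first by rewrite subrr ltxx.
  by rewrite lte_fin ts -EFinB.
Qed.

(* The null set where the derivative is not controlled lies in an open set of
   small measure, over which absolute continuity bounds the increments. *)
Lemma ACon_dini_le (f : R -> R) (a b : R) : a <= b -> ACon a b f ->
  {ae mu, forall t, a <= t -> t < b -> forall e, 0 < e ->
    exists2 h, 0 < h & forall s, t <= s -> s < t + h -> s <= b ->
      f s - f t <= e * (s - t)} ->
  f b <= f a.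
Proof.
move=> ab ACf [Z [mZ Z0 ZP]].
apply/ler_addgt0Pr => e0 e0p.
(* A third of [e0] for each error: the slope [e] over [[a, b]], the increments over the chain, and
   the slack [eta]. *)
pose e := e0 / (3 * (b - a + 1)).
have ba : 0 < b - a + 1 by rewrite ltr_wpDl// subr_ge0.
have e_gt0 : 0 < e by rewrite divr_gt0// mulr_gt0.
have e03 : 0 < e0 / 3 by rewrite divr_gt0.
have [d d0 Hd] := ACf _ e03.
have [ O [oO ZO Od]] : exists O : set R, [/\ open O, Z `<=` O & (mu O < d%:E)%E].
  have Zy : (mu Z < +oo)%E by rewrite Z0 ltry.
  have [ O [oO ZO Od]] := lebesgue_regularity_outer mZ Zy d0.
  exists O; split => //; rewrite -(setDUK ZO).
  have mOZ : measurable (O `\` Z) by apply: measurableD => //; exact: open_measurable.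
  by rewrite (measureU mu mZ mOZ (setDIK _ _)) [X in (X + _)%E]Z0 add0e.
(* The slack [eta] makes [good] stable under limits from the left. *)
pose good t := forall eta, 0 < eta -> exists L S, chain O f a t L S /\
  f t - f a <= e * (t - a) + S + eta.
have goodb : good b -> f b <= f a + e0.
  move=> /(_ _ e03)[L [S [ch H]]].
  have [k [l [r [lr dis HL HS]]]] := chain_family ch.
  have : L < d.
    rewrite -lte_fin; apply: le_lt_trans Od; apply: le_trans (chain_measure oO ch) _.
    have mO : measurable O by exact: open_measurable.
    by apply: le_measure; [rewrite inE; exact: measurableI|rewrite inE|exact: subIsetl].
  rewrite -HL => /(Hd k l r lr dis); rewrite HS => Se.
  have : e * (b - a) <= e0 / 3.
    rewrite /e; have -> : e0 / (3 * (b - a + 1)) * (b - a) = e0 / 3 * ((b - a) / (b - a + 1)).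
      by field; rewrite gt_eqF.
    rewrite ler_piMr ?(ltW e03)// ler_pdivrMr// mul1r lerDl//.
  lra.
apply: goodb.
have goodext t s : good t -> t <= s ->
    (forall eta, 0 < eta -> exists2 t', [/\ a <= t', t' <= s & good t'] &
      (forall x, t' <= x -> x <= s -> O x) \/ f s - f t' <= e * (s - t') + eta) -> good s.
  move=> gt ts H eta eta0.
  have eta20 : 0 < eta / 2 by rewrite divr_gt0.
  have [t' [at' t's /(_ _ eta20)[L [S [ch HS]]]] [oo|dd]] := H _ eta20.
    exists (L + (s - t')), (S + `|f s - f t'|); split; first exact: chain_add.
    have := ler_norm (f s - f t').
    have : 0 <= e * (s - t') by rewrite mulr_ge0 ?subr_ge0// ltW.
    have -> : e * (s - a) = e * (t' - a) + e * (s - t') by ring.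
    lra.
  exists L, S; split; first exact: chain_skip ch _.
  have -> : e * (s - a) = e * (t' - a) + e * (s - t') by ring.
  lra.
pose E := [set t | a <= t /\ t <= b /\ good t].
have Ea : E a.
  rewrite /E/=; split => //; split => // eta eta0; exists 0, 0; split; first exact: chain0.
  by rewrite !subrr mulr0 !add0r ltW.
have hE : has_sup E by split; [exists a|exists b => x [_ []]].
pose c := sup E.
have ac : a <= c by apply: sup_upper_bound.
have cb : c <= b by apply: sup_le_ub => //; [exists a|move=> x [_ []]].
(* Good points accumulate at [c] from the left; by continuity the last increment is absorbed in the
   slack. *)
have gc : good c.
  apply: (goodext a) => //; first by case: Ea => _ [].
  move=> eta eta0; have [d' d'0 Hc] := ACon_cont ACf eta0.
  have [t' [at' [t'b gt']] ct'] := sup_adherent d'0 hE.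
  have t'c : t' <= c by apply: sup_upper_bound => //; split.
  exists t' => //; right.
  have := Hc t' c at' t'c cb; rewrite -/c in ct' *.
  have h : c - t' < d' by lra.
  move=> /(_ h) /ltW/(le_trans (ler_norm _)) h'.
  by rewrite (le_trans h')// lerDr mulr_ge0 ?subr_ge0// ltW.
move: cb; rewrite le_eqVlt => /predU1P[cE|cb]; first by move: gc; rewrite cE.
exfalso.
suff [s cs [sb gs]] : exists2 s, c < s & s <= b /\ good s.
  have : s <= c by apply: sup_upper_bound => //; split => //; rewrite (le_trans ac)// ltW.
  by rewrite leNgt cs.
(* Either way one gets beyond [c]: at an exceptional time by adding to the chain an interval of [O],
   at any other time by the hypothesis on right increments. *)
have [Zc|nZc] := pselect (Z c).
  have Oc : O c by exact: ZO.
  have /nbhs_ballP[h/= h0 hO] : nbhs c O by exact: open_nbhs_nbhs.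
  pose s := Num.min b (c + h / 2).
  have cs : c < s by rewrite lt_min cb ltrDl divr_gt0.
  have sb : s <= b by rewrite ge_min lexx.
  have sh : s <= c + h / 2 by rewrite ge_min lexx orbT.
  exists s => //; split => //; apply: (goodext c) => //; first exact: ltW.
  move=> eta eta0; exists c; first by split => //; exact: ltW.
  left=> x cx xs; apply: hO; rewrite /ball/= ltr_norml; apply/andP; split; lra.
have [h h0 Hh] : exists2 h, 0 < h & forall s, c <= s -> s < c + h -> s <= b ->
      f s - f c <= e * (s - c).
  have [P|nP] := pselect (forall t, t = c -> forall e, 0 < e ->
    exists2 h, 0 < h & forall s, t <= s -> s < t + h -> s <= b -> f s - f t <= e * (s - t)).
    exact: P.
  exfalso; apply: nZc; apply: ZP => /= H; apply: nP => t ->; exact: H.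
pose s := Num.min b (c + h / 2).
have cs : c < s by rewrite lt_min cb ltrDl divr_gt0.
have sb : s <= b by rewrite ge_min lexx.
have sh : s <= c + h / 2 by rewrite ge_min lexx orbT.
exists s => //; split => //; apply: (goodext c) => //; first exact: ltW.
move=> eta eta0; exists c; first by split => //; exact: ltW.
right; rewrite (le_trans (Hh s _ _ sb)) ?lerDl ?(ltW cs) ?(ltW eta0)//.
by rewrite (le_lt_trans sh)// ltrD2l; lra.
Qed.
End absolute_continuity.

(** * Row vectors and derivatives, coordinate by coordinate *)

Section row_norm.
Context {R : realType} {n : nat}.
Implicit Types x y : 'rV[R]_n.

Lemma rV_norm_coord x j : `|x 0 j| <= `|x|.
Proof.
rewrite [leRHS]/Num.Def.normr/= mx_normrE.
exact: (le_bigmax _ (fun ij => `|x ij.1 ij.2|) (0, j)).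
Qed.

Lemma rV_norm_le x (c : R) : 0 <= c -> (forall j, `|x 0 j| <= c) -> `|x| <= c.
Proof.
move=> c0 H; rewrite /Num.Def.normr/= mx_normrE; apply: bigmax_le => // -[i j] _ /=.
by rewrite ord1; exact: H.
Qed.

Lemma is_derive_coord (f : R -> 'rV[R]_n) (t : R) (d : 'rV[R]_n) j :
  is_derive t (1:R) f d -> is_derive t (1:R) (fun s => f s 0 j) (d 0 j).
Proof.
move=> [df dfE]; split; first by move/derivable_mxP : df; exact.
by have := derive_mx df; rewrite dfE => ->; rewrite mxE.
Qed.

Lemma is_derive_rV (f : R -> 'rV[R]_n) (t : R) (d : 'rV[R]_n) :
  (forall j, is_derive t (1:R) (fun s => f s 0 j) (d 0 j)) -> is_derive t (1:R) f d.
Proof.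
move=> H; have df : derivable f t (1:R).
  by apply/derivable_mxP => i j; rewrite ord1; have [] := H j.
split => //; rewrite derive_mx//; apply/rowP => j; rewrite !mxE.
by have [_ ->] := H j.
Qed.

End row_norm.

Section right_increments.
Context {R : realType} {V : normedModType R}.

Lemma is_derive_increment (f : R -> V) (t : R) (d : V) : is_derive t (1:R) f d ->
  forall e, 0 < e -> exists2 h, 0 < h & forall s, `|s - t| < h ->
    `|f s - f t - (s - t) *: d| <= e * `|s - t|.
Proof.
move=> [df dfE] e e0; have /cvgrPdist_le/(_ e e0) : h^-1 *: (f (h + t) - f t) @[h --> 0^'] --> d.
  rewrite -dfE; apply: cvg_trans df; apply: near_eq_cvg; near=> h.
  by rewrite /= [X in f (X + _)]mulr1.
rewrite near_withinE => /nbhs_ballP[h/= h0 H]; exists h => // s sth.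
have [->|st] := eqVneq s t; first by rewrite !subrr scale0r subrr !normr0 mulr0.
have st0 : s - t != 0 by rewrite subr_eq0.
have := H (s - t); rewrite /ball/= sub0r normrN sth => /(_ isT st0).
rewrite subrK => Hd.
rewrite -(normrN (_ - _ - _)) opprB.
have -> : (s - t) *: d - (f s - f t) = (s - t) *: (d - (s - t)^-1 *: (f s - f t)).
  by rewrite scalerBr scalerA divff// scale1r.
by rewrite normrZ mulrC ler_wpM2r.
Unshelve. all: by end_near. Qed.

End right_increments.

(** * Primitives of Lebesgue integrable functions *)

Section primitive.
Context {R : realType}.
Notation mu := (@lebesgue_measure R).
Implicit Types (l h : R -> R).

Definition integrableR l := mu.-integrable setT (EFin \o l).

Definition prim l (t : R) : R := (\int[mu]_(x in `]-oo, t]) l x)%R.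

Lemma integrableR_sub l (A : set R) : measurable A -> integrableR l ->
  mu.-integrable A (EFin \o l).
Proof. by move=> mA; apply: integrableS. Qed.

Lemma primB l s t : integrableR l -> s <= t ->
  prim l t - prim l s = (\int[mu]_(x in `]s, t]) l x)%R.
Proof.
by move=> il st; apply: Rintegral_itvB; rewrite ?bnd_simp//; exact: integrableR_sub.
Qed.

Lemma prim_le l s t : integrableR l -> (forall x, 0 <= l x) -> s <= t ->
  prim l s <= prim l t.
Proof. by move=> il l0 st; rewrite -subr_ge0 primB//; apply: Rintegral_ge0. Qed.

Lemma prim_dom h l s t : integrableR l -> integrableR h ->
  (forall x, `|h x| <= l x) -> s <= t ->
  `|prim h t - prim h s| <= prim l t - prim l s.
Proof.
move=> il ih hl st; rewrite !primB//.
apply: le_trans (le_normr_Rintegral _ _) _ => //; first exact: integrableR_sub.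
apply: le_Rintegral => //; last exact: integrableR_sub.
have := integrableR_sub (measurable_itv `]s, t]) ih => /integrable_norm.
by [].
Qed.

Lemma primBT l s t : integrableR l -> (forall x, 0 <= l x) -> s <= t ->
  prim l t - prim l s <= (\int[mu]_x l x)%R.
Proof.
move=> il l0 st; rewrite primB// -lee_fin /Rintegral !fineK; last 2 first.
- exact: integrable_fin_num.
- by apply: integrable_fin_num => //; exact: integrableR_sub.
apply: ge0_subset_integral => //.
  by case/integrableP : il.
by move=> x _; rewrite lee_fin.
Qed.

Lemma prim_derive l : integrableR l ->
  {ae mu, forall t, is_derive t (1:R) (prim l) (l t)}.
Proof.
move=> il; have := @FTC1Ny R l; have : locally_integrable [set: R] l.
  by apply: open_integrable_locally => //; exact: openT.
move=> ll /(_ (fun y => integrableR_sub (measurable_itv `]-oo, y]) il) ll)/=.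
apply: filterS; first exact: (ae_filter_ringOfSetsType mu).
by move=> t [dt dtE]; split => //; rewrite -derive1E.
Qed.

Lemma prim_ACon l (a b : R) : integrableR l -> ACon a b (prim l).
Proof.
move=> il e e0; have [d [d0 Hd]] := integral_normr_continuous il e0.
exists d => // k L r lr dis sd.
(* Half-open, so that two intervals sharing an end are disjoint. *)
pose F i := `]L i, r i]%classic.
pose D := \big[setU/set0]_(i < k) F i.
have tF : trivIset setT F.
  apply/trivIsetP => i j _ _ ij; apply/seteqP; split=> x//=.
  rewrite /F/= !in_itv/= => -[/andP[? ?] /andP[? ?]].
  by have [?|?] := dis _ _ ij; lra.
have mF i : measurable (F i) by exact: measurable_itv.
have mD : measurable D by apply: bigsetU_measurable.
have muD : (mu D < d%:E)%E.
  have muF i : mu (F i) = (r i - L i)%:E.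
    rewrite /F lebesgue_measure_itv/=; have [_ + _] := lr i.
    by rewrite lte_fin le_eqVlt => /predU1P[->|->//]; rewrite subrr ltxx.
  rewrite /D (measure_bigsetU_ord mu _ mF tF).
  by rewrite (eq_bigr _ (fun i _ => muF i)) sumEFin lte_fin.
have ln : integrableR (fun x => `|l x|) by exact: (integrable_norm il).
apply: le_lt_trans (Hd D mD muD).
have -> : (\int[mu]_(x in D) `|l x|)%R = \sum_i (\int[mu]_(x in F i) `|l x|)%R.
  rewrite /Rintegral /D.
  have -> : (\int[mu]_(x in \big[setU/set0]_(i < k) F i) `|l x|%:E =
     \sum_(i < k) \int[mu]_(x in F i) `|l x|%:E)%E.
    rewrite ge0_integral_bigsetU//=.
    - exact: index_enum_uniq.
    - exact: sub_trivIset tF.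
    - by apply: measurable_funTS; case/integrableP : ln.
  rewrite sum_fine// => i _; apply: integrable_fin_num.
    exact: mF.
  exact: (integrableR_sub (mF i) ln).
apply: ler_sum => i _; have [_ lri _] := lr i; rewrite primB//.
by apply: le_normr_Rintegral => //; exact: integrableR_sub.
Qed.

End primitive.

(** * Growth bounds and Gronwall inequalities *)

Section growth.
Context {R : realType}.
Notation mu := (@lebesgue_measure R).
Implicit Types (l w : R -> R).

Lemma ae_neq (a : R) : {ae mu, forall t, t != a}.
Proof.
exists [set a]; split; [exact: measurable_set1|exact: lebesgue_measure_set1|].
by move=> t/= /negP; rewrite negbK => /eqP.
Qed.

Lemma ae_and (P Q : R -> Prop) : {ae mu, forall t, P t} -> {ae mu, forall t, Q t} ->
  {ae mu, forall t, P t /\ Q t}.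
Proof.
move=> hP hQ; apply: (filterS2 _ _ hP hQ); first exact: (ae_filter_ringOfSetsType mu).
by [].
Qed.

Lemma ae_mono (P Q : R -> Prop) : (forall t, P t -> Q t) ->
  {ae mu, forall t, P t} -> {ae mu, forall t, Q t}.
Proof. by move=> PQ; apply: filterS => //; exact: (ae_filter_ringOfSetsType mu). Qed.

(** Almost everywhere [prim w] has derivative [w], so [ACon_dini_le] applies to [f - prim w]. Right
    increments replace derivatives because the lemma serves for norms and for the squared distance
    to a set, which may fail to be differentiable. *)
Lemma ACon_growth (f w : R -> R) a b : a <= b -> ACon a b f -> integrableR w ->
  {ae mu, forall t, a < t -> t < b -> forall e, 0 < e ->
    exists2 h, 0 < h & forall s, t <= s -> s < t + h -> s <= b ->
      f s - f t <= (w t + e) * (s - t)} ->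
  f b - f a <= prim w b - prim w a.
Proof.
move=> ab ACf iw H.
suff : f b - prim w b <= f a - prim w a by lra.
apply: (@ACon_dini_le _ (fun t => f t - prim w t)) => //.
  apply: (ACon_dom (K := 1) ACf (prim_ACon a b iw)) => s t _ _ _.
  have -> : f t - prim w t - (f s - prim w s) = (f t - f s) - (prim w t - prim w s) by ring.
  by rewrite mul1r ler_normB.
have := ae_and (ae_neq a) (ae_and H (prim_derive iw)).
apply: ae_mono => t [ta [Ht dt]] at_ tb e e0.
have e20 : 0 < e / 2 by rewrite divr_gt0.
have {}at_ : a < t by rewrite lt_neqAle eq_sym ta.
have [h h0 Hh] := Ht at_ tb _ e20.
have [h' h'0 Hh'] := is_derive_increment dt e20.
exists (Num.min h h'); first by rewrite lt_min h0.
move=> s ts sh sb.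
have sh1 : s < t + h by rewrite (lt_le_trans sh)// lerD2l ge_min lexx.
have sh2 : s < t + h' by rewrite (lt_le_trans sh)// lerD2l ge_min lexx orbT.
have st0 : 0 <= s - t by rewrite subr_ge0.
have := Hh s ts sh1 sb.
have : `|s - t| < h' by rewrite ger0_norm// ltrBlDl.
move=> /Hh'; rewrite (ger0_norm st0) ler_norml => /andP[+ _].
rewrite /GRing.scale/=; set x := s - t.
set p := prim w s; set q := prim w t; set c := w t => h1 h2.
have -> : f s - p - (f t - q) = (f s - f t) - (p - q) by ring.
have h3 : (c + e / 2) * x = x * c + e / 2 * x by ring.
have h4 : e * x = e / 2 * x + e / 2 * x by field.
move: h1 h2 h3 h4; lra.
Qed.

(** The scalar function [|f t - f a|] grows at most as fast as the norm of [f']. *)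
Lemma ACon_derive_bound (V : normedModType R) (f f' : R -> V) w a b :
  a <= b -> ACon a b f -> integrableR w ->
  {ae mu, forall t, a < t -> t < b -> is_derive t (1:R) f (f' t) /\ `|f' t| <= w t} ->
  `|f b - f a| <= prim w b - prim w a.
Proof.
move=> ab ACf iw H.
suff : `|f b - f a| - `|f a - f a| <= prim w b - prim w a by rewrite subrr normr0 subr0.
apply: (@ACon_growth (fun t => `|f t - f a|)) => //.
  apply: (ACon_lip (K := 1) ACf) => s t _ _ _; rewrite mul1r.
  have -> : f t - f s = (f t - f a) - (f s - f a) by rewrite opprB addrA subrK.
  exact: ler_dist_dist.
apply: ae_mono H => t Ht at_ tb e e0; have [dt wt] := Ht at_ tb.
have [h h0 Hh] := is_derive_increment dt e0.
exists h => // s ts sh sb.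
have st0 : 0 <= s - t by rewrite subr_ge0.
have := Hh s; rewrite ger0_norm// ltrBlDl => /(_ sh) Hs.
have : `|f s - f a| - `|f t - f a| <= `|f s - f t|.
  by rewrite lerBlDr -[in leLHS](subrKA (f t)) ler_normD.
move=> /le_trans; apply.
rewrite -[f s - f t](subrK ((s - t) *: f' t)) (le_trans (ler_normD _ _))//.
rewrite mulrDl addrC lerD// normrZ ger0_norm// mulrC ler_wpM2r//.
Qed.

Lemma ACon_continuous (V : normedModType R) (f : R -> V) a b : ACon a b f ->
  {within `[a, b], continuous f}.
Proof.
move=> ACf; apply/subspace_continuousP => x; rewrite /= in_itv/= => /andP[ax xb].
apply/cvgrPdist_lt => e e0; have [d d0 H] := ACon_cont ACf e0.
rewrite near_withinE; apply/nbhs_ballP; exists d => // y; rewrite /ball/= => xy.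
rewrite in_itv/= => /andP[ay yb].
have [xley|yltx] := leP x y.
  rewrite distrC; apply: H => //.
  by move: xy; rewrite distrC ger0_norm// subr_ge0.
by apply: H => //; [exact: ltW|move: xy; rewrite gtr0_norm// subr_gt0].
Qed.

Lemma integrableRZ k w : integrableR w -> integrableR (fun t => k * w t).
Proof. by move=> iw; exact: (integrableZl measurableT k iw). Qed.

Lemma primZ k w s t : integrableR w -> s <= t ->
  prim (fun t => k * w t) t - prim (fun t => k * w t) s = k * (prim w t - prim w s).
Proof.
move=> iw st; rewrite !primB//; last exact: integrableRZ.
by rewrite RintegralZl//; exact: integrableR_sub.
Qed.

(** At a maximum [c] of [f], the growth bound gives [f c <= f c * (prim l c - prim l a) <= f c / 2],
    hence [f c <= 0]. *)
Lemma gronwall0 (f l : R -> R) a b : a <= b -> ACon a b f ->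
  integrableR l -> (forall t, 0 <= l t) -> prim l b - prim l a <= 2^-1 ->
  (forall t, 0 <= f t) -> f a = 0 ->
  {ae mu, forall t, a < t -> t < b -> forall e, 0 < e ->
    exists2 h, 0 < h & forall s, t <= s -> s < t + h -> s <= b ->
      f s - f t <= (l t * f t + e) * (s - t)} ->
  forall t, a <= t -> t <= b -> f t = 0.
Proof.
move=> ab ACf il l0 l2 f0 fa H.
have [c cab cmax] := EVT_max ab (ACon_continuous ACf).
have /andP[ac cb] : a <= c <= b by move: cab; rewrite in_itv.
have : f c - f a <= prim (fun t => f c * l t) c - prim (fun t => f c * l t) a.
  apply: ACon_growth => //; [exact: ACon_sub ACf|exact: integrableRZ|].
  apply: ae_mono H => t Ht at_ tc e e0.
  have [h h0 Hh] := Ht at_ (lt_le_trans tc cb) _ e0.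
  exists h => // s ts sth sc; apply: le_trans (Hh s ts sth (le_trans sc cb)) _.
  rewrite ler_wpM2r ?subr_ge0// lerD2r mulrC ler_wpM2r//.
  by apply: cmax; rewrite in_itv/= ltW//= ltW// (lt_le_trans tc).
rewrite primZ// fa subr0.
have h1 : prim l c - prim l a <= 2^-1.
  by apply: le_trans l2; rewrite lerD2r prim_le.
move=> h2; have fc0 : f c <= 0.
  have := ler_wpM2l (f0 c) h1; move: h2.
  set u := f c * (_ - _) => h2 h3; lra.
move=> t at_ tb; apply/eqP; rewrite eq_le f0 andbT (le_trans _ fc0)// cmax//.
by rewrite in_itv/= at_.
Qed.

(** If [d] is a maximum of [|y|], then [|y d - y c|] is at most [|y d| / 2], whence the factor 2.
    The reference time [c] may come before or after [t], which allows comparison from the end of the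
    interval. *)
Lemma gronwall2 (V : normedModType R) (y y' : R -> V) (l : R -> R) a b : a <= b -> ACon a b y ->
  integrableR l -> (forall t, 0 <= l t) -> prim l b - prim l a <= 2^-1 ->
  {ae mu, forall t, a < t -> t < b ->
     is_derive t (1:R) y (y' t) /\ `|y' t| <= l t * `|y t|} ->
  forall c t, a <= c -> c <= b -> a <= t -> t <= b -> `|y t| <= 2 * `|y c|.
Proof.
move=> ab ACy il l0 l2 H.
have ACny : ACon a b (fun t => `|y t|).
  by apply: (ACon_lip (K := 1) ACy) => s t _ _ _; rewrite mul1r ler_dist_dist.
have [d dab dmax] := EVT_max ab (ACon_continuous ACny).
have /andP[ad db] : a <= d <= b by move: dab; rewrite in_itv.
have B s t : a <= s -> s <= t -> t <= b -> `|y t - y s| <= `|y d| / 2.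
  move=> as_ st tb.
  apply: (@le_trans _ _ (prim (fun t => `|y d| * l t) t - prim (fun t => `|y d| * l t) s)).
    apply: (@ACon_derive_bound _ y y') => //; [exact: ACon_sub ACy|exact: integrableRZ|].
    apply: ae_mono H => x Hx sx xt.
    have ax := le_lt_trans as_ sx; have xb := lt_le_trans xt tb.
    have [dx yx] := Hx ax xb; split => //; apply: le_trans yx _.
    by rewrite mulrC ler_wpM2r// dmax// in_itv/= !ltW.
  rewrite primZ// ler_wpM2l//; apply: le_trans l2.
  by have := prim_le il l0 tb; have := prim_le il l0 as_; lra.
move=> c t ac cb at_ tb; apply: (@le_trans _ _ `|y d|).
  by apply: dmax; rewrite in_itv/= at_.
have : `|y d - y c| <= `|y d| / 2.
  by have [cd|/ltW dc] := leP c d; [exact: B|rewrite distrC; exact: B].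
have := lerB_dist (y d) (y c); lra.
Qed.

End growth.

(** * Picard iteration for Caratheodory equations *)

Section caratheodory_existence.
Context {R : realType}.
Notation mu := (@lebesgue_measure R).

Lemma cvg_of_rate (n : nat) (u : nat -> 'rV[R]_n) (e : nat -> R) :
  e @ \oo --> (0 : R) -> (forall k m, (k <= m)%N -> `|u m - u k| <= e k) ->
  exists v : 'rV[R]_n, u @ \oo --> v /\ forall k, `|v - u k| <= e k.
Proof.
move=> e0 ue; have cu : cvg (u @ \oo).
  apply/cauchy_cvgP; apply: cauchy_exP => eps eps0.
  have [k _ Hk] : \forall k \near \oo, `|e k| < eps.
    by have /cvgr0Pnorm_lt/(_ _ eps0) := e0.
  exists (u k); suff : \forall m \near \oo, ball (u k) eps (u m) by [].
  near=> m; rewrite -ball_normE/= distrC.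
  apply: le_lt_trans (ue k m _) (le_lt_trans (ler_norm _) (Hk k (leqnn k))).
  by near: m; exists k.
exists (lim (u @ \oo)); split => // k.
have : (fun m => `|u m - u k|) @ \oo --> `|lim (u @ \oo) - u k|.
  by apply: cvg_norm; apply: cvgB => //; exact: cvg_cst.
move=> /cvg_lim <-//; apply: limr_le.
  by apply/cvg_ex; exists `|lim (u @ \oo) - u k|; apply: cvg_norm; apply: cvgB => //; exact: cvg_cst.
by exists k => // m /= km; exact: ue.
Unshelve. all: by end_near. Qed.

Variable n : nat.
Implicit Types (l : R -> R) (f : R -> 'rV[R]_n -> 'rV[R]_n) (xi : R -> 'rV[R]_n).

Definition rV_measurable (xi : R -> 'rV[R]_n) :=
  forall j, measurable_fun setT (fun t => xi t 0 j).

(** The bounds hold at all times and on the whole space; [local_field_exists] arranges this by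
    cutting fields to zero at bad times and retracting space onto a cube. Measurability is asked of
    the superpositions, the functions that get integrated. *)
Definition caratheodory_field l f := [/\ integrableR l, forall t, 0 <= l t,
  forall t x y, `|f t x - f t y| <= l t * `|x - y| &
  forall xi, rV_measurable xi -> rV_measurable (fun t => f t (xi t))].

Lemma integrableR_dom l (h : R -> R) : integrableR l -> measurable_fun setT h ->
  (forall t, `|h t| <= l t) -> integrableR h.
Proof.
move=> il mh hl; apply: (le_integrable measurableT _ _ il).
  exact/measurable_EFinP.
by move=> t _ /=; rewrite lee_fin (le_trans (hl t))// ler_norm.
Qed.

(** The initial time [c] may lie anywhere: trajectories are started at the end of an interval and
    run backwards, adjoint solutions at its beginning. *)
Definition picard f (c : R) (z : 'rV[R]_n) xi (t : R) : 'rV[R]_n :=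
  z + \row_j (prim (fun s => f s (xi s) 0 j) t - prim (fun s => f s (xi s) 0 j) c).

Lemma prim_dist l (h : R -> R) s t : integrableR l -> measurable_fun setT h ->
  (forall x, `|h x| <= l x) -> `|prim h t - prim h s| <= `|prim l t - prim l s|.
Proof.
move=> il mh hl; have ih := integrableR_dom il mh hl.
have [st|/ltW ts] := leP s t.
  by rewrite (le_trans (prim_dom il ih hl st))// ler_norm.
by rewrite distrC [leRHS]distrC (le_trans (prim_dom il ih hl ts))// ler_norm.
Qed.

Lemma prim_distT l s t : integrableR l -> (forall x, 0 <= l x) ->
  `|prim l t - prim l s| <= (\int[mu]_x l x)%R.
Proof.
move=> il l0; have [st|/ltW ts] := leP s t.
  by rewrite ger0_norm ?subr_ge0 ?primBT// prim_le.
by rewrite distrC ger0_norm ?subr_ge0 ?primBT// prim_le.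
Qed.

Lemma picard_rV_measurable f c z xi : rV_measurable (fun t => f t (xi t)) ->
  (forall j, integrableR (fun t => f t (xi t) 0 j)) ->
  rV_measurable (picard f c z xi).
Proof.
move=> mf jf j; apply: continuous_measurable_fun => t.
rewrite (_ : (fun t => _) = fun t => z 0 j + (prim (fun s => f s (xi s) 0 j) t - prim (fun s => f s (xi s) 0 j) c)); last first.
  by apply/funext => s; rewrite !mxE.
apply: cvgD; first exact: cvg_cst.
apply: cvgB; last exact: cvg_cst.
have /(ACon_continuous) := prim_ACon (t - 1) (t + 1) (jf j).
move=> /continuous_within_itvP[]; first lra.
by move=> + _ _; apply; rewrite in_itv/=; lra.
Qed.

(** The integral of [l] over the line bounds the increments of its primitive on both sides of [c],
    hence the contraction factor 1/2 at all times. *)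
Lemma picard_lip l f c z xi eta (D : R) : caratheodory_field l f ->
  (\int[mu]_x l x)%R <= 2^-1 ->
  rV_measurable xi -> rV_measurable eta ->
  (forall j, integrableR (fun t => f t (xi t) 0 j)) ->
  (forall j, integrableR (fun t => f t (eta t) 0 j)) ->
  (forall t, `|xi t - eta t| <= D) ->
  forall t, `|picard f c z xi t - picard f c z eta t| <= D / 2.
Proof.
move=> [il l0 flip mf] l2 mxi meta ixi ieta xe t.
have D0 : 0 <= D by rewrite (le_trans _ (xe 0)).
apply: rV_norm_le; first by rewrite divr_ge0.
move=> j; rewrite !mxE.
pose h s := f s (xi s) 0 j - f s (eta s) 0 j.
have hE s : prim h s = prim (fun s => f s (xi s) 0 j) s - prim (fun s => f s (eta s) 0 j) s.
  by rewrite /prim -RintegralB//; apply: integrableR_sub.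
have -> : z 0 j + (prim (fun s => f s (xi s) 0 j) t - prim (fun s => f s (xi s) 0 j) c) -
  (z 0 j + (prim (fun s => f s (eta s) 0 j) t - prim (fun s => f s (eta s) 0 j) c)) =
  prim h t - prim h c by rewrite !hE; ring.
apply: (@le_trans _ _ `|prim (fun t => D * l t) t - prim (fun t => D * l t) c|).
  apply: prim_dist; first exact: integrableRZ.
    by apply: measurable_funB; exact: mf.
  move=> s; have := rV_norm_coord (f s (xi s) - f s (eta s)) j.
  rewrite !mxE => /le_trans; apply; apply: le_trans (flip _ _ _) _.
  by rewrite mulrC ler_wpM2r.
have -> : prim (fun t => D * l t) t - prim (fun t => D * l t) c = D * (prim l t - prim l c).
  have [ct|/ltW tc] := leP c t; first by rewrite primZ.
  by apply: oppr_inj; rewrite -mulrN !opprB primZ.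
rewrite normrM ger0_norm// ler_wpM2l// (le_trans _ l2)//.
exact: prim_distT.
Qed.

(** The iteration starts from the constant curve [z] and converges uniformly on the whole line. The
    point [x0] gives integrability: for bounded [xi], the bound at [x0] and the Lipschitz condition
    dominate [f t (xi t)] by a multiple of [l]. *)
Lemma caratheodory_exists l f (c : R) (z x0 : 'rV[R]_n) : caratheodory_field l f ->
  (\int[mu]_x l x)%R <= 2^-1 -> (forall t, `|f t x0| <= l t) ->
  exists xi, [/\ xi c = z, forall a b, ACon a b xi &
    {ae mu, forall t, is_derive t (1:R) xi (f t (xi t))}].
Proof.
move=> cf l2 fx0; have [il l0 flip mf] := cf.
have intf xi (B : R) : rV_measurable xi -> (forall t, `|xi t - x0| <= B) ->
    forall j, integrableR (fun t => f t (xi t) 0 j) /\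
      forall t, `|f t (xi t) 0 j| <= (B + 1) * l t.
  move=> mxi xiB j.
  have fB t : `|f t (xi t) 0 j| <= (B + 1) * l t.
    apply: le_trans (rV_norm_coord _ _) _.
    rewrite -[f t (xi t)](subrK (f t x0)) (le_trans (ler_normD _ _))//.
    rewrite mulrDl mul1r lerD// (le_trans (flip _ _ _))// mulrC ler_wpM2r//.
  split => //; apply: integrableR_dom fB; first exact: integrableRZ.
  exact: mf.
pose u k := iter k (picard f c z) (fun=> z).
(* The iterates stay within [2 * D0] of [x0]: if one does, the next is within [(2 * D0 + 1) / 2] of
   [z], and [z] is at distance [D0 - 1] from [x0]. *)
pose D0 := `|z - x0| + 1.
have D00 : 0 <= D0 by rewrite addr_ge0.
pose e k := D0 * (2^-1) ^+ k.
have picB xi (B : R) : rV_measurable xi -> (forall t, `|xi t - x0| <= B) ->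
    forall t, `|picard f c z xi t - z| <= (B + 1) / 2.
  move=> mxi xiB t; rewrite /picard addrAC subrr add0r.
  have B0 : 0 <= B by rewrite (le_trans _ (xiB 0)).
  apply: rV_norm_le; first by rewrite divr_ge0// addr_ge0.
  move=> j; rewrite mxE; have [ij fB] := intf xi B mxi xiB j.
  apply: le_trans (prim_dist _ _ _ _ fB) _.
  - exact: integrableRZ.
  - exact: mf.
  have -> : prim (fun t => (B + 1) * l t) t - prim (fun t => (B + 1) * l t) c = (B + 1) * (prim l t - prim l c).
    have [ct|/ltW tc] := leP c t; first by rewrite primZ.
    by apply: oppr_inj; rewrite -mulrN !opprB primZ.
  rewrite normrM ger0_norm ?addr_ge0// ler_wpM2l ?addr_ge0// (le_trans _ l2)//.
  exact: prim_distT.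
have uP k : [/\ rV_measurable (u k), forall t, `|u k t - x0| <= 2 * D0 &
    forall t, `|u k.+1 t - u k t| <= e k / 2].
  elim: k => [|k [mk bk dk]].
    have mz : rV_measurable (u 0%N) by move=> j; exact: measurable_cst.
    have bz (t : R) : `|u 0%N t - x0| <= `|z - x0| by [].
    split => //.
      by move=> t; rewrite (le_trans (bz t))// /D0; have := normr_ge0 (z - x0); lra.
    by move=> t; rewrite /e expr0 mulr1; exact: picB bz t.
  have ik j := (intf _ _ mk bk j).1.
  have mk1 : rV_measurable (u k.+1).
    by apply: picard_rV_measurable => //; exact: mf.
  have bk1 t : `|u k.+1 t - x0| <= 2 * D0.
    rewrite -(subrKA z) (le_trans (ler_normD _ _))//.
    have := picB _ _ mk bk t; rewrite -/(u k.+1) => h.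
    by rewrite (le_trans (lerD h (lexx _)))// /D0; lra.
  split => // t.
  have ik1 j := (intf _ _ mk1 bk1 j).1.
  have := picard_lip c z cf l2 mk1 mk ik1 ik dk t.
  by move=> /le_trans; apply; rewrite /e exprS mulrCA; set y := D0 * _; lra.
(* Consecutive iterates differ by at most [e k / 2 = e k - e k.+1], and these bounds telescope. *)
have ue t k m : (k <= m)%N -> `|u m t - u k t| <= e k.
  move=> km; suff : `|u m t - u k t| <= e k - e m.
    move=> /le_trans; apply; rewrite lerBlDr lerDl mulr_ge0// exprn_ge0//.
  elim: m km => [|m ih]; first by rewrite leqn0 => /eqP ->; rewrite !subrr normr0.
  rewrite leq_eqVlt => /predU1P[->|]; first by rewrite !subrr normr0.
  rewrite ltnS => /ih h; rewrite -[u m.+1 t - u k t](subrKA (u m t)) [X in `|X|]addrC.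
  apply: le_trans (ler_normD _ _) _; apply: le_trans (lerD h _) _.
    by have [_ _] := uP m; exact.
  by rewrite /e exprS; set x := _ ^+ m; lra.
have e0 : e @ \oo --> (0 : R).
  by apply: cvg_geometric; rewrite ger0_norm// invf_lt1// ltr1n.
have /choice[xi xiP] : forall t, exists v : 'rV[R]_n, (fun k => u k t) @ \oo --> v /\ forall k, `|v - u k t| <= e k.
  by move=> t; apply: cvg_of_rate => // k m; exact: ue.
have mxi : rV_measurable xi.
  move=> j; apply: (@measurable_fun_cvg _ _ _ setT (fun k t => u k t 0 j)).
    by move=> k; have [h _ _] := uP k; exact: h.
  move=> t _; have [+ _] := xiP t => ut.
  apply/cvgrPdist_le => eps eps0; have /cvgrPdist_le/(_ _ eps0) := ut.
  apply: filterS => k; apply: le_trans.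
  by have := rV_norm_coord (xi t - u k t) j; rewrite !mxE.
have bxi t : `|xi t - x0| <= 3 * D0.
  have [_ /(_ 0%N)] := xiP t; rewrite /e expr0 mulr1 => h.
  rewrite -(subrKA (u 0%N t)) (le_trans (ler_normD _ _))//.
  by have [_ /(_ t) h' _] := uP 0%N; lra.
have ixi j := (intf _ _ mxi bxi j).1.
have fix_xi : picard f c z xi = xi.
  apply/funext => t; apply/eqP; rewrite -subr_eq0 -normr_le0.
  apply/ler_addgt0Pr => eps eps0; rewrite add0r.
  have [k _ /(_ k (leqnn k)) Hk] : \forall k \near \oo, `|e k| < eps / 2.
    by have /cvgr0Pnorm_lt := e0; apply; rewrite divr_gt0.
  have [mk bk _] := uP k.
  have := picard_lip c z cf l2 mxi mk ixi (fun j => (intf _ _ mk bk j).1) (fun t => (xiP t).2 k) t.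
  have [_ /(_ k.+1)] := xiP t; rewrite -(distrC (u k.+1 t)) => h1 h2.
  rewrite -(subrKA (u k.+1 t)) (le_trans (ler_normD _ _))//.
  apply: le_trans (lerD h2 h1) _.
  have := ler_norm (e k); rewrite /e exprS in Hk *; set x := D0 * _ in Hk * => h3.
  rewrite mulrCA -/x; lra.
exists xi; split.
- by rewrite -fix_xi /picard; apply/rowP => j; rewrite !mxE subrr addr0.
- move=> a b; apply: (ACon_lip (K := 3 * D0 + 1) (prim_ACon a b il)) => s t _ st _.
  apply: rV_norm_le; first by rewrite mulr_ge0// addr_ge0// mulr_ge0.
  move=> j; rewrite -fix_xi /picard !mxE.
  rewrite [z 0 j + _]addrC -[leRHS]ger0_norm ?mulr_ge0 ?addr_ge0 ?mulr_ge0//.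
  rewrite [X in `|X|](_ : _ = prim (fun s => f s (xi s) 0 j) t - prim (fun s => f s (xi s) 0 j) s); last by ring.
  rewrite normrM normr_id -normrM -primZ//.
  apply: prim_dist; [exact: integrableRZ|exact: mf|].
  by have [_] := intf _ _ mxi bxi j.
- have H : {ae mu, forall t, forall j, is_derive t (1:R) (prim (fun s => f s (xi s) 0 j)) (f t (xi t) 0 j)}.
    apply: (@filter_forall _ _ _ _ (ae_filter_ringOfSetsType mu)).
    by move=> j; exact: prim_derive.
  apply: ae_mono H => t Ht; apply: is_derive_rV => j.
  have -> : (fun s => xi s 0 j) = cst (z 0 j - prim (fun s => f s (xi s) 0 j) c) + prim (fun s => f s (xi s) 0 j).
    apply/funext => s; transitivity (picard f c z xi s 0 j); first by rewrite fix_xi.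
    rewrite /picard !mxE.
    have -> (g h : R -> R) : (g + h) s = g s + h s by [].
    by rewrite /cst; ring.
  by rewrite -[f t (xi t) 0 j]add0r; apply: is_deriveD; exact: Ht.
Qed.

End caratheodory_existence.

Section differential_estimate.
Context {R : realType} {V W : normedModType R}.

Lemma diff_eps (f : V -> W) x : differentiable f x -> forall e, 0 < e ->
  exists2 d, 0 < d & forall y, `|y - x| < d ->
    `|f y - f x - 'd f x (y - x)| <= e * `|y - x|.
Proof.
move=> /diff_locally/eqaddoP H e e0; have /nbhs_ballP[d/= d0 Hd] := H e e0.
exists d => // y yx; have := Hd (y - x).
rewrite -ball_normE/= sub0r normrN => /(_ yx).
set u := (X in `|X| <= _ -> _).
have -> // : u = f y - f x - 'd f x (y - x).
rewrite /u; set w := y - x; have wx : w + x = y by rewrite subrK.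
by transitivity (f (w + x) - (f x + 'd f x w)); rewrite // wx opprD addrA.
Qed.

End differential_estimate.

(** * The Euclidean pairing of row vectors *)

Section dot_product.
Context {R : realType} {n : nat}.
Implicit Types u v : 'rV[R]_n.

Definition dot u v : R := \sum_i u 0 i * v 0 i.

Lemma dotC u v : dot u v = dot v u.
Proof. by apply: eq_bigr => i _; rewrite mulrC. Qed.

Lemma dotDr u v w : dot u (v + w) = dot u v + dot u w.
Proof. by rewrite /dot -big_split; apply: eq_bigr => i _ /=; rewrite mxE mulrDr. Qed.

Lemma dotNr u v : dot u (- v) = - dot u v.
Proof. by rewrite /dot -sumrN; apply: eq_bigr => i _ /=; rewrite mxE mulrN. Qed.

Lemma dotBr u v w : dot u (v - w) = dot u v - dot u w.
Proof. by rewrite dotDr dotNr. Qed.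

Lemma dotZr u k v : dot u (k *: v) = k * dot u v.
Proof. by rewrite /dot mulr_sumr; apply: eq_bigr => i _; rewrite mxE mulrCA. Qed.

Lemma dotBl u v w : dot (u - v) w = dot u w - dot v w.
Proof. by rewrite dotC dotBr !(dotC w). Qed.

(** The norm of row vectors is the sup norm; the factors of dimension in the later constants come
    from here and from [mulmx_norm_le]. *)
Lemma dot_norm_le u v : `|dot u v| <= n%:R * (`|u| * `|v|).
Proof.
apply: le_trans (ler_norm_sum _ _ _) _.
apply: (@le_trans _ _ (\sum_(i < n) `|u| * `|v|)).
  by apply: ler_sum => i _; rewrite normrM ler_pM// rV_norm_coord.
by rewrite sumr_const card_ord mulr_natl.
Qed.

Lemma dot_mulmx u (J : 'M[R]_n) v : dot u (v *m J) = dot (u *m J^T) v.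
Proof.
have E x y : dot x y = (x *m y^T) 0 0.
  by rewrite mxE; apply: eq_bigr => i _; rewrite mxE.
by rewrite !E trmx_mul mulmxA.
Qed.

Lemma ACon_dot (u v : R -> 'rV[R]_n) a b (C : R) : ACon a b u -> ACon a b v ->
  (forall t, a <= t -> t <= b -> `|u t| <= C /\ `|v t| <= C) ->
  ACon a b (fun t => dot (u t) (v t)).
Proof.
move=> ACu ACv uvC; apply: (ACon_dom (K := n%:R * C) ACu ACv) => s t as_ st tb.
have -> : dot (u t) (v t) - dot (u s) (v s) = dot (u t - u s) (v t) + dot (u s) (v t - v s).
  by rewrite dotBl dotBr addrA subrK.
apply: le_trans (ler_normD _ _) _; rewrite mulrDr lerD//.
  apply: le_trans (dot_norm_le _ _) _; rewrite -mulrA ler_wpM2l// mulrC ler_wpM2r//.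
  by have [] := uvC t (le_trans as_ st) tb.
apply: le_trans (dot_norm_le _ _) _; rewrite -mulrA ler_wpM2l// ler_wpM2r//.
by have [] := uvC s as_ (le_trans st tb).
Qed.

Lemma is_derive_dot (u v : R -> 'rV[R]_n) (t : R) du dv :
  is_derive t (1:R) u du -> is_derive t (1:R) v dv ->
  is_derive t (1:R) (fun t => dot (u t) (v t)) (dot (u t) dv + dot du (v t)).
Proof.
move=> hu hv.
have -> : (fun t => dot (u t) (v t)) = \sum_(i < n) ((fun s => u s 0 i) * (fun s => v s 0 i)).
  by apply/funext => s; rewrite fct_sumE.
rewrite /dot -big_split/=.
have -> : \sum_(i < n) (u t 0 i * dv 0 i + du 0 i * v t 0 i) =
  \sum_(i < n) ((fun s => u s 0 i) t *: dv 0 i + (fun s => v s 0 i) t *: du 0 i).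
  by apply: eq_bigr => i _; rewrite /GRing.scale/= [du 0 i * _]mulrC.
apply: is_derive_sum => i; apply: is_deriveM; exact: is_derive_coord.
Qed.

End dot_product.

(** * The Jacobian along a trajectory and the adjoint equation *)

Section variational_equation.
Context {R : realType} {n : nat}.
Notation mu := (@lebesgue_measure R).
Implicit Types (l : R -> R) (xi : R -> 'rV[R]_n).

Definition clampR (a b t : R) : R := Num.max a (Num.min t b).

Lemma clampR_id a b t : a <= t -> t <= b -> clampR a b t = t.
Proof. by move=> at_ tb; rewrite /clampR (min_idPl tb) (max_idPr at_). Qed.

Lemma clampR_itv a b t : a <= b -> a <= clampR a b t /\ clampR a b t <= b.
Proof. by move=> ab; rewrite /clampR le_max lexx ge_max ab ge_min lexx orbT. Qed.

Lemma clampR_lip a b s t : `|clampR a b t - clampR a b s| <= `|t - s|.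
Proof.
rewrite ler_norml; apply/andP.
have := ler_norm (t - s); have := lerNnormlW (lexx `|t - s|).
rewrite /clampR /Num.max /Num.min; set d := `|_|.
by (do !case: ifPn); rewrite -?leNgt => *; split; lra.
Qed.

Lemma ACon_clamp_measurable xi a b : a <= b -> ACon a b xi ->
  rV_measurable (fun t => xi (clampR a b t)).
Proof.
move=> ab ACxi j; apply: continuous_measurable_fun => t.
apply/cvgrPdist_lt => e e0; have [d d0 H] := ACon_cont ACxi e0.
apply/nbhs_ballP; exists d => // s; rewrite /ball/= => ts.
have [c1 c2] := clampR_itv s ab; have [c3 c4] := clampR_itv t ab.
have := rV_norm_coord (xi (clampR a b t) - xi (clampR a b s)) j.
rewrite !mxE => /le_lt_trans; apply.
have L := le_lt_trans (clampR_lip a b s t) ts.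
have [st|/ltW st] := leP (clampR a b s) (clampR a b t).
  by apply: H => //; move: L; rewrite ger0_norm// subr_ge0.
rewrite distrC; apply: H => //; move: L; rewrite distrC ger0_norm// subr_ge0//.
Qed.

Lemma norm_delta_le (j : 'I_n) : `|delta_mx 0 j : 'rV[R]_n| <= 1.
Proof.
apply: rV_norm_le => // i; rewrite mxE eqxx/=; case: eqP => _; by rewrite ?normr1 ?normr0.
Qed.

Variables (l : R -> R) (f : R -> 'rV[R]_n -> 'rV[R]_n) (a b : R) (g : R -> 'rV[R]_n).
Hypotheses (cf : caratheodory_field l f) (ab : a <= b) (ACg : ACon a b g).
Variable G : set R.
Hypotheses (mG : measurable G) (Gab : forall t, G t -> a < t /\ t < b)
  (Gdiff : forall t, G t -> differentiable (f t) (g t)).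

Let il : integrableR l. Proof. by case: cf. Qed.
Let l0 t : 0 <= l t. Proof. by case: cf. Qed.
Let flip t x y : `|f t x - f t y| <= l t * `|x - y|. Proof. by case: cf. Qed.
Let mf xi : rV_measurable xi -> rV_measurable (fun t => f t (xi t)).
Proof. by case: cf => _ _ _; exact. Qed.

(** Row [j] is the derivative along the basis vector [j], so that the differential is right
    multiplication of row vectors. The factor [\1_G] yields a matrix at every time. *)
Definition field_jacobian (t : R) : 'M[R]_n :=
  \1_G t *: \matrix_(j, i) 'd (f t) (g t) (delta_mx 0 j) 0 i.

Lemma diff_jacobian t v : G t -> 'd (f t) (g t) v = v *m field_jacobian t.
Proof.
move=> Gt; rewrite /field_jacobian indicE mem_set// scale1r.
rewrite {1}[v]row_sum_delta linear_sum; apply/rowP => i; rewrite summxE mxE.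
by apply: eq_bigr => j _; rewrite linearZ !mxE.
Qed.

Lemma jacobian_out t : ~ G t -> field_jacobian t = 0.
Proof. by move=> nG; rewrite /field_jacobian indicE memNset// scale0r. Qed.

Let gc t := g (clampR a b t).
Let quot j i k t := \1_G t * (k.+1%:R * (f t (gc t + k.+1%:R^-1 *: delta_mx 0 j) 0 i - f t (gc t) 0 i)).

(** The difference quotients with step [1 / k.+1] are measurable in [t] and bounded by [l t], and
    both properties pass to the limit. Clamping the time extends [g] by constants to a continuous
    curve on the line. *)
Lemma jacobian_cvg j i t : quot j i k t @[k --> \oo] --> field_jacobian t j i.
Proof.
have [Gt|nG] := pselect (G t); last first.
  rewrite jacobian_out// mxE /quot indicE memNset//.
  by under eq_fun do rewrite mul0r; exact: cvg_cst.
have [at_ tb] := Gab Gt.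
have gE : gc t = g t by rewrite /gc clampR_id ?ltW.
apply/cvgrPdist_le => e e0.
have [d d0 Hd] := diff_eps (Gdiff Gt) e0.
have [k0 _ Hk] : \forall k \near \oo, (k.+1%:R^-1 : R) < d.
  exact: (near_infty_natSinv_lt (PosNum d0)).
exists k0 => // k /= /Hk kd.
rewrite /quot /field_jacobian indicE mem_set// scale1r mul1r gE mxE.
set s : R := k.+1%:R^-1 in kd *; have s0 : 0 < s by rewrite invr_gt0.
have -> : k.+1%:R = s^-1 by rewrite invrK.
set dj := delta_mx 0 j.
have sd : `|s *: dj| <= s by rewrite normrZ gtr0_norm// ler_piMr ?(ltW s0)// norm_delta_le.
have := Hd (g t + s *: dj); rewrite addrAC subrr add0r => /(_ (le_lt_trans sd kd)).
rewrite linearZ => H.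
have := rV_norm_coord (f t (g t + s *: dj) - f t (g t) - s *: 'd (f t) (g t) dj) i.
rewrite !mxE => /le_trans/(_ H) {}H.
move: H.
set D := (X in `|_ - s * X|); set A : R := f t (_ + _) 0 i; set B : R := f t (g t) 0 i => H.
rewrite -/D.
have -> : D - s^-1 * (A - B) = - (s^-1 * (A - B - s * D)) by field; rewrite gt_eqF.
rewrite normrN normrM gtr0_norm ?invr_gt0// ler_pdivrMl// [s * e]mulrC.
by apply: le_trans H _; rewrite ler_wpM2l// ltW.
Qed.

Lemma jacobian_measurable j i : measurable_fun setT (fun t => field_jacobian t j i).
Proof.
apply: (@measurable_fun_cvg _ _ _ setT (quot j i)); last by move=> t _; exact: jacobian_cvg.
move=> k; apply: measurable_funM; first exact: measurable_indic.
apply: measurable_funM; first exact: measurable_cst.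
have mg := ACon_clamp_measurable ab ACg.
apply: measurable_funB; apply: mf => // i'.
rewrite (_ : (fun t => _) = fun t => gc t 0 i' + (k.+1%:R^-1 *: delta_mx 0 j : 'rV[R]_n) 0 i'); last first.
  by apply/funext => t; rewrite mxE.
by apply: measurable_funD; [exact: mg|exact: measurable_cst].
Qed.

Lemma jacobian_le t j i : `|field_jacobian t j i| <= l t.
Proof.
have := @jacobian_cvg j i t => /cvg_norm /cvg_lim <-//.
apply: limr_le; first by apply/cvg_ex; eexists; apply: cvg_norm; exact: jacobian_cvg.
apply: nearW => k; rewrite /quot.
rewrite !normrM (ger0_norm (ler0n _ k.+1)).
have := rV_norm_coord (f t (gc t + k.+1%:R^-1 *: delta_mx 0 j) - f t (gc t)) i.
rewrite !mxE => H.
have {}H : `|f t (gc t + k.+1%:R^-1 *: delta_mx 0 j) 0 i - f t (gc t) 0 i| <= l t * k.+1%:R^-1.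
  apply: le_trans H (le_trans (flip _ _ _) _).
  rewrite addrAC subrr add0r ler_wpM2l// normrZ ger0_norm// ler_piMr//.
  exact: norm_delta_le.
have i1 : `|\1_G t : R| <= 1 by rewrite indicE; case: (_ \in _); rewrite ?normr1 ?normr0.
apply: (@le_trans _ _ (1 * (k.+1%:R * (l t * k.+1%:R^-1)))).
  by apply: ler_pM => //; rewrite ?mulr_ge0// ler_wpM2l.
by rewrite mul1r mulrCA divff ?mulr1.
Qed.

Lemma mulmx_norm_le (v : 'rV[R]_n) (M : 'M[R]_n) (c : R) : 0 <= c ->
  (forall i j, `|M i j| <= c) -> `|v *m M| <= n%:R * c * `|v|.
Proof.
move=> c0 Mc; apply: rV_norm_le; first by rewrite !mulr_ge0.
move=> j; rewrite mxE (le_trans (ler_norm_sum _ _ _))//.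
apply: (@le_trans _ _ (\sum_(i < n) c * `|v|)).
  by apply: ler_sum => i _; rewrite normrM mulrC ler_pM// rV_norm_coord.
by rewrite sumr_const card_ord mulr_natl mulrnAl.
Qed.

(** The field of the adjoint linearised equation: along its solutions the linear part of the
    derivative of [dot lam (xi - g)] cancels, leaving only the second-order remainder of [f] at
    [g]. *)
Definition adjoint_field (t : R) (lam : 'rV[R]_n) : 'rV[R]_n := - (lam *m (field_jacobian t)^T).

Lemma adjoint_caratheodory : caratheodory_field (fun t => n%:R * l t) adjoint_field.
Proof.
split; [exact: integrableRZ|by move=> t; rewrite mulr_ge0| |].
- move=> t x y; rewrite /adjoint_field opprK addrC -mulmxBl distrC.
  by apply: mulmx_norm_le => // i j; rewrite mxE; exact: jacobian_le.
- move=> xi mxi j.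
  rewrite (_ : (fun t => _) = fun t => - \sum_i (xi t 0 i * field_jacobian t j i)); last first.
    by apply/funext => t; rewrite !mxE; congr (- _); apply: eq_bigr => i _; rewrite !mxE.
  apply: measurableT_comp => //; apply: measurable_sum => i.
  by apply: measurable_funM; [exact: mxi|exact: jacobian_measurable].
Qed.

End variational_equation.

(** * Differentiability of the flow along a trajectory *)

Section flow_differential.
Context {R : realType} {n : nat}.
Notation mu := (@lebesgue_measure R).
Implicit Types (xi : R -> 'rV[R]_n).

Lemma dominated_Rintegral_cvg0 (w : nat -> R -> R) (L : R -> R) :
  integrableR L -> (forall k, measurable_fun setT (w k)) ->
  (forall k t, `|w k t| <= L t) -> (forall t, w k t @[k --> \oo] --> (0 : R)) ->
  (\int[mu]_x w k x)%R @[k --> \oo] --> (0 : R).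
Proof.
move=> iL mw wL w0.
have [] := @dominated_convergence _ _ _ mu setT measurableT (fun k => EFin \o w k) (cst 0%E) (EFin \o L).
- by move=> k; have /measurable_EFinP := mw k.
- exact: measurable_cst.
- by apply: aeW => t _; apply: cvg_EFin; [exact: nearW|exact: w0].
- exact: iL.
- by apply: aeW => t k _ /=; rewrite lee_fin.
move=> _ _; rewrite integral0 => /fine_cvgP[_].
by apply: cvg_trans.
Qed.

Variables (l : R -> R) (f : R -> 'rV[R]_n -> 'rV[R]_n) (a b : R) (g : R -> 'rV[R]_n).
Hypotheses (cf : caratheodory_field l f) (ab : a <= b) (ACg : ACon a b g).
(** With the factor [n.+1], one bound covers both the field, of Lipschitz constant [l], and the
    adjoint equation, of constant [n * l]. *)
Hypothesis l2 : n.+1%:R * (\int[mu]_x l x)%R <= 2^-1.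
Variable G : set R.
Hypotheses (mG : measurable G) (Gab : forall t, G t -> a < t /\ t < b)
  (Gdiff : forall t, G t -> differentiable (f t) (g t))
  (aeG : {ae mu, forall t, a < t -> t < b -> G t})
  (dg : {ae mu, forall t, a < t -> t < b -> is_derive t (1:R) g (f t (g t))}).

Let il : integrableR l. Proof. by case: cf. Qed.
Let l0 t : 0 <= l t. Proof. by case: cf. Qed.
Let flip t x y : `|f t x - f t y| <= l t * `|x - y|. Proof. by case: cf. Qed.
Let mf xi : rV_measurable xi -> rV_measurable (fun t => f t (xi t)).
Proof. by case: cf => _ _ _; exact. Qed.
Let intl0 : 0 <= (\int[mu]_x l x)%R. Proof. exact: Rintegral_ge0. Qed.

Let lab : prim l b - prim l a <= 2^-1.
Proof.
apply: le_trans (primBT il l0 ab) (le_trans _ l2).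
by rewrite ler_peMl// ler1n.
Qed.

Definition integral_curve xi := ACon a b xi /\
  {ae mu, forall t, a < t -> t < b -> is_derive t (1:R) xi (f t (xi t))}.

Lemma integral_curve_dist xi : integral_curve xi ->
  forall c t, a <= c -> c <= b -> a <= t -> t <= b -> `|xi t - g t| <= 2 * `|xi c - g c|.
Proof.
move=> [ACxi dxi].
apply: (@gronwall2 _ _ (fun t => xi t - g t) (fun t => f t (xi t) - f t (g t)) l) => //.
  apply: (ACon_dom (K := 1) ACxi ACg) => s t _ _ _; rewrite mul1r.
  have -> : xi t - g t - (xi s - g s) = (xi t - xi s) - (g t - g s).
    by rewrite !opprD !opprK addrACA.
  exact: ler_normB.
apply: ae_mono (ae_and dxi dg) => t [H1 H2] at_ tb; split => //.
by apply: is_deriveB; [exact: H1|exact: H2].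
Qed.

Let Jac := field_jacobian f g G.

Section remainder.
Variables (xi : nat -> R -> 'rV[R]_n) (h : nat -> R).
Hypotheses (icxi : forall k, integral_curve (xi k)) (h0 : forall k, 0 < h k)
  (hE : forall k, h k = `|xi k b - g b|) (hcvg : h @ \oo --> (0 : R)).

Let gc t := g (clampR a b t).
Let xc k t := xi k (clampR a b t).
Let Delta k t := f t (xc k t) - f t (gc t) - (xc k t - gc t) *m Jac t.

(** The error of linearisation at [g], divided by the final distance [h k]. Since [|xi k - g|] is at
    most [2 * h k] on all of [[a, b]], it is dominated by a multiple of [l] and tends to 0 at each
    time of [G], so dominated convergence applies. *)
Definition remainder k t := \1_G t * ((\sum_i `|Delta k t 0 i|) / h k).

Let xg k t : `|xc k t - gc t| <= 2 * h k.
Proof.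
rewrite hE; have [? ?] := clampR_itv t ab.
exact: (integral_curve_dist (icxi k)).
Qed.

Let Delta_le k t i : `|Delta k t 0 i| <= (1 + n%:R) * (2 * h k) * l t.
Proof.
apply: le_trans (rV_norm_coord _ _) _; apply: le_trans (ler_normB _ _) _.
rewrite mulrDl mulrDl mul1r lerD//.
  by apply: le_trans (flip _ _ _) _; rewrite mulrC ler_wpM2r.
apply: le_trans (mulmx_norm_le _ (l0 t) _) _.
  by move=> i' j'; exact: (jacobian_le cf Gab Gdiff).
by rewrite mulrAC ler_wpM2r// ler_wpM2l.
Qed.

Lemma remainder_le k t : `|remainder k t| <= n%:R * ((1 + n%:R) * 2) * l t.
Proof.
rewrite /remainder normrM [X in _ * X]ger0_norm; last first.
  by rewrite divr_ge0 ?sumr_ge0// ltW.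
have i1 : `|\1_G t : R| <= 1 by rewrite indicE; case: (_ \in _); rewrite ?normr1 ?normr0.
apply: (@le_trans _ _ (1 * ((\sum_i `|Delta k t 0 i|) / h k))).
  by rewrite ler_wpM2r// divr_ge0 ?sumr_ge0// ltW.
rewrite mul1r ler_pdivrMr//.
apply: (@le_trans _ _ (\sum_(i < n) (1 + n%:R) * (2 * h k) * l t)).
  by apply: ler_sum => i _; exact: Delta_le.
by rewrite sumr_const card_ord -mulr_natl le_eqVlt; apply/orP; left; apply/eqP; ring.
Qed.

Lemma remainder_measurable k : measurable_fun setT (remainder k).
Proof.
apply: measurable_funM; first exact: measurable_indic.
apply: measurable_funM; last exact: measurable_cst.
apply: measurable_sum => i; apply: measurableT_comp => //.
have mg := ACon_clamp_measurable ab ACg.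
have mx := ACon_clamp_measurable ab (icxi k).1.
rewrite (_ : (fun t => _) = fun t => f t (xc k t) 0 i - f t (gc t) 0 i -
    \sum_j ((xc k t 0 j - gc t 0 j) * Jac t j i)); last first.
  apply/funext => t; rewrite !mxE; congr (_ - _).
  by apply: eq_bigr => j _; rewrite !mxE.
apply: measurable_funB; first by apply: measurable_funB; exact: mf.
apply: measurable_sum => j; apply: measurable_funM.
  by apply: measurable_funB; [exact: mx|exact: mg].
exact: (jacobian_measurable cf ab ACg mG Gab Gdiff).
Qed.

Lemma remainder_cvg t : remainder k t @[k --> \oo] --> (0 : R).
Proof.
have [Gt|nG] := pselect (G t); last first.
  rewrite /remainder indicE memNset//.
  by under eq_fun do rewrite mul0r; exact: cvg_cst.
have [at_ tb] := Gab Gt.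
apply/cvgr0Pnorm_le => e e0.
(* There are [n] coordinates and the distance to [g] is at most [2 * h k]; the [+ 1] keeps the
   denominator positive when [n = 0]. *)
have e'0 : 0 < e / (n%:R * 2 + 1) by rewrite divr_gt0// ltr_wpDl// mulr_ge0.
have [d d0 Hd] := diff_eps (Gdiff Gt) e'0.
have d20 : 0 < d / 2 by rewrite divr_gt0.
have [k0 _ Hk] : \forall k \near \oo, `|h k| < d / 2.
  by have /cvgr0Pnorm_lt/(_ _ d20) := hcvg.
exists k0 => // k /= /Hk kd.
rewrite /remainder indicE mem_set// mul1r ger0_norm; last by rewrite divr_ge0 ?sumr_ge0// ltW.
rewrite ler_pdivrMr//.
have gE : gc t = g t by rewrite /gc clampR_id ?ltW.
have xd : `|xc k t - g t| <= 2 * h k by rewrite -gE.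
have xd' : `|xc k t - g t| < d.
  by apply: le_lt_trans xd _; rewrite (gtr0_norm (h0 k)) in kd; lra.
have := Hd _ xd'; rewrite (diff_jacobian f g _ Gt) -/Jac => H.
apply: (@le_trans _ _ (\sum_(i < n) e / (n%:R * 2 + 1) * (2 * h k))).
  apply: ler_sum => i _; apply: le_trans (rV_norm_coord _ _) _.
  rewrite /Delta gE; apply: le_trans H _.
  by rewrite ler_wpM2l// ltW.
rewrite sumr_const card_ord -[X in X <= _]mulr_natl.
have -> : n%:R * (e / (n%:R * 2 + 1) * (2 * h k)) = (n%:R * 2) / (n%:R * 2 + 1) * (e * h k).
  by field; rewrite gt_eqF// ltr_wpDl// mulr_ge0.
apply: ler_piMl; first by rewrite mulr_ge0// ltW.
rewrite ler_pdivrMr ?mul1r ?lerDl//; by rewrite ltr_wpDl// mulr_ge0.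
Qed.

Lemma remainder_integral_cvg : (\int[mu]_x remainder k x)%R @[k --> \oo] --> (0 : R).
Proof.
apply: (dominated_Rintegral_cvg0 (L := fun t => n%:R * ((1 + n%:R) * 2) * l t)).
- exact: integrableRZ.
- exact: remainder_measurable.
- exact: remainder_le.
- exact: remainder_cvg.
Qed.

(** The adjoint equation cancels the Jacobian term, so the derivative of the pairing is
    [dot lam Delta], at most [C * h k * remainder k]. *)
Lemma remainder_pairing lam (C : R) k : 0 <= C -> ACon a b lam ->
  (forall t, a <= t -> t <= b -> `|lam t| <= C) ->
  {ae mu, forall t, a < t -> t < b -> is_derive t (1:R) lam (adjoint_field f g G t (lam t))} ->
  `|dot (lam b) (xi k b - g b) - dot (lam a) (xi k a - g a)| <=
    C * h k * (\int[mu]_x remainder k x)%R.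
Proof.
move=> C0 AClam lamC dlam; have [ACxi dxi] := icxi k.
have irem : integrableR (remainder k).
  by apply: integrableR_dom (remainder_le k); [exact: integrableRZ|exact: remainder_measurable].
have rem0 t : 0 <= remainder k t.
  by rewrite /remainder mulr_ge0// ?divr_ge0 ?sumr_ge0 ?ltW// indicE.
have Ch : 0 <= C * h k by rewrite mulr_ge0// ltW.
apply: (@le_trans _ _ (prim (fun t => C * h k * remainder k t) b - prim (fun t => C * h k * remainder k t) a)); last first.
  by rewrite primZ// ler_wpM2l// primBT.
pose y t := dot (lam t) (xi k t - g t).
have ACd : ACon a b (fun t => xi k t - g t).
  apply: (ACon_dom (K := 1) ACxi ACg) => s t _ _ _; rewrite mul1r.
  have -> : xi k t - g t - (xi k s - g s) = (xi k t - xi k s) - (g t - g s).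
    by rewrite !opprD !opprK addrACA.
  exact: ler_normB.
apply: (@ACon_derive_bound _ _ y (fun t => dot (lam t) (f t (xi k t) - f t (g t)) + dot (adjoint_field f g G t (lam t)) (xi k t - g t))) => //.
- apply: (ACon_dot (C := C + 2 * h k) AClam ACd) => t at_ tb; split.
    by rewrite (le_trans (lamC _ at_ tb))// lerDl mulr_ge0// ltW.
  rewrite (@le_trans _ _ (2 * h k)) ?lerDr// hE.
  exact: integral_curve_dist.
- exact: integrableRZ.
apply: ae_mono (ae_and (ae_and dxi dg) (ae_and dlam aeG)) => t [[Hx Hg] [Hl HG]] at_ tb.
have Gt := HG at_ tb; split.
  by apply: is_derive_dot; [exact: Hl|apply: is_deriveB; [exact: Hx|exact: Hg]].
have tE : clampR a b t = t by rewrite clampR_id ?ltW.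
have -> : dot (lam t) (f t (xi k t) - f t (g t)) + dot (adjoint_field f g G t (lam t)) (xi k t - g t) = dot (lam t) (Delta k t).
  rewrite /Delta /xc /gc tE [RHS]dotBr; congr (_ + _).
  by rewrite dot_mulmx /adjoint_field dotC dotNr dotC.
apply: (@le_trans _ _ (C * \sum_i `|Delta k t 0 i|)).
  apply: le_trans (ler_norm_sum _ _ _) _; rewrite mulr_sumr; apply: ler_sum => i _.
  rewrite normrM ler_wpM2r// (le_trans (rV_norm_coord _ _))// lamC// ltW//.
rewrite /remainder indicE mem_set// mul1r mulrAC -!mulrA mulVf ?gt_eqF// mulr1//.
Qed.

End remainder.

(** By contradiction, because dominated convergence speaks of sequences: a failure for some [e]
    yields integral curves whose ends converge to [g b]. *)
Lemma adjoint_pairing lam (C : R) : 0 <= C -> ACon a b lam ->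
  (forall t, a <= t -> t <= b -> `|lam t| <= C) ->
  {ae mu, forall t, a < t -> t < b -> is_derive t (1:R) lam (adjoint_field f g G t (lam t))} ->
  forall e, 0 < e -> exists2 d, 0 < d & forall xi, integral_curve xi -> `|xi b - g b| < d ->
    `|dot (lam b) (xi b - g b) - dot (lam a) (xi a - g a)| <= e * `|xi b - g b|.
Proof.
move=> C0 AClam lamC dlam e e0; apply/not_notP => nex.
have /choice[xi Hxi] : forall k : nat, exists xi, [/\ integral_curve xi, `|xi b - g b| < k.+1%:R^-1 &
    e * `|xi b - g b| < `|dot (lam b) (xi b - g b) - dot (lam a) (xi a - g a)|].
  move=> k; apply/not_notP => nxi; apply: nex; exists k.+1%:R^-1; first by rewrite invr_gt0.
  move=> xi icxi xib; rewrite leNgt; apply/negP => H; apply: nxi; exists xi; split => //.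
pose h k := `|xi k b - g b|.
(* A curve that ends at [g b] also starts at [g a] by [integral_curve_dist], and then both pairings
   vanish, against the strict inequality. *)
have h0 k : 0 < h k.
  rewrite lt_neqAle normr_ge0 andbT eq_sym normr_eq0; apply/eqP => xib.
  have [ic _] := Hxi k; rewrite xib normr0 mulr0 => H.
  have := integral_curve_dist ic ab (lexx b) (lexx a) ab.
  rewrite xib normr0 mulr0 normr_le0 => /eqP xia.
  move: H; rewrite xia /dot !big1 ?subrr ?normr0 ?ltxx// => i _; rewrite mxE mulr0//.
have hc : h @ \oo --> (0 : R).
  apply/cvgr0Pnorm_lt => d d0; near=> k.
  rewrite gtr0_norm//; have [_ /lt_trans + _] := Hxi k; apply.
  by near: k; exact: (near_infty_natSinv_lt (PosNum d0)).
have icx k : integral_curve (xi k) by case: (Hxi k).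
have := remainder_integral_cvg icx h0 (fun k => erefl) hc.
have e'0 : 0 < e / (C + 1) by rewrite divr_gt0// ltr_wpDl.
move=> /cvgr0Pnorm_lt/(_ _ e'0)[k _ /(_ k (leqnn k)) Hk].
have := remainder_pairing icx h0 (fun k => erefl) k C0 AClam lamC dlam.
have [_ _ /lt_le_trans H /H] := Hxi k; rewrite -/(h k) mulrAC ltr_pM2r//.
apply/negP; rewrite -leNgt (le_trans (ler_wpM2l C0 (ler_norm _)))//.
apply: (@le_trans _ _ (C * (e / (C + 1)))); first by rewrite ler_wpM2l// ltW.
rewrite mulrCA ler_piMr ?ltW// ltr_pdivrMr ?mul1r ?ltrDl// ltr_wpDl//.
Unshelve. all: by end_near. Qed.

Lemma ACon_sum m (F : 'I_m -> R -> 'rV[R]_n) : (forall i, ACon a b (F i)) ->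
  ACon a b (fun t => \sum_i F i t).
Proof.
move=> H; rewrite (_ : (fun t => _) = \sum_i F i); last first.
  by apply/funext => t; rewrite fct_sumE.
elim/big_ind : _ => //.
  move=> e e0; exists 1 => // k L r _ _ _; rewrite big1// => i _.
  by rewrite subrr normr0.
move=> u v ACu ACv; apply: (ACon_dom (K := 1) ACu ACv) => s t _ _ _.
by rewrite mul1r [X in `|X|](_ : _ = (u t - u s) + (v t - v s)) ?ler_normD// opprD addrACA.
Qed.

Lemma ACon_scale k (F : R -> 'rV[R]_n) : ACon a b F -> ACon a b (fun t => k *: F t).
Proof.
by move=> H; apply: (ACon_lip (K := `|k|) H) => s t _ _ _; rewrite -scalerBr normrZ.
Qed.

(* The pairing of xi - g with a solution of the adjoint equation
   lam' = - lam (Df)^T is constant up to o(|xi b - g b|); the differential is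
   read off the solutions starting from the canonical basis at time a. *)
Lemma flow_differentiable : exists2 J : 'M[R]_n, J \in unitmx &
  forall e, 0 < e -> exists2 d, 0 < d & forall xi, integral_curve xi -> `|xi b - g b| < d ->
    `|(xi a - g a) - (xi b - g b) *m J| <= e * `|xi b - g b|.
Proof.
have cad := adjoint_caratheodory cf ab ACg mG Gab Gdiff.
have nl2 : (\int[mu]_x (n%:R * l x))%R <= 2^-1.
  rewrite RintegralZl//; apply: le_trans l2; rewrite ler_wpM2r//.
  by rewrite ler_nat.
have /choice[lam Hlam] : forall i : 'I_n, exists lam, [/\ lam a = delta_mx 0 i, forall a b, ACon a b lam &
    {ae mu, forall t, is_derive t (1:R) lam (adjoint_field f g G t (lam t))}].
  move=> i; apply: (caratheodory_exists (x0 := 0) _ _ cad nl2) => t.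
  by rewrite /adjoint_field mul0mx oppr0 normr0 mulr_ge0.
have adj_le t x : `|adjoint_field f g G t x| <= n%:R * l t * `|x|.
  have [_ _ H _] := cad; have := H t x 0; rewrite subr0 /adjoint_field mul0mx oppr0 subr0.
  exact.
have gr y : ACon a b y -> {ae mu, forall t, is_derive t (1:R) y (adjoint_field f g G t (y t))} ->
    forall c t, a <= c -> c <= b -> a <= t -> t <= b -> `|y t| <= 2 * `|y c|.
  move=> ACy dy; apply: (@gronwall2 _ _ y (fun t => adjoint_field f g G t (y t)) (fun t => n%:R * l t)) => //.
  - exact: integrableRZ.
  - by move=> t; rewrite mulr_ge0.
  - apply: le_trans nl2; apply: primBT => //; [exact: integrableRZ|by move=> t; rewrite mulr_ge0].
  - by apply: ae_mono dy => t.
pose T : 'M[R]_n := \matrix_(i, j) lam i b 0 j.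
have rowT i : row i T = lam i b by apply/rowP => j; rewrite !mxE.
(* Pairing with [lam i] gives coordinate [i] of [xi a - g a] at time [a], and coordinate [i] of the
   product of [xi b - g b] by [T^T] at time [b]. *)
exists T^T.
  (* A combination of the [lam i] that vanishes at [b] vanishes at [a] by Gronwall, and its value at
     [a] is the vector of its coefficients. *)
  rewrite unitmx_tr -row_free_unit -kermx_eq0; apply/rowV0P => c /sub_kermxP cT.
  pose y t := \sum_i c 0 i *: lam i t.
  have ACy : ACon a b y by apply: ACon_sum => i; apply: ACon_scale; case: (Hlam i).
  have dy : {ae mu, forall t, is_derive t (1:R) y (adjoint_field f g G t (y t))}.
    have H : {ae mu, forall t, forall i, is_derive t (1:R) (lam i) (adjoint_field f g G t (lam i t))}.
      apply: (@filter_forall _ _ _ _ (ae_filter_ringOfSetsType mu)) => i.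
      by case: (Hlam i).
    apply: ae_mono H => t Ht.
    have -> : y = \sum_(i < n) (c 0 i *: lam i : R -> 'rV[R]_n).
      by apply/funext => s; rewrite fct_sumE.
    have -> : adjoint_field f g G t ((\sum_(i < n) (c 0 i *: lam i : R -> 'rV[R]_n)) t) =
        \sum_(i < n) c 0 i *: adjoint_field f g G t (lam i t).
      rewrite fct_sumE /adjoint_field mulmx_suml -sumrN; apply: eq_bigr => i _.
      by rewrite scalerN scalemxAl.
    by apply: is_derive_sum => i; apply: is_deriveZ; exact: Ht.
  have yb : y b = 0.
    rewrite -cT /y mulmx_sum_row; apply: eq_bigr => i _; rewrite rowT//.
  have ya : y a = c.
    rewrite /y [RHS]row_sum_delta; apply: eq_bigr => i _; by have [-> _ _] := Hlam i.
  have := gr y ACy dy b a ab (lexx b) (lexx a) ab.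
  by rewrite yb ya normr0 mulr0 normr_le0 => /eqP.
move=> e e0.
have /choice[d Hd] : forall i, exists d, 0 < d /\ forall xi, integral_curve xi -> `|xi b - g b| < d ->
    `|dot (lam i b) (xi b - g b) - dot (lam i a) (xi a - g a)| <= e * `|xi b - g b|.
  move=> i; have [lama AClam dlam] := Hlam i.
  have lam2 t : a <= t -> t <= b -> `|lam i t| <= 2.
    move=> at_ tb; apply: le_trans (gr _ (AClam a b) dlam a t (lexx a) ab at_ tb) _.
    by rewrite lama ler_piMr// norm_delta_le.
  have dlam' : {ae mu, forall t, a < t -> t < b -> is_derive t (1:R) (lam i) (adjoint_field f g G t (lam i t))}.
    by apply: ae_mono dlam => t.
  have [d d0 H] := adjoint_pairing (ler0n _ 2) (AClam a b) lam2 dlam' e0.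
  by exists d.
exists (\big[Num.min/1]_i d i).
  by apply: (big_ind (fun x => 0 < x)) => // [x y x0 y0|i _]; [rewrite lt_min x0|have [] := Hd i].
move=> xi icxi xib; apply: rV_norm_le; first by rewrite mulr_ge0// ltW.
move=> i; have [_ H] := Hd i; have [lama _ _] := Hlam i.
have /H : `|xi b - g b| < d i by apply: lt_le_trans xib _; exact: bigmin_le.
move=> /(_ icxi); rewrite lama distrC.
have -> // : dot (delta_mx 0 i) (xi a - g a) - dot (lam i b) (xi b - g b) = (xi a - g a - (xi b - g b) *m T^T) 0 i.
rewrite !mxE; congr (_ - _).
  rewrite /dot (bigD1 i)//= !mxE !eqxx mul1r big1 ?addr0// => j ji.
  by rewrite mxE eqxx (negbTE ji) mul0r.
by rewrite /dot; apply: eq_bigr => j _; rewrite !mxE mulrC.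
Qed.

End flow_differential.

(** * Translation invariance of Lebesgue measure *)

Section translation.
Context {R : realType}.
Notation mu := (@lebesgue_measure R).

Definition shiftR (c t : R) : measurableTypeR R := t + c.

Lemma measurable_shift (c : R) : measurable_fun setT (shiftR c).
Proof. by apply: measurable_funD; [exact: measurable_id|exact: measurable_cst]. Qed.

(** The image measure gives half-open intervals their length, which characterises Lebesgue
    measure. *)
Lemma lebesgue_measure_shift (c : R) (A : set R) : measurable A ->
  mu A = mu [set t | A (t + c)].
Proof.
move=> mA; rewrite -[RHS]/(pushforward mu (shiftR c) A).
apply: lebesgue_measure_unique => //=.
  exact: measurable_shift.
move=> ? _ [[a b]] _ <-; rewrite /pushforward.
have -> : shiftR c @^-1` `]a, b]%classic = `]a - c, b - c]%classic.
  by apply/seteqP; split => x /=; rewrite !in_itv/= /shiftR ltrBlDr lerBrDr.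
rewrite !lebesgue_measure_itv/= !lte_fin ltrD2r.
by case: ifP => // _; rewrite -!EFinB; congr EFin; ring.
Qed.

Lemma ae_shift (c : R) (P : R -> Prop) : {ae mu, forall t, P t} -> {ae mu, forall t, P (t + c)}.
Proof.
move=> [Z [mZ Z0 ZP]]; exists [set t | Z (t + c)]; split.
- have := measurable_shift c; move=> /(_ measurableT _ mZ); rewrite setTI; exact.
- by rewrite -lebesgue_measure_shift.
- by move=> t /= nP; apply: ZP.
Qed.

Lemma integrableR_shift (c : R) l : integrableR l -> integrableR (fun t => l (t + c)).
Proof.
move=> /integrableP[ml il]; apply/integrableP; split.
  apply/measurable_EFinP; apply: (measurableT_comp (f := l) (g := shiftR c)).
    exact/measurable_EFinP.
  exact: measurable_shift.
apply: le_lt_trans il.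
have -> : (\int[mu]_x `|(EFin \o l) x| = \int[pushforward mu (shiftR c)]_x `|(EFin \o l) x|)%E.
  apply: eq_measure_integral => [|ms A mA _]; first exact: measurable_shift.
  exact: lebesgue_measure_shift.
rewrite ge0_integral_pushforward//=; first exact: measurable_shift.
apply/measurable_EFinP; apply: measurableT_comp => //.
exact/measurable_EFinP.
Qed.

End translation.

(** * Chain rule along curves and local Lipschitz bounds *)

Section curves.
Context {R : realType} {V W : normedModType R}.

Lemma is_derive_diff_comp (h : V -> W) (c : R -> V) (s : R) (v : V) :
  is_derive s (1:R) c v -> differentiable h (c s) ->
  is_derive s (1:R) (h \o c) ('d h (c s) v).
Proof.
move=> [dc cE] dh; have dcs : differentiable c s by exact/derivable1_diffP.
have dhc : differentiable (h \o c) s by exact: differentiable_comp.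
split; first exact/derivable1_diffP.
by rewrite deriveE// diff_comp//= -cE deriveE.
Qed.

Lemma is_derive_line (z w : V) (s : R) : is_derive s (1:R) (fun s => z + s *: w) w.
Proof.
have dl : is_diff s (fun s : R => z + s *: w) (0 + ( *:%R^~ w)).
  exact: (is_diffD (is_diff_cst z s) (is_diff_scalel s w)).
have df : differentiable (fun s : R => z + s *: w) s by exact: ex_diff.
split; first exact/derivable1_diffP.
rewrite deriveE// diff_val.
by transitivity (0 + 1 *: w : V); rewrite // add0r scale1r.
Qed.

End curves.

Section lipschitz.
Context {R : realType} {n p : nat}.

(** Mean value theorem for each coordinate on the segment from [z] to [y], inside a ball where the
    partial derivatives exceed their norms at [x] by at most 1. *)
Lemma C1_lipschitz_at (h : 'rV[R]_n -> 'rV[R]_p) (x : 'rV[R]_n) :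
  (\forall y \near x, differentiable h y) ->
  (forall v, {for x, continuous (fun y => 'D_v h y)}) ->
  exists K r : R, [/\ 0 <= K, 0 < r & forall y z, `|y - x| < r -> `|z - x| < r ->
    `|h y - h z| <= K * `|y - z|].
Proof.
move=> dh ch.
pose K := \sum_(j < n) (`|'D_(delta_mx 0 j) h x| + 1).
have K0 : 0 <= K by apply: sumr_ge0 => j _; rewrite addr_ge0.
have near_bd : \forall y \near x, forall j : 'I_n, `|'D_(delta_mx 0 j) h y| <= `|'D_(delta_mx 0 j) h x| + 1.
  apply: (@filter_forall _ _ _ (nbhs x)) => j.
  have [D DE] : exists D, D = (fun y => 'D_(delta_mx 0 j) h y) by exists (fun y => 'D_(delta_mx 0 j) h y).
  have := ch (delta_mx 0 j); rewrite -DE => cD.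
  have /cvgrPdist_le/(_ _ ltr01) : D y @[y --> x] --> D x by exact: cD.
  apply: filterS => y Hy; rewrite -[X in `|X| <= _]/((fun y => 'D_(delta_mx 0 j) h y) y).
  rewrite -[X in _ <= `|X| + 1]/((fun y => 'D_(delta_mx 0 j) h y) x) -DE.
  by rewrite -lerBlDl (le_trans (lerB_dist _ _))// distrC.
have /nbhs_ballP[r/= r0 Hr] : nbhs x [set y | differentiable h y /\ forall j : 'I_n, `|'D_(delta_mx 0 j) h y| <= `|'D_(delta_mx 0 j) h x| + 1].
  by apply: filterS2 dh near_bd => y; split.
exists K, r; split => // y z yx zx; apply: rV_norm_le; first by rewrite mulr_ge0.
move=> i.
pose c (s : R) := z + s *: (y - z).
have cx s : 0 <= s -> s <= 1 -> ball x r (c s).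
  move=> s0 s1; rewrite -ball_normE/=.
  have -> : x - c s = (1 - s) *: (x - z) + s *: (x - y).
    by rewrite /c; apply/rowP => j; rewrite !mxE; ring.
  apply: le_lt_trans (ler_normD _ _) _; rewrite !normrZ !ger0_norm ?subr_ge0//.
  rewrite distrC [`|x - y|]distrC.
  have [->|s0'] := eqVneq s 0; first by rewrite subr0 mul1r mul0r addr0.
  apply: (@lt_le_trans _ _ ((1 - s) * r + s * r)); last by rewrite -mulrDl subrK mul1r.
  rewrite ler_ltD// ?ler_wpM2l ?subr_ge0// ?ltW// ltr_pM2l// lt_neqAle eq_sym s0'//.
have dhc (s : R) : 0 <= s -> s <= 1 -> is_derive s (1:R) (fun s => h (c s) 0 i) (('d h (c s) (y - z)) 0 i).
  move=> s0 s1; have [dhs _] := Hr _ (cx s s0 s1).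
  apply: (@is_derive_coord _ _ (h \o c) s ('d h (c s) (y - z)) i).
  by apply: is_derive_diff_comp => //; exact: is_derive_line.
have c1 : c 1 = y by rewrite /c scale1r addrC subrK.
have c0 : c 0 = z by rewrite /c scale0r addr0.
have dh01 (s : R) : s \in `]0, 1[ -> is_derive s (1:R) (fun s => h (c s) 0 i) (('d h (c s) (y - z)) 0 i).
  by rewrite in_itv/= => /andP[/ltW s0 /ltW s1]; exact: dhc.
have cont : {within `[0, 1], continuous (fun s => h (c s) 0 i)}.
  apply: derivable_within_continuous => s; rewrite in_itv/= => /andP[s0 s1].
  by have [] := dhc s s0 s1.
have [s s01 E] := MVT ltr01 dh01 cont.
rewrite !mxE.
move: s01; rewrite in_itv/= => /andP[/ltW s0 /ltW s1].
move: E; rewrite c1 c0 subr0 mulr1 => ->.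
have [dhs bd] := Hr _ (cx s s0 s1).
rewrite {1}[y - z]row_sum_delta linear_sum summxE (le_trans (ler_norm_sum _ _ _))//.
rewrite /K mulr_suml; apply: ler_sum => j _.
rewrite linearZ mxE normrM mulrC; apply: ler_pM => //; last exact: rV_norm_coord.
by apply: le_trans (rV_norm_coord _ _) _; rewrite -deriveE.
Qed.

End lipschitz.

(** * From local to global on a compact interval *)

Section interval_cover.
Context {R : realType}.

(** Cousin's lemma, by a supremum argument. It globalises absolute continuity, the transport of
    normals and the invariance of [P]. *)
Lemma cousin (Q : R -> R -> Prop) (a b : R) : a <= b ->
  (forall r s t, a <= r -> r <= s -> s <= t -> t <= b -> Q r s -> Q s t -> Q r t) ->
  (forall t, a <= t -> t <= b -> exists2 d, 0 < d & forall r s,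
     a <= r -> r <= s -> s <= b -> t - d < r -> s < t + d -> Q r s) ->
  Q a b.
Proof.
move=> ab Qtr Qloc.
have Qaa : Q a a.
  by have [d d0 H] := Qloc a (lexx a) ab; apply: H => //; rewrite ?ltrDl// ltrBlDr ltrDl.
pose E := [set t | a <= t /\ t <= b /\ Q a t].
have hE : has_sup E by split; [exists a|exists b => x [_ []]].
pose c := sup E.
have ac : a <= c by apply: sup_upper_bound.
have cb : c <= b by apply: ge_sup => //; [exists a|move=> x [_ []]].
have [d d0 H] := Qloc c ac cb.
have [t [at_ [tb Qat]] ct] := sup_adherent d0 hE.
have tc : t <= c by apply: sup_upper_bound.
(* Beyond [c] unless [c = b], yet within the radius [d] that is good around [c]. *)
pose s := Num.min b (c + d / 2).
have cs : c <= s by rewrite le_min cb lerDl ltW// divr_gt0.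
have sb : s <= b by rewrite ge_min lexx.
have sd : s < c + d.
  by apply: (@le_lt_trans _ _ (c + d / 2)); [rewrite ge_min lexx orbT|rewrite ltrD2l; lra].
have Qas : Q a s.
  by apply: (Qtr a t s) => //; [exact: le_trans cs|apply: H => //; exact: le_trans cs].
have sc : s <= c by apply: sup_upper_bound => //; split => //; exact: le_trans cs.
have : s = b.
  have : s = c by apply/eqP; rewrite eq_le sc.
  rewrite /s /Num.min; case: ifPn => // _ E1; lra.
by move=> <-.
Qed.

Lemma ACon_local (V : normedModType R) (f : R -> V) (a b : R) : a <= b ->
  (forall t, a <= t -> t <= b -> exists2 d, 0 < d & forall r s,
     a <= r -> r <= s -> s <= b -> t - d < r -> s < t + d -> ACon r s f) ->
  ACon a b f.
Proof. by move=> ab; apply: cousin => // r s t _ rs st _; exact: ACon_cat. Qed.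

End interval_cover.

(** * Admissible controls: restriction, translation, concatenation *)

Section controls.
Context {R : realType} {m : nat}.
Notation mu := (@lebesgue_measure R).
Implicit Types (U : set 'rV[R]_m) (u : R -> 'rV[R]_m) (UU : set (control R m)).

(* The list L is arbitrary: unsorted, possibly not contained in [0, T]. *)
Definition pc_breaks (T : R) u (L : seq R) := forall a b : R, 0 <= a -> a < b -> b <= T ->
  (forall x, x \in L -> x <= a \/ b <= x) ->
  forall t t', a < t -> t < b -> a < t' -> t' < b -> u t = u t'.

(** With an unordered list of possible jumps, restriction needs no new list, translation is [map]
    and concatenation is [++]. Sorting the distinct entries inside []0, T[] and appending [T] gives
    back a partition. *)
Lemma U_pcP U T u : U_pc U (T, u) <->
  [/\ 0 <= T, forall t, t \in `[0, T] -> U (u t) & exists L, pc_breaks T u L].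
Proof.
split=> [[/= T0 uU [s [[ps ls] Hs]]]|[T0 uU [L HL]]]; split => //=.
  exists s => a b a0 ab bT sab t t' at_ tb at' t'b.
  have Ts : T \in s.
    case: s ps ls {Hs sab} => [|x s] ps /eqP ls; last by rewrite -ls /= mem_last.
    by move: ab; rewrite ltNge (le_trans bT)// -ls.
  have hb : has (fun x => b <= x) s by apply/hasP; exists T.
  (* The first partition point at or beyond [b]. Its predecessor is below [b], hence at most [a], no
     partition point being strictly between. *)
  pose k := find (fun x => b <= x) s.
  have ks : (k < size s)%N by rewrite -has_find.
  have kb : b <= nth 0 s k by exact: nth_find.
  have ka : nth 0 (0 :: s) k <= a.
    move: ks; rewrite /k; case E : (find _ _) => [|k'] //= ks.
    have bk : ~~ (b <= nth 0 s k').
      apply/negP => h; have := @before_find _ 0 (fun x => b <= x) s k'.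
      by rewrite E ltnSn h => /(_ isT).
    have [//|] := sab (nth 0 s k') (mem_nth 0 (ltnW ks)).
    by rewrite (negbTE bk).
  apply: (Hs k ks); rewrite in_itv/=; apply/andP; split.
  - exact: le_lt_trans at_.
  - exact: lt_le_trans kb.
  - exact: le_lt_trans at'.
  - exact: lt_le_trans kb.
(* A partition of [[0, 0]] increases strictly from 0 to 0, so it is the empty list. *)
move: T0; rewrite le_eqVlt => /predU1P[<-|T0].
  by exists [::]; split.
pose p := [pred x : R | 0 < x & x < T].
pose s0 := sort <=%O (undup [seq x <- L | p x]).
have s0P x : x \in s0 = (p x) && (x \in L).
  by rewrite mem_sort mem_undup mem_filter.
have s0s : sorted <%O s0 by rewrite sort_lt_sorted undup_uniq.
exists (rcons s0 T); split.
  split; last by rewrite last_rcons.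
  rewrite lt_path_sortedE; apply/andP; split.
    apply/allP => x; rewrite mem_rcons inE => /predU1P[->//|].
    by rewrite s0P => /andP[/andP[]].
  apply/(sortedP 0) => i; rewrite size_rcons ltnS => is0.
  rewrite !nth_rcons is0; case: (ltngtP i.+1 (size s0)) => [i1|i1|E].
  - by rewrite lt_sorted_ltn_nth.
  - by move: is0; rewrite leqNgt i1.
  have : nth 0 s0 i \in s0 by rewrite mem_nth// -E.
  by rewrite s0P => /andP[/andP[]].
move=> k; rewrite size_rcons ltnS => ks t t'.
set a := nth _ _ _; set b := nth _ _ _.
rewrite !in_itv/= => /andP[at_ tb] /andP[at' t'b].
have a0 : 0 <= a.
  rewrite /a; case: k ks @a @b at_ tb at' t'b => [|k] //= ks *.
  rewrite nth_rcons ks; have : nth 0 s0 k \in s0 by rewrite mem_nth.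
  by rewrite s0P => /andP[/andP[/ltW]].
have bT : b <= T.
  rewrite /b nth_rcons; case: ltngtP ks => // ks _.
  have : nth 0 s0 k \in s0 by rewrite mem_nth.
  by rewrite s0P => /andP[/andP[_ /ltW]].
apply: (HL a b a0 (lt_trans at_ tb) bT) => //.
move=> x xL; have [xa|ax] := leP x a; [by left|right].
rewrite leNgt; apply/negP => xb.
have xs0 : x \in s0 by rewrite s0P xL andbT /= (le_lt_trans a0 ax) (lt_le_trans xb bT).
pose j := index x s0; have js : (j < size s0)%N by rewrite index_mem.
have xj : x = nth 0 s0 j by rewrite nth_index.
have jk : (j < k)%N.
  rewrite ltnNge; apply/negP => kj.
  move: xb; rewrite /b nth_rcons (leq_ltn_trans kj js) xj lt_sorted_ltn_nth ?inE//.
    by rewrite ltnNge kj.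
  exact: leq_ltn_trans js.
move: ax; rewrite /a; case E : k jk => [|k'] // jk.
have k's : (k' < size s0)%N by rewrite E in ks.
by rewrite /= nth_rcons k's xj lt_sorted_ltn_nth ?inE// ltnNge -ltnS jk.
Qed.

End controls.

Section admissible_controls.
Context {R : realType} {m : nat}.
Notation mu := (@lebesgue_measure R).
Variables (U : set 'rV[R]_m) (UU : set (control R m)).
Hypothesis hUU : UU = U_pc U \/ UU = U_infty U.
Implicit Types (u : R -> 'rV[R]_m).

Lemma UU_ge0 T u : UU (T, u) -> 0 <= T.
Proof. by case: hUU => -> []. Qed.

Lemma UU_val T u t : UU (T, u) -> 0 <= t -> t <= T -> U (u t).
Proof.
move=> + t0 tT; have tI : t \in `[0, T] by rewrite in_itv/= t0.
by case: hUU => -> [/= _ H *]; exact: H.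
Qed.

Lemma U_pc_measurable T u j : U_pc U (T, u) -> measurable_fun `[0, T] (fun t => u t 0 j).
Proof.
case=> /= T0 _ [s [[ps /eqP/= ls] Hs]].
suff H k : (k <= size s)%N -> measurable_fun `[0, nth 0 (0 :: s) k] (fun t => u t 0 j).
  have := H (size s) (leqnn _).
  suff -> : nth 0 (0 :: s) (size s) = T by [].
  by rewrite -ls (last_nth 0).
elim: k => [_|k ih ks].
  by rewrite /= set_itv1; exact: measurable_fun_set1.
have ab : nth 0 (0 :: s) k < nth 0 s k by move/(pathP 0): ps; apply.
have a0 : 0 <= nth 0 (0 :: s) k.
  case: k ks {ih ab} => [|k] // ks.
  move: ps; rewrite lt_path_sortedE => /andP[/allP H _].
  by apply: ltW; apply: H; apply: mem_nth; exact: ltnW.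
have -> : `[0, nth 0 (0 :: s) k.+1]%classic =
    (`[0, nth 0 (0 :: s) k] `|` `]nth 0 (0 :: s) k, nth 0 s k[) `|` [set nth 0 s k].
  apply/seteqP; split=> t /=; rewrite !in_itv/=.
    move=> /andP[t0]; rewrite le_eqVlt => /predU1P[->|tb]; [by right|left].
    by have [ta|ta] := leP t (nth 0 (0 :: s) k); [left; rewrite t0|right].
  case=> [[/andP[-> ta]|/andP[ta tb]]|->].
  - by rewrite (le_trans ta)// ltW.
  - by rewrite (le_trans a0 (ltW ta)) ltW.
  - by rewrite lexx (le_trans a0)// ltW.
apply/measurable_funU => //; first exact: measurableU.
split; last exact: measurable_fun_set1.
apply/measurable_funU => //; split; first by apply: ih; exact: ltnW.
pose c := (nth 0 (0 :: s) k + nth 0 s k) / 2.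
apply: (@eq_measurable_fun _ _ _ _ _ (cst (u c 0 j))); last exact: measurable_cst.
have cI : c \in `](nth 0 (0 :: s) k), (nth 0 s k)[.
  by rewrite in_itv/= /c; apply/andP; split; move: ab; set x := nth _ _ _; set y := nth _ _ _; lra.
by move=> t; rewrite inE/= => tI; rewrite /cst (Hs k ks t c).
Qed.

Lemma UU_measurable T u j : UU (T, u) -> measurable_fun `[0, T] (fun t => u t 0 j).
Proof. by case: hUU => ->; [exact: U_pc_measurable|case]. Qed.

Lemma UU_cst (T : R) (u0 : 'rV[R]_m) : 0 <= T -> U u0 -> UU (T, cst u0).
Proof.
move=> T0 Uu; case: hUU => ->.
  by apply/U_pcP; split => //; exists [::].
split => //=.
by exists `|u0|; apply: aeW.
Qed.

Lemma UU_sub T u a b : UU (T, u) -> 0 <= a -> a <= b -> b <= T ->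
  UU (b - a, fun t => u (t + a)).
Proof.
move=> + a0 ab bT; have sub t : t \in `[0, b - a] -> t + a \in `[0, T].
  rewrite !in_itv/= => /andP[t0 tba]; rewrite addr_ge0//=.
  by move: tba; rewrite lerBrDr => /le_trans; apply.
case: hUU => ->.
  move=> /U_pcP[T0 uU [L HL]]; apply/U_pcP; split; first by rewrite subr_ge0.
    by move=> t /sub; exact: uU.
  exists [seq x - a | x <- L] => c d c0 cd db H t t' ct td ct' t'd.
  apply: (HL (c + a) (d + a)); rewrite ?ltrD2r// ?addr_ge0//.
    by rewrite (le_trans _ bT)// -lerBrDr.
  move=> x xL; have := H (x - a) (map_f (fun x => x - a) xL).
  by rewrite lerBlDr lerBrDr.
case=> /= T0 uU mu_ [C HC]; split => /=; first by rewrite subr_ge0.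
- by move=> t /sub; exact: uU.
- move=> j; apply: (measurable_comp (F := `[0, T]%classic) (f := fun t => u t 0 j) (g := shiftR a)) => //.
    by move=> _ [t /= tI <-]; exact: sub.
  by apply: measurable_funTS; exact: measurable_shift.
- exists C; apply: ae_mono (ae_shift a HC) => t H tI; apply: H; exact: sub.
Qed.

Lemma UU_cat T1 u1 T2 u2 : UU (T1, u1) -> UU (T2, u2) ->
  UU (T1 + T2, fun t => if t <= T1 then u1 t else u2 (t - T1)).
Proof.
move=> h1 h2; have T10 := UU_ge0 h1; have T20 := UU_ge0 h2.
have uU t : t \in `[0, T1 + T2] -> U (if t <= T1 then u1 t else u2 (t - T1)).
  rewrite in_itv/= => /andP[t0 tT]; case: leP => tT1; first exact: UU_val h1 _ _.
  by apply: UU_val h2 _ _; [rewrite subr_ge0 ltW|rewrite lerBlDl].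
move: (h1) (h2); case: hUU => ->.
  move=> /U_pcP[_ _ [L1 HL1]] /U_pcP[_ _ [L2 HL2]]; apply/U_pcP; split => //.
    exact: addr_ge0.
  exists (T1 :: L1 ++ [seq x + T1 | x <- L2]) => c d c0 cd dT H t t' ct td ct' t'd.
  have [dT1|T1c] := H T1 (mem_head _ _); last first.
    have tT s : s < d -> s <= T1 by move=> sd; rewrite (le_trans (ltW sd)).
    rewrite !tT//; apply: (HL1 c d) => // x xL; apply: H.
    by rewrite inE mem_cat xL orbT.
  have tT s : c < s -> (s <= T1) = false by move=> cs; apply/negbTE; rewrite -ltNge (le_lt_trans dT1).
  rewrite !tT//; apply: (HL2 (c - T1) (d - T1)); rewrite ?ltrD2r ?subr_ge0 ?lerBlDl//.
  move=> x xL; rewrite lerBrDr lerBlDr; apply: H.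
  by rewrite inE mem_cat (map_f (fun x => x + T1) xL) !orbT.
move=> [/= _ _ m1 [C1 HC1]] [/= _ _ m2 [C2 HC2]]; split => //=; first exact: addr_ge0.
- move=> j; have -> : `[0, T1 + T2]%classic = `[0, T1] `|` `]T1, T1 + T2].
    apply/seteqP; split=> t /=; rewrite !in_itv/=.
      by move=> /andP[t0 tT]; have [tT1|tT1] := leP t T1; [left; rewrite t0|right].
    case=> /andP[t0 tT]; first by rewrite t0 (le_trans tT)// lerDl.
    by rewrite tT (le_trans T10)// ltW.
  apply/measurable_funU => //; split.
    apply: (eq_measurable_fun (fun t => u1 t 0 j)) => //.
    by move=> t; rewrite inE/= in_itv/= => /andP[_ ->].
  apply: (eq_measurable_fun ((fun t => u2 t 0 j) \o shiftR (- T1))).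
    by move=> t; rewrite inE/= in_itv/= => /andP[tT _]; rewrite leNgt tT.
  apply: (measurable_comp (F := `[0, T2]%classic)) => //.
    move=> _ [t /= + <-]; rewrite !in_itv/= /shiftR => /andP[tT tT2].
    by rewrite subr_ge0 ltW//= lerBlDl.
  by apply: measurable_funTS; exact: measurable_shift.
- exists (Num.max C1 C2); apply: ae_mono (ae_and HC1 (ae_shift (- T1) HC2)) => t [H1 H2].
  rewrite in_itv/= => /andP[t0 tT]; case: (leP t T1) => tT1; rewrite le_max.
    by rewrite H1// in_itv/= t0.
  by rewrite H2 ?orbT// in_itv/= subr_ge0 ltW//= lerBlDl.
Qed.

End admissible_controls.

(** * Local estimates for smooth maps *)

Section smooth_estimates.
Context {R : realType} {n p : nat}.
Implicit Types (h : 'rV[R]_n -> 'rV[R]_p) (x y z v : 'rV[R]_n).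

Lemma smooth_on_differentiable (V W : normedModType R) (D : set V) (h : V -> W) (x : V) :
  smooth_on D h -> D x -> differentiable h x.
Proof. by move=> /(_ 1%N) [H _]; exact: H. Qed.

Lemma smooth_on_derive (V W : normedModType R) (D : set V) (h : V -> W) (v : V) :
  smooth_on D h -> smooth_on D (fun y : V => 'D_v h y).
Proof. by move=> sh k; have [_] := sh k.+1; exact. Qed.

Lemma smooth_on_continuous (V W : normedModType R) (D : set V) (h : V -> W) (x : V) :
  smooth_on D h -> D x -> {for x, continuous h}.
Proof. by move=> /(_ 0%N); exact. Qed.

Lemma smooth_on_lipschitz (D : set 'rV[R]_n) h x : smooth_on D h -> nbhs x D ->
  exists K r : R, [/\ 0 <= K, 0 < r & forall y z, `|y - x| < r -> `|z - x| < r ->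
    `|h y - h z| <= K * `|y - z|].
Proof.
move=> sh nD; apply: C1_lipschitz_at.
  by apply: filterS nD => y; exact: smooth_on_differentiable.
by move=> v; exact: (smooth_on_continuous (smooth_on_derive v sh) (nbhs_singleton nD)).
Qed.

Lemma diff_sum_derive h x v : differentiable h x ->
  'd h x v = \sum_(k < n) v 0 k *: 'D_(delta_mx 0 k) h x.
Proof.
move=> dh; rewrite {1}[v]row_sum_delta linear_sum; apply: eq_bigr => k _.
by rewrite linearZ/= deriveE.
Qed.

(** Smoothness as defined controls derivatives in fixed directions; decomposing [v] on the canonical
    basis makes the bounds uniform in [v]. *)
Lemma smooth_on_diff_lipschitz (D : set 'rV[R]_n) h x : smooth_on D h -> nbhs x D ->
  exists K r : R, [/\ 0 <= K, 0 < r &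
    forall y z, `|y - x| < r -> `|z - x| < r ->
      [/\ differentiable h y, forall v, `|'d h y v| <= K * `|v| &
        forall v, `|'d h y v - 'd h z v| <= K * `|y - z| * `|v|]].
Proof.
move=> sh nD.
have /choice[Kr HKr] : forall k : 'I_n, exists Kr : R * R, [/\ 0 <= Kr.1, 0 < Kr.2 &
    forall y z, `|y - x| < Kr.2 -> `|z - x| < Kr.2 ->
    `|'D_(delta_mx 0 k) h y - 'D_(delta_mx 0 k) h z| <= Kr.1 * `|y - z|].
  move=> k; have [K [r [K0 r0 H]]] := smooth_on_lipschitz (smooth_on_derive (delta_mx 0 k) sh) nD.
  by exists (K, r).
have /nbhs_ballP[r0 /= r00 Hr0] := nD.
pose r1 := \big[Num.min/1]_k (Kr k).2.
have r10 : 0 < r1.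
  by apply: (big_ind (fun s : R => 0 < s)) => // [a b a0 b0|k _]; [rewrite lt_min a0|have [] := HKr k].
have r1k k : r1 <= (Kr k).2 by exact: bigmin_le.
pose r := Num.min r0 r1.
have r_gt0 : 0 < r by rewrite lt_min r00.
pose K1 := \sum_k (Kr k).1.
pose K2 := \sum_k (`|'D_(delta_mx 0 k) h x| + (Kr k).1 * r).
have K10 : 0 <= K1 by apply: sumr_ge0 => k _; have [] := HKr k.
have K20 : 0 <= K2.
  by apply: sumr_ge0 => k _; have [? _ _] := HKr k; rewrite addr_ge0// mulr_ge0// ltW.
exists (K1 + K2), r; split => //; first exact: addr_ge0.
have dh y : `|y - x| < r -> differentiable h y.
  move=> yx; apply: (smooth_on_differentiable sh); apply: Hr0.
  by rewrite -ball_normE/= distrC (lt_le_trans yx)// ge_min lexx.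
have rk k y : `|y - x| < r -> `|y - x| < (Kr k).2.
  by move=> /lt_le_trans; apply; rewrite (le_trans _ (r1k k))// ge_min lexx orbT.
move=> y z yx zx; split; [exact: dh| |] => v.
  rewrite (diff_sum_derive v (dh y yx)).
  apply: le_trans (ler_norm_sum _ _ _) _.
  apply: (@le_trans _ _ (K2 * `|v|)); last by rewrite ler_wpM2r// lerDr.
  rewrite mulr_suml; apply: ler_sum => k _; rewrite normrZ mulrC ler_pM//; last exact: rV_norm_coord.
  have [Kk0 rk0 Hk] := HKr k.
  have := Hk y x (rk k _ yx); rewrite subrr normr0 => /(_ rk0) H.
  rewrite -['D_(delta_mx 0 k) h y](subrK ('D_(delta_mx 0 k) h x)) addrC.
  rewrite (le_trans (ler_normD _ _))// lerD2l (le_trans H)// ler_wpM2l// ltW//.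
rewrite [X in `|X - _|](diff_sum_derive v (dh y yx)) [X in `|_ - X|](diff_sum_derive v (dh z zx)).
rewrite -sumrB; apply: le_trans (ler_norm_sum _ _ _) _.
apply: (@le_trans _ _ (K1 * `|y - z| * `|v|)); last by rewrite !ler_wpM2r// lerDl.
rewrite !mulr_suml; apply: ler_sum => k _; rewrite -scalerBr normrZ mulrC.
have [Kk0 rk0 Hk] := HKr k.
by rewrite ler_pM//; [exact: Hk (rk k _ yx) (rk k _ zx)|exact: rV_norm_coord].
Qed.

Lemma near_eq_diff (V W : normedModType R) (f g : V -> W) (x v : V) :
  differentiable f x -> differentiable g x -> (\forall y \near x, f y = g y) ->
  'd f x v = 'd g x v.
Proof. by move=> df dg fg; rewrite -!deriveE//; apply: near_eq_derive. Qed.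

End smooth_estimates.

(** * Charts and their transitions *)

Section charts.
Context {R : realType} {n : nat} {M : topologicalType} {A : smooth_atlas R n M}.
Implicit Types (i j : chart_index A) (x y : M).

Definition transition i j := chart j \o chart_inv i.

(** The image of the chart domain is open and [chart_inv] is continuous there, so neighbourhoods in
    [M] contain balls of coordinates. *)
Lemma chart_near i x (Q : set M) : chart_dom i x -> nbhs x Q ->
  exists2 r : R, 0 < r & forall w, `|w - chart i x| < r ->
    [/\ chart_dom i (chart_inv i w), Q (chart_inv i w) & chart i (chart_inv i w) = w].
Proof.
move=> ix nQ.
have n1 : nbhs (chart i x) (chart i @` chart_dom i).
  apply: open_nbhs_nbhs; split; first exact: chart_image_open.
  by exists x.
have n2 : nbhs (chart i x) (chart_inv i @^-1` Q).
  by have := chart_inv_continuous ix; apply; rewrite chartK.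
have /nbhs_ballP[r /= r0 Hr] : nbhs (chart i x) ((chart i @` chart_dom i) `&` (chart_inv i @^-1` Q)).
  exact: filterI.
exists r => // w wx; have [|[y iy yw] Qw] := Hr w.
  by rewrite -ball_normE/= distrC.
by rewrite -yw chartK//; split => //; rewrite -[y](chartK iy) yw.
Qed.

Lemma chart_nbhs i x (r : R) : chart_dom i x -> 0 < r ->
  \forall y \near x, chart_dom i y /\ `|chart i y - chart i x| < r.
Proof.
move=> ix r0; apply: filterI.
  by apply: open_nbhs_nbhs; split => //; exact: chart_dom_open.
have /cvgrPdist_lt/(_ _ r0) := chart_continuous ix.
by apply: filterS => y; rewrite distrC.
Qed.

Lemma transition_nbhs i j x : chart_dom i x -> chart_dom j x ->
  nbhs (chart i x) (chart i @` (chart_dom i `&` chart_dom j)).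
Proof.
move=> ix jx; have nj : nbhs x (chart_dom j).
  by apply: open_nbhs_nbhs; split => //; exact: chart_dom_open.
have [r r0 H] := chart_near ix nj.
apply/nbhs_ballP; exists r => // w; rewrite -ball_normE/= distrC => /H[iw jw E].
by exists (chart_inv i w).
Qed.

Lemma transition_differentiable i j x : chart_dom i x -> chart_dom j x ->
  differentiable (transition i j) (chart i x).
Proof.
move=> ix jx; apply: (smooth_on_differentiable (chart_smooth i j)).
exact: nbhs_singleton (transition_nbhs ix jx).
Qed.

Lemma transitionE i j x : chart_dom i x -> transition i j (chart i x) = chart j x.
Proof. by move=> ix; rewrite /transition/= chartK. Qed.

(** The composite of the two transitions is the identity near the point; the chain rule
    concludes. *)
Lemma transition_diffK i j x v : chart_dom i x -> chart_dom j x ->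
  'd (transition j i) (chart j x) ('d (transition i j) (chart i x) v) = v.
Proof.
move=> ix jx.
have d1 := transition_differentiable ix jx; have d2 := transition_differentiable jx ix.
have d2' : differentiable (transition j i) (transition i j (chart i x)) by rewrite transitionE.
rewrite -[X in 'd _ X](transitionE j ix).
have E := congr1 (fun f => f v) (diff_comp d1 d2').
apply: etrans (esym E) _.
rewrite (@near_eq_diff _ _ _ _ id)//.
- by rewrite diff_val.
- exact: differentiable_comp.
- apply: filterS (transition_nbhs ix jx) => w [y [iy jy] <-].
  by rewrite /transition/= !chartK.
Qed.

End charts.

(** * Trajectories on arbitrary time intervals *)

Section trajectories.
Context {R : realType} {n m : nat} {M : topologicalType} {A : smooth_atlas R n M}.
Variable F : forall x : M, 'rV[R]_m -> tangent_vector A x.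
Notation mu := (@lebesgue_measure R).
Implicit Types (i j : chart_index A) (x y : M) (u : R -> 'rV[R]_m) (g : R -> M).

(** Continuity relative to [[a, b]] is spelled out with explicit radii, so that restriction,
    translation and concatenation do not pass through the subspace topology. *)
Definition sol_on (a b : R) u g :=
  [/\ forall t, a <= t -> t <= b -> forall Q, nbhs (g t) Q ->
        exists2 d : R, 0 < d & forall s, a <= s -> s <= b -> `|s - t| < d -> Q (g s),
      forall i a' b', a <= a' -> a' <= b' -> b' <= b ->
        (forall t, a' <= t -> t <= b' -> chart_dom i (g t)) -> ACon a' b' (chart i \o g) &
      {ae mu, forall t, a < t -> t < b -> forall i, chart_dom i (g t) ->
        is_derive t (1:R) (chart i \o g) (tcoord (F (g t) (u t)) i)}].

Lemma solutionP T x u g : solution F T x u g <-> g 0 = x /\ sol_on 0 T u g.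
Proof.
have E : {within `[0, T], continuous g} <-> forall t, 0 <= t -> t <= T -> forall Q, nbhs (g t) Q ->
        exists2 d : R, 0 < d & forall s, 0 <= s -> s <= T -> `|s - t| < d -> Q (g s).
  split=> [/subspace_continuousP H t t0 tT Q nQ|H].
    have := H t; rewrite /= in_itv/= t0 tT => /(_ isT Q nQ).
    rewrite /= /nbhs/= /within => /nbhs_ballP[d/= d0 Hd]; exists d => // s s0 sT std.
    by apply: Hd; rewrite /ball/= ?in_itv/= ?s0// distrC.
  apply/subspace_continuousP => t; rewrite /= in_itv/= => /andP[t0 tT] Q nQ.
  have [d d0 Hd] := H t t0 tT Q nQ.
  rewrite /= /nbhs/= /within; apply/nbhs_ballP; exists d => // s /=; rewrite /ball/= distrC => std.
  by rewrite in_itv/= => /andP[s0 sT]; exact: Hd.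
split=> [[g0 [c ac] dg]|[g0 [c ac dg]]]; split => //.
- split; [exact/E| |].
  + move=> i a' b' a0 ab bT H; apply: ac => // t; rewrite in_itv/= => /andP[]; exact: H.
  + by apply: ae_mono dg => t H t0 tT; apply: H; rewrite in_itv/= t0.
- split; first exact/E.
  by move=> i a b a0 ab bT H; apply: ac => // t at_ tb; apply: H; rewrite in_itv/= at_.
- by apply: ae_mono dg => t H; rewrite in_itv/= => /andP[]; exact: H.
Qed.

Lemma sol_on_sub a b a' b' u g : a <= a' -> b' <= b -> sol_on a b u g -> sol_on a' b' u g.
Proof.
move=> aa bb [c ac dg]; split.
- move=> t at_ tb Q nQ; have [d d0 H] := c t (le_trans aa at_) (le_trans tb bb) Q nQ.
  by exists d => // s as_ sb; apply: H; [exact: le_trans as_|exact: le_trans bb].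
- by move=> i a1 b1 h1 h2 h3; apply: ac => //; [exact: le_trans h1|exact: le_trans bb].
- by apply: ae_mono dg => t H h1 h2; apply: H; [exact: le_lt_trans h1|exact: lt_le_trans bb].
Qed.

Lemma sol_on_shift a b c u g : sol_on (a + c) (b + c) u g ->
  sol_on a b (fun t => u (t + c)) (fun t => g (t + c)).
Proof.
move=> [co ac dg]; split.
- move=> t at_ tb Q nQ; have [||d d0 H] := co (t + c) _ _ Q nQ; rewrite ?lerD2r//.
  exists d => // s as_ sb sd; apply: H; rewrite ?lerD2r//.
  by rewrite opprD addrACA subrr addr0.
- move=> i a' b' h1 h2 h3 H.
  apply: (@ACon_shift _ _ (chart i \o g)); apply: ac; rewrite ?lerD2r// => t h4 h5.
  by rewrite -[t](subrK c); apply: H; rewrite ?lerBrDr ?lerBlDr.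
- apply: ae_mono (ae_shift c dg) => t H h1 h2 i it.
  have := H _ _ i it; rewrite !ltrD2r => /(_ h1 h2) D.
  have := is_derive_diff_comp.
  have Ds : is_derive t (1:R) (fun s : R => s + c) (1:R).
    have := is_derive_line c 1 t; rewrite (_ : (fun s : R => c + s *: 1) = fun s => s + c)//.
    by apply/funext => s; rewrite addrC /GRing.scale/= mulr1.
  have dch : differentiable (chart i \o g) (t + c) by apply/derivable1_diffP; case: D.
  move=> /(_ _ _ _ (chart i \o g) _ t 1 Ds dch); rewrite -deriveE//.
  by case: D => _ ->.
Qed.

Lemma sol_on_eq a b u v g f : (forall t, a <= t -> t <= b -> g t = f t) ->
  (forall t, a < t -> t < b -> u t = v t) -> sol_on a b u g -> sol_on a b v f.
Proof.
move=> gf uv [c ac dg]; split.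
- move=> t at_ tb Q; rewrite -gf// => nQ; have [d d0 H] := c t at_ tb Q nQ.
  by exists d => // s as_ sb sd; rewrite -gf//; exact: H.
- move=> i a' b' h1 h2 h3 H; apply: (ACon_eq (f := chart i \o g)).
    by move=> t h4 h5 /=; rewrite gf//; [exact: le_trans h4|exact: le_trans h3].
  by apply: ac => // t h4 h5; rewrite gf; [exact: H|exact: le_trans h4|exact: le_trans h3].
- apply: ae_mono dg => t H h1 h2 i; rewrite -gf ?ltW// -uv// => it.
  apply: near_eq_is_derive (H h1 h2 i it) => //; near=> s.
  have as_ : a < s by near: s; exact: lt_nbhsr.
  have sb : s < b by near: s; exact: lt_nbhsl.
  by rewrite /= gf// ltW.
Unshelve. all: by end_near. Qed.

Lemma sol_on_cat a c b u g : a <= c -> c <= b -> sol_on a c u g -> sol_on c b u g ->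
  sol_on a b u g.
Proof.
move=> ac cb [c1 ac1 d1] [c2 ac2 d2]; split.
- move=> t at_ tb Q nQ.
  have [d10 d1p H1] : exists2 d : R, 0 < d & forall s, a <= s -> s <= c -> `|s - t| < d -> Q (g s).
    have [tc|ct] := leP t c; first exact: c1.
    exists (t - c); first by rewrite subr_gt0.
    by move=> s as_ sc; rewrite distrC => /(le_lt_trans (ler_norm _)); lra.
  have [d20 d2p H2] : exists2 d : R, 0 < d & forall s, c <= s -> s <= b -> `|s - t| < d -> Q (g s).
    have [ct|tc] := leP c t; first exact: c2.
    exists (c - t); first by rewrite subr_gt0.
    by move=> s as_ sc => /(le_lt_trans (ler_norm _)); lra.
  exists (Num.min d10 d20); first by rewrite lt_min d1p.
  move=> s as_ sb; rewrite lt_min => /andP[h1 h2].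
  by have [sc|/ltW cs] := leP s c; [exact: H1|exact: H2].
- move=> i a' b' h1 h2 h3 H.
  have [bc|/ltW cb'] := leP b' c; first exact: ac1.
  have [ca|/ltW ac'] := leP c a'; first exact: ac2.
  apply: (ACon_cat ac' cb').
    by apply: ac1 => // t h4 h5; apply: H => //; exact: le_trans cb'.
  by apply: ac2 => // t h4 h5; apply: H => //; exact: le_trans h4.
- apply: ae_mono (ae_and (ae_neq c) (ae_and d1 d2)) => t [tc [H1 H2]] h1 h2.
  by move: tc; rewrite neq_lt => /orP[h|h]; [exact: H1|exact: H2].
Qed.

(** One chart is enough: transitions are locally Lipschitz, hence preserve absolute continuity on
    short intervals, and the chain rule with [tcoord_change] carries the equation to the other
    charts. *)
Lemma sol_on_chart i (a b : R) u (xi : R -> 'rV[R]_n) : a <= b -> ACon a b xi ->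
  (forall t, a <= t -> t <= b -> chart_dom i (chart_inv i (xi t)) /\ chart i (chart_inv i (xi t)) = xi t) ->
  {ae mu, forall t, a < t -> t < b -> is_derive t (1:R) xi (tcoord (F (chart_inv i (xi t)) (u t)) i)} ->
  sol_on a b u (chart_inv i \o xi).
Proof.
move=> ab ACxi im dxi.
have cxi t (e : R) : 0 < e -> a <= t -> t <= b -> exists2 d : R, 0 < d &
    forall s, a <= s -> s <= b -> `|s - t| < d -> `|xi s - xi t| < e.
  move=> e0 at_ tb; have [d d0 H] := ACon_cont ACxi e0; exists d => // s as_ sb std.
  have [st|/ltW ts] := leP s t.
    by rewrite distrC; apply: H => //; move: std; rewrite distrC ger0_norm// subr_ge0.
  by apply: H => //; move: std; rewrite ger0_norm// subr_ge0.
split.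
- move=> t at_ tb Q /= nQ; have [it iE] := im t at_ tb.
  have [r r0 Hr] := chart_near it nQ.
  have [d d0 H] := cxi t r r0 at_ tb; exists d => // s as_ sb std.
  by have [] := Hr (xi s); rewrite ?iE//; exact: H.
- move=> j a' b' h1 h2 h3 H.
  apply: ACon_local => // t at_ tb; have [it iE] := im t (le_trans h1 at_) (le_trans tb h3).
  have jt := H t at_ tb; rewrite /= in jt.
  have nT := transition_nbhs it jt.
  have [K [r [K0 r0 HK]]] := smooth_on_lipschitz (chart_smooth i j) nT.
  have [d d0 Hd] := cxi t r r0 (le_trans h1 at_) (le_trans tb h3); exists d => // p q ap pq qb tp qt.
  apply: (ACon_lip (K := K)); first exact: ACon_sub (le_trans h1 ap) (le_trans qb h3) ACxi.
  move=> s s' ps ss sq; apply: HK; rewrite iE; apply: Hd.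
  + by rewrite (le_trans h1)// (le_trans ap)// (le_trans ps).
  + by rewrite (le_trans sq)// (le_trans qb).
  + by rewrite ltr_norml; apply/andP; split; lra.
  + by rewrite (le_trans h1)// (le_trans ap).
  + by rewrite (le_trans ss)// (le_trans sq)// (le_trans qb).
  + by rewrite ltr_norml; apply/andP; split; lra.
- apply: ae_mono dxi => t H h1 h2 j jt; have [it iE] := im t (ltW h1) (ltW h2).
  have /= jt' := jt.
  have dt := transition_differentiable it jt'; rewrite iE in dt.
  have := is_derive_diff_comp (H h1 h2) dt.
  have := tcoord_change (F (chart_inv i (xi t)) (u t)) it jt'.
  rewrite iE => E D.
  apply: is_derive_eq D _; exact: esym E.
Qed.

End trajectories.

(** * Freezing the control variable of a smooth map *)

Section smooth_slices.
Context {R : realType} {n m p : nat}.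

Lemma derive_slice (G : 'rV[R]_n * 'rV[R]_m -> 'rV[R]_p) (u0 : 'rV[R]_m) (v : 'rV[R]_n) :
  (fun w => 'D_v (fun w => G (w, u0)) w) = (fun w => 'D_(v, 0) G (w, u0)).
Proof.
apply/funext => w; rewrite /derive.
set f1 := (X in lim (X @ _)); set f2 := (X in _ = lim (X @ _)).
suff -> : f1 = f2 by [].
apply/funext => h; rewrite /f1 /f2 /=; congr (_ *: (_ - _)).
have -> // : h *: ((v, 0) : 'rV[R]_n * 'rV[R]_m) + (w, u0) = (h *: v + w, u0).
by apply: injective_projections => //=; rewrite scaler0 add0r.
Qed.

Lemma continuous_pair_cst (u0 : 'rV[R]_m) (w : 'rV[R]_n) :
  {for w, continuous (fun w : 'rV[R]_n => (w, u0))}.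
Proof.
move=> Q [[Q1 Q2] /= [n1 n2] H].
by apply: filterS n1 => y Qy; apply: H; split => //=; exact: nbhs_singleton.
Qed.

Lemma continuous_slice (G : 'rV[R]_n * 'rV[R]_m -> 'rV[R]_p) (u0 : 'rV[R]_m) (w : 'rV[R]_n) :
  {for (w, u0), continuous G} -> {for w, continuous (fun w => G (w, u0))}.
Proof. by move=> cG; apply: continuous_comp; [exact: continuous_pair_cst|exact: cG]. Qed.

(** Induction on the order: the derivative of the slice along [v] is the slice of the derivative
    along [(v, 0)]. *)
Lemma smooth_on_slice (D : set ('rV[R]_n * 'rV[R]_m)) (G : 'rV[R]_n * 'rV[R]_m -> 'rV[R]_p) (u0 : 'rV[R]_m) :
  smooth_on D G -> smooth_on [set w | D (w, u0)] (fun w => G (w, u0)).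
Proof.
move=> sG k; move: {sG}(sG k).
elim: k G => [|k ih] G /= H; first by move=> w /= /H; exact: continuous_slice.
case: H => H1 H2; split.
  move=> w /= /H1 dG.
  apply: (@differentiable_comp _ _ _ _ (fun w => (w, u0)) G) => //.
by move=> v; rewrite derive_slice; exact: (ih _ (H2 (v, 0))).
Qed.

End smooth_slices.

Lemma linear_sub_le (R : realType) (V W : normedModType R) (f g : {linear V -> W}) (u v : V) :
  `|f u - g v| <= `|f (u - v)| + `|f v - g v|.
Proof. by rewrite linearB -[in leLHS](subrKA (f v)) ler_normD. Qed.

(** * Stability of the Caratheodory conditions *)

Section caratheodory_lemmas.
Context {R : realType} {n m : nat} {M : topologicalType} {A : smooth_atlas R n M}.
Variable F : forall x : M, 'rV[R]_m -> tangent_vector A x.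
Notation mu := (@lebesgue_measure R).
Implicit Types (i j : chart_index A) (x y : M) (u : R -> 'rV[R]_m) (g : R -> M).

Definition cara_at i x (T : R) u := exists (N : set M) (l : R -> R),
  [/\ nbhs x N, N `<=` chart_dom i, mu.-integrable `[0, T] (EFin \o l) &
    {ae mu, forall t : R, t \in `[0, T] -> forall y z, N y -> N z ->
      `|tcoord (F y (u t)) i| <= l t /\
      `|tcoord (F y (u t)) i - tcoord (F z (u t)) i| <= l t * `|chart i y - chart i z|}].

Lemma cara_at_dom i x T u : cara_at i x T u -> chart_dom i x.
Proof. by case=> N [l [nN Ni _ _]]; apply: Ni; exact: nbhs_singleton. Qed.

(** Two concatenated controls may come with bounds in different charts at the same point, and a
    common chart is needed. *)
Lemma cara_at_change i j x T u : chart_dom j x -> cara_at i x T u -> cara_at j x T u.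
Proof.
move=> jx ci; have ix := cara_at_dom ci; case: ci => N [l [nN Ni il H]].
have [K [r [K0 r0 HK]]] := smooth_on_diff_lipschitz (chart_smooth i j) (transition_nbhs ix jx).
have [K3 [r3 [K30 r30 HK3]]] := smooth_on_lipschitz (chart_smooth j i) (transition_nbhs jx ix).
(* The first [K] bounds the coordinates. In the Lipschitz estimate, one [K] comes from the
   differential applied to the difference of coordinates, the other from the variation of the
   differential, and [K3] converts distances in chart [i] into distances in chart [j]. *)
pose C := K + (K + K) * K3.
have C0 : 0 <= C by rewrite addr_ge0// mulr_ge0// addr_ge0.
exists (N `&` ([set y | chart_dom i y /\ `|chart i y - chart i x| < r] `&`
  [set y | chart_dom j y /\ `|chart j y - chart j x| < r3])), (fun t => C * l t); split.
- by apply: filterI => //; apply: filterI; exact: chart_nbhs.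
- by move=> y [_ [_ []]].
- have H0 : mu.-integrable `[0, T] (fun t => (C%:E * (EFin \o l) t)%E) by exact: integrableZl.
  exact: H0.
apply: ae_mono H => t H tI y z [Ny [[iy yr] [jy yr3]]] [Nz [[iz zr] [jz zr3]]].
have [Hy Hyz] := H tI y z Ny Nz; have [Hz _] := H tI z y Nz Ny.
have l0 : 0 <= l t by apply: le_trans Hy.
have -> := tcoord_change (F y (u t)) iy jy; have -> := tcoord_change (F z (u t)) iz jz.
have [dy by_ Dyz] := HK _ _ yr zr; split.
  apply: le_trans (by_ _) _; apply: (@le_trans _ _ (K * l t)); first by rewrite ler_wpM2l.
  by rewrite ler_wpM2r// lerDl mulr_ge0// addr_ge0.
have := HK3 _ _ yr3 zr3.
rewrite -/(transition j i) (transitionE i jy) (transitionE i jz) => h3.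
set ty := tcoord _ i in Hy Hyz *; set tz := tcoord _ i in Hz Hyz *.
apply: (le_trans (linear_sub_le _ _ ty tz)).
apply: (@le_trans _ _ ((K + K) * l t * `|chart i y - chart i z|)).
  rewrite mulrDl mulrDl lerD//.
    by apply: le_trans (by_ _) _; rewrite -mulrA ler_wpM2l.
  by apply: le_trans (Dyz _) _; rewrite -!mulrA ler_wpM2l// mulrC ler_wpM2r.
apply: (@le_trans _ _ ((K + K) * l t * (K3 * `|chart j y - chart j z|))).
  by rewrite ler_wpM2l// mulr_ge0// addr_ge0.
have -> : (K + K) * l t * (K3 * `|chart j y - chart j z|) = (K + K) * K3 * l t * `|chart j y - chart j z|.
  by ring.
by rewrite !ler_wpM2r// lerDr.
Qed.

Lemma integrable_itvP (a b : R) (l : R -> R) : mu.-integrable `[a, b] (EFin \o l) ->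
  integrableR (l \_ `[a, b]).
Proof.
by move=> il; rewrite /integrableR -restrict_EFin; apply/integrable_restrict => //=; rewrite setTI.
Qed.

Lemma integrableRD (f g : R -> R) : integrableR f -> integrableR g ->
  integrableR (fun t => f t + g t).
Proof.
move=> if_ ig.
have H : mu.-integrable setT (fun t => ((EFin \o f) t + (EFin \o g) t)%E) by exact: integrableD.
exact: H.
Qed.

Lemma cara_sub T u a b : caratheodory F T u -> 0 <= a -> b <= T ->
  caratheodory F (b - a) (fun t => u (t + a)).
Proof.
move=> cu a0 bT x; have [i [N [l [nN Ni il H]]]] := cu x.
exists i, N, (fun t => (l \_ `[0, T]) (t + a)); split => //.
  exact: (integrableR_sub (measurable_itv _) (integrableR_shift a (integrable_itvP il))).
apply: ae_mono (ae_shift a H) => t Ht; rewrite in_itv/= => /andP[t0 tb].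
have tI : t + a \in `[0, T].
  by rewrite in_itv/= addr_ge0//= (le_trans _ bT)// -lerBrDr.
by rewrite patchE mem_set//; exact: Ht.
Qed.

Lemma cara_cat T1 u1 T2 u2 : 0 <= T1 -> caratheodory F T1 u1 -> caratheodory F T2 u2 ->
  caratheodory F (T1 + T2) (fun t => if t <= T1 then u1 t else u2 (t - T1)).
Proof.
move=> T10 c1 c2 x; have [i H1] := c1 x; have [j H2] := c2 x.
have {H1}H1 : cara_at i x T1 u1 by [].
have {H2}H2 : cara_at j x T2 u2 by [].
have := cara_at_change (cara_at_dom H1) H2; case: H1 => N1 [l1 [nN1 N1i il1 H1]].
move=> [N2 [l2 [nN2 N2i il2 {}H2]]].
exists i, (N1 `&` N2), (fun t => (l1 \_ `[0, T1]) t + (l2 \_ `[0, T2]) (t - T1)); split.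
- exact: filterI.
- by move=> y [/N1i].
- apply: (integrableR_sub (measurable_itv _)).
  apply: integrableRD; first exact: integrable_itvP.
  exact: (integrableR_shift (- T1) (integrable_itvP il2)).
(* Away from the junction time, exactly one of the two truncated bounds is active. *)
apply: ae_mono (ae_and (ae_neq T1) (ae_and H1 (ae_shift (- T1) H2))) => t [tT1 [h1 h2]].
rewrite in_itv/= => /andP[t0 tT] y z [Ny1 Ny2] [Nz1 Nz2].
rewrite !patchE; have [tle|tgt] := leP t T1.
  have I1 : t \in `[0, T1]%classic by rewrite inE/= in_itv/= t0.
  have I2 : t - T1 \notin `[0, T2]%classic.
    by rewrite notin_setE/= in_itv/= subr_ge0 => /andP[h _]; move: tT1; rewrite eq_le tle h.
  rewrite I1 (negbTE I2) addr0; apply: h1 => //; by rewrite in_itv/= t0.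
have I1 : t \notin `[0, T1]%classic by rewrite notin_setE/= in_itv/= => /andP[_]; rewrite leNgt tgt.
have I2 : t - T1 \in `[0, T2] by rewrite in_itv/= subr_ge0 ltW//= lerBlDl.
rewrite (negbTE I1) add0r mem_set//; exact: h2.
Qed.

Lemma cara_cst (U : set 'rV[R]_m) (T : R) (u0 : 'rV[R]_m) : smooth_control_field U F -> U u0 -> 0 <= T ->
  caratheodory F T (cst u0).
Proof.
move=> sF Uu T0 x; have [i ix] := chart_cover A x.
have [W [G [oW Wx sG FG]]] := sF i x u0 ix Uu.
pose h w := G (w, u0).
have nW : nbhs (chart i x) [set w | W (w, u0)].
  have : nbhs (chart i x, u0) W by exact: open_nbhs_nbhs.
  exact: (continuous_pair_cst (u0 := u0) (w := chart i x)).
have sh : smooth_on [set w | W (w, u0)] h := smooth_on_slice u0 sG.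
have [K [r [K0 r0 HK]]] := smooth_on_lipschitz sh nW.
have /nbhs_ballP[r1 /= r10 Hr1] := nW.
pose r2 := Num.min r r1.
have r20 : 0 < r2 by rewrite lt_min r0.
(* The first term is the Lipschitz constant, the other two bound the field near [x]. *)
pose C := K + K * r + `|h (chart i x)|.
exists i, [set y | chart_dom i y /\ `|chart i y - chart i x| < r2], (cst C); split.
- exact: chart_nbhs.
- by move=> y [].
- apply: continuous_compact_integrable; first exact: segment_compact.
  by apply: continuous_subspaceT => ?; exact: cvg_cst.
apply: aeW => t _ y z [iy yr] [iz zr].
have yr' : `|chart i y - chart i x| < r by rewrite (lt_le_trans yr)// ge_min lexx.
have zr' : `|chart i z - chart i x| < r by rewrite (lt_le_trans zr)// ge_min lexx.
have Wy : W (chart i y, u0).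
  by apply: Hr1; rewrite -ball_normE/= distrC (lt_le_trans yr)// ge_min lexx orbT.
have Wz : W (chart i z, u0).
  by apply: Hr1; rewrite -ball_normE/= distrC (lt_le_trans zr)// ge_min lexx orbT.
rewrite /cst (FG y u0 iy Uu Wy) (FG z u0 iz Uu Wz) -/(h _) -/(h _); split.
  rewrite -[h (chart i y)](subrK (h (chart i x))) (le_trans (ler_normD _ _))//.
  rewrite lerD2r (le_trans (HK _ _ yr' _))// ?subrr ?normr0//.
  by rewrite (@le_trans _ _ (K * r))// ?lerDr// ler_wpM2l// ltW.
apply: le_trans (HK _ _ yr' zr') _; rewrite ler_wpM2r// /C -addrA lerDl addr_ge0// mulr_ge0// ltW//.
Qed.

End caratheodory_lemmas.

Lemma near_eq_differentiable (R : realType) (V W : normedModType R) (f g : V -> W) (x : V) :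
  (\forall y \near x, f y = g y) -> differentiable g x -> differentiable f x.
Proof.
move=> fg dg; have [cg /eqaddoP og] := (diff_locallyP _ _).1 dg.
have of_ : f \o shift x = cst (f x) + 'd g x +o_ 0 id.
  apply/eqaddoP => e e0.
  have H : \forall h \near (0 : V), f (h + x) = g (h + x).
    have : (h + x) @[h --> (0 : V)] --> x.
      by rewrite -[X in _ --> X]add0r; apply: cvgD; [exact: cvg_id|exact: cvg_cst].
    by move=> /(_ _ fg).
  apply: filterS2 (og e e0) H => h ogh fgh; apply: le_trans ogh.
  set a := (X in `|X| <= _); set b := (X in _ <= `|X|).
  suff -> : a = b by [].
  transitivity (f (h + x) - (f x + 'd g x h)) => //.
  by rewrite fgh (nbhs_singleton fg).
have E := diff_unique cg of_.
apply/diff_locallyP; split; first by move=> y; rewrite E; exact: cg.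
by move: of_ => /eqaddoP h; apply/eqaddoP; rewrite E.
Qed.

(** * Measurability of superpositions *)

Section composition_measurability.
Context {R : realType} {n m : nat}.
Notation mu := (@lebesgue_measure R).

Definition l1dist {k} (w : 'rV[R]_k) (q : 'rV[rat]_k) : R := \sum_j `|w 0 j - ratr (q 0 j)|.

Lemma l1dist_dense k (w : 'rV[R]_k) (e : R) : 0 < e -> exists q, l1dist w q < e.
Proof.
move=> e0; have [d dE] : exists d, d = e / k.+1%:R by exists (e / k.+1%:R).
have d0 : 0 < d by rewrite dE divr_gt0.
have /choice[q Hq] : forall j : 'I_k, exists q : rat, `|w 0 j - ratr q| < d.
  move=> j; have [|q] := @rat_in_itvoo R (w 0 j - d) (w 0 j + d); first lra.
  rewrite in_itv/= => /andP[q1 q2]; exists q; rewrite ltr_norml; apply/andP; split; lra.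
exists (\row_j q j); rewrite /l1dist.
apply: (@le_lt_trans _ _ (\sum_(j < k) d)).
  by apply: ler_sum => j _; rewrite mxE ltW.
rewrite sumr_const card_ord -[X in X < _]mulr_natl dE mulrCA -[X in _ < X]mulr1 ltr_pM2l//.
by rewrite ltr_pdivrMr// mul1r ltr_nat.
Qed.

Lemma l1dist_near k (w w' : 'rV[R]_k) q : `|w - w'| <= l1dist w q + l1dist w' q.
Proof.
apply: rV_norm_le; first by rewrite addr_ge0// sumr_ge0.
move=> j; rewrite !mxE.
have H (v : 'rV[R]_k) : `|v 0 j - ratr (q 0 j)| <= l1dist v q.
  by rewrite /l1dist (bigD1 j)//= lerDl sumr_ge0.
rewrite -(subrKA (ratr (q 0 j))) (le_trans (ler_normD _ _))// lerD//.
by rewrite distrC.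
Qed.

(* B and U need not be measurable: { H > c } is covered by countably many rational
   balls on which H > c. *)
Lemma comp_measurable (D : set R) (B : set 'rV[R]_n) (U : set 'rV[R]_m)
    (H : 'rV[R]_n -> 'rV[R]_m -> R) (xi : R -> 'rV[R]_n) (v : R -> 'rV[R]_m) :
  measurable D ->
  (forall w u, B w -> U u -> forall e, 0 < e -> exists2 d, 0 < d &
     forall w' u', B w' -> U u' -> `|w' - w| < d -> `|u' - u| < d -> `|H w' u' - H w u| < e) ->
  (forall j, measurable_fun D (fun t => xi t 0 j)) ->
  (forall j, measurable_fun D (fun t => v t 0 j)) ->
  (forall t, D t -> B (xi t) /\ U (v t)) ->
  measurable_fun D (fun t => H (xi t) (v t)).
Proof.
move=> mD cH mxi mv DB.
apply: (measurability _ (RGenOInfty.measurableE R)) => _ [_ [c ->] <-].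
pose good (p : 'rV[rat]_n * 'rV[rat]_m * nat) := forall w u, B w -> U u ->
  l1dist w p.1.1 < p.2.+1%:R^-1 -> l1dist u p.1.2 < p.2.+1%:R^-1 -> c < H w u.
pose box (p : 'rV[rat]_n * 'rV[rat]_m * nat) := D `&` [set t | good p /\
  l1dist (xi t) p.1.1 < p.2.+1%:R^-1 /\ l1dist (v t) p.1.2 < p.2.+1%:R^-1].
have -> : D `&` (fun t => H (xi t) (v t)) @^-1` `]c, +oo[ = \bigcup_p box p.
  apply/seteqP; split => t /=.
    move=> [Dt]; rewrite in_itv/= andbT => ct; have [Bt Ut] := DB t Dt.
    have e0 : 0 < H (xi t) (v t) - c by rewrite subr_gt0.
    have [d d0 Hd] := cH _ _ Bt Ut _ e0.
    have d20 : 0 < d / 2 by rewrite divr_gt0.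
    have [k _ /(_ k (leqnn k)) Hk] := near_infty_natSinv_lt (PosNum d20).
    rewrite /= in Hk.
    have k0 : 0 < (k.+1%:R^-1 : R) by rewrite invr_gt0.
    have [q Hq] := l1dist_dense (xi t) k0; have [q' Hq'] := l1dist_dense (v t) k0.
    exists (q, q', k) => //; split => //; split => // w u Bw Uu /= wq uq.
    have wd : `|w - xi t| < d.
      apply: le_lt_trans (l1dist_near _ _ q) _; rewrite [d]splitr.
      exact: lt_trans (ltrD wq Hq) (ltrD Hk Hk).
    have ud : `|u - v t| < d.
      apply: le_lt_trans (l1dist_near _ _ q') _; rewrite [d]splitr.
      exact: lt_trans (ltrD uq Hq') (ltrD Hk Hk).
    by have := Hd _ _ Bw Uu wd ud; rewrite distrC => /(le_lt_trans (ler_norm _)); rewrite ltrD2l ltrN2.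
  move=> [p _ [Dt [gp [h1 h2]]]]; split => //; rewrite in_itv/= andbT.
  by have [Bt Ut] := DB t Dt; exact: gp.
apply: countable_bigcupT_measurable; first exact: countableP.
move=> p; have [gp|ngp] := pselect (good p); last first.
  rewrite (_ : box p = set0)//; apply/seteqP; split => t //=.
  by move=> [_ [/ngp]].
have ml k (w : R -> 'rV[R]_k) (q : 'rV[rat]_k) : (forall j, measurable_fun D (fun t => w t 0 j)) ->
    measurable (D `&` [set t | l1dist (w t) q < p.2.+1%:R^-1]).
  move=> mw; have mf : measurable_fun D (fun t => l1dist (w t) q).
    apply: measurable_sum => j; apply: measurableT_comp => //.
    by apply: measurable_funB => //; exact: measurable_cst.
  have := mf mD `]-oo, p.2.+1%:R^-1[%classic (measurable_itv _).
  by rewrite (_ : _ @^-1` _ = [set t | l1dist (w t) q < p.2.+1%:R^-1])//; apply/seteqP; split => t /=; rewrite in_itv.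
have -> : box p = (D `&` [set t | l1dist (xi t) p.1.1 < p.2.+1%:R^-1]) `&`
    (D `&` [set t | l1dist (v t) p.1.2 < p.2.+1%:R^-1]).
  by apply/seteqP; split => t /=; [move=> [? [? [? ?]]]|move=> [[? ?] [? ?]]].
by apply: measurableI; exact: ml.
Qed.

End composition_measurability.

(** * Attainability as a relation *)

Section reachability.
Context {R : realType} {n m : nat} {M : topologicalType} {A : smooth_atlas R n M}.
Variables (U : set 'rV[R]_m) (F : forall x : M, 'rV[R]_m -> tangent_vector A x).
Hypothesis smoothF : smooth_control_field U F.
Variable UU : set (control R m).
Hypothesis hUU : UU = U_pc U \/ UU = U_infty U.
Notation mu := (@lebesgue_measure R).
Implicit Types (i j : chart_index A) (x y z : M) (u : R -> 'rV[R]_m) (g : R -> M).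

Definition reach x y := attainable F UU x y.

Lemma reach_intro T u a b g : UU (T, u) -> caratheodory F T u ->
  0 <= a -> a <= b -> b <= T -> sol_on F a b u g -> reach (g a) (g b).
Proof.
move=> hu cu a0 ab bT sg.
exists (b - a), (fun t => u (t + a)), (fun t => g (t + a)); split.
- exact: (UU_sub hUU hu a0 ab bT).
- split; first exact: cara_sub.
  apply/solutionP; split; first by rewrite add0r.
  by apply: sol_on_shift; rewrite add0r subrK.
- by rewrite subrK.
Qed.

Lemma reach_elim x y : reach x y -> exists T u g,
  [/\ UU (T, u), caratheodory F T u, sol_on F 0 T u g, g 0 = x & g T = y].
Proof.
by move=> [T [u [g [hu [cu /solutionP[g0 sg]] ->]]]]; exists T, u, g.
Qed.

Lemma reach_cst v0 a b g : U v0 -> a <= b -> sol_on F a b (fun=> v0) g -> reach (g a) (g b).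
Proof.
move=> Uu ab sg; have ba : 0 <= b - a by rewrite subr_ge0.
have := @reach_intro (b - a) (cst v0) 0 (b - a) (fun t => g (t + a)) (UU_cst hUU ba Uu) _ (lexx 0) ba (lexx _).
rewrite add0r subrK; apply.
  exact: cara_cst smoothF Uu ba.
have := @sol_on_shift _ _ _ _ _ F 0 (b - a) a (fun=> v0) g.
by rewrite add0r subrK; apply.
Qed.

Lemma reach_trans x y z : reach x y -> reach y z -> reach x z.
Proof.
move=> /reach_elim[T1 [u1 [g1 [hu1 c1 s1 g10 g1T]]]] /reach_elim[T2 [u2 [g2 [hu2 c2 s2 g20 g2T]]]].
have T10 := UU_ge0 hUU hu1; have T20 := UU_ge0 hUU hu2.
pose u t := if t <= T1 then u1 t else u2 (t - T1).
pose g t := if t <= T1 then g1 t else g2 (t - T1).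
have T12 : 0 <= T1 + T2 by rewrite addr_ge0.
have gE : g (T1 + T2) = z.
  rewrite /g; case: ifPn => h; last by rewrite addrAC subrr add0r.
  (* Here [T2 = 0]: the second trajectory is a point and the value comes from the first branch. *)
  have -> : T1 + T2 = T1 by apply/eqP; rewrite eq_le h lerDl.
  have T2E : T2 = 0 by apply/eqP; rewrite eq_le T20 andbT; move: h; rewrite gerDl.
  by rewrite g1T -g20 -g2T T2E.
have <- : g 0 = x by rewrite /g T10.
rewrite -gE; apply: (@reach_intro (T1 + T2) u) => //.
- exact: (UU_cat hUU).
- exact: cara_cat.
apply: (@sol_on_cat _ _ _ _ _ _ _ T1) => //; first by rewrite lerDl.
  apply: sol_on_eq s1 => t t0 tT.
    by rewrite /g tT.
  by rewrite /u ltW.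
have s2' : sol_on F T1 (T1 + T2) (fun t => u2 (t - T1)) (fun t => g2 (t - T1)).
  by apply: sol_on_shift; rewrite subrr addrAC subrr add0r.
apply: sol_on_eq s2' => t tT1 tT.
  rewrite /g; case: ifPn => // h.
  have -> : t = T1 by apply/eqP; rewrite eq_le h tT1.
  by rewrite subrr g20 g1T.
by rewrite /u leNgt tT1.
Qed.

(** If [x] adheres to the set, then [x] attains some point of it, because [x] attains a
    neighbourhood of itself; concatenation gives [reach x y]. *)
Lemma reach_backward_closed y : locally_controllable F UU -> closed [set x | reach x y].
Proof.
move=> lc; rewrite closedE => x H; apply: contrapT => nxy; apply: H.
have := lc x; rewrite /interior => nx.
have [E|/existsNP[z]] := pselect (forall z, attainable F UU x z -> ~ reach z y).
  by apply: filterS nx => z xz /=; exact: E.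
by move=> /not_implyP[xz /contrapT zy]; exfalso; apply: nxy; exact: reach_trans xz zy.
Qed.

Lemma reach_open x : locally_controllable F UU -> open [set y | reach x y].
Proof.
move=> lc; rewrite openE => y xy; have := lc y; rewrite /interior.
by apply: filterS => z yz; exact: reach_trans xy yz.
Qed.

Lemma reach_refl x : locally_controllable F UU -> reach x x.
Proof. by move=> lc; exact: (nbhs_singleton (lc x)). Qed.

End reachability.

(** * The system in a cube of coordinates, extended to the whole space *)

Section local_model.
Context {R : realType} {n m : nat} {M : topologicalType} {A : smooth_atlas R n M}.
Variables (U : set 'rV[R]_m) (F : forall x : M, 'rV[R]_m -> tangent_vector A x).
Hypothesis smoothF : smooth_control_field U F.
Variable UU : set (control R m).
Hypothesis hUU : UU = U_pc U \/ UU = U_infty U.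
Notation mu := (@lebesgue_measure R).
Implicit Types (i j : chart_index A) (x y z : M) (u : R -> 'rV[R]_m) (g : R -> M).

(** A retraction onto a closed ball of the sup norm, 1-Lipschitz for that norm: composing with it
    extends a field from the cube and keeps its Lipschitz constant. *)
Definition box_retract (c : 'rV[R]_n) (r : R) (w : 'rV[R]_n) : 'rV[R]_n :=
  \row_j clampR (c 0 j - r) (c 0 j + r) (w 0 j).

Lemma box_retract_lip c r w w' : `|box_retract c r w - box_retract c r w'| <= `|w - w'|.
Proof.
apply: rV_norm_le => // j; rewrite !mxE (le_trans (clampR_lip _ _ _ _))//.
by have := rV_norm_coord (w - w') j; rewrite !mxE.
Qed.

Lemma box_retract_in c r w : 0 <= r -> `|box_retract c r w - c| <= r.
Proof.
move=> r0; apply: rV_norm_le => // j; rewrite !mxE.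
have h : c 0 j - r <= c 0 j + r by lra.
have [] := clampR_itv (w 0 j) h; rewrite ler_norml; set d := clampR _ _ _ => *.
by apply/andP; split; lra.
Qed.

Lemma box_retract_id c r w : `|w - c| <= r -> box_retract c r w = w.
Proof.
move=> wc; apply/rowP => j; rewrite mxE.
have := le_trans (rV_norm_coord (w - c) j) wc; rewrite !mxE ler_norml => /andP[h1 h2].
by rewrite clampR_id//; lra.
Qed.

Lemma tcoord_continuous i x v0 : chart_dom i x -> U v0 -> forall e, 0 < e -> exists2 d : R, 0 < d &
  forall y v', chart_dom i y -> U v' -> `|chart i y - chart i x| < d -> `|v' - v0| < d ->
    `|tcoord (F y v') i - tcoord (F x v0) i| < e.
Proof.
move=> ix Uu e e0; have [W [G [oW Wx sG FG]]] := smoothF ix Uu.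
have cG := smooth_on_continuous sG Wx.
have nW : nbhs (chart i x, v0) W by exact: open_nbhs_nbhs.
have nE : nbhs (chart i x, v0) [set p | `|G (chart i x, v0) - G p| < e].
  by move/cvgrPdist_lt : cG => /(_ _ e0).
have /nbhs_ballP[d /= d0 Hd] : nbhs (chart i x, v0) (W `&` [set p | `|G (chart i x, v0) - G p| < e]).
  exact: filterI.
exists d => // y v' iy Uv' yd ud.
have [|Wy Gy] := Hd (chart i y, v').
  by split; rewrite -ball_normE/= distrC.
by rewrite (FG y v' iy Uv' Wy) (FG x v0 ix Uu Wx) distrC.
Qed.

(* F(., u t) in the chart i on the cube of radius r around c, extended to the
   whole space; G omits the times at which u is badly behaved. *)
Definition local_field i (c : 'rV[R]_n) (r : R) u (a b : R) (l : R -> R)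
    (f : R -> 'rV[R]_n -> 'rV[R]_n) (G : set R) :=
  [/\ caratheodory_field l f, forall t, `|f t c| <= l t, measurable G,
      {ae mu, forall t, a < t -> t < b -> G t} &
      forall t, G t -> [/\ a < t, t < b,
        forall w, `|w - c| <= r -> f t w = tcoord (F (chart_inv i w) (u t)) i &
        forall w, `|w - c| < r -> differentiable (f t) w]].

Definition chart_box i (c : 'rV[R]_n) (r : R) (Q : set M) :=
  forall w, `|w - c| <= r ->
    [/\ chart_dom i (chart_inv i w), Q (chart_inv i w) & chart i (chart_inv i w) = w].

(** Neither [r] nor [L] depends on [[a, b]], and the primitive of [L] is continuous; short intervals
    therefore give fields whose bound has as small an integral as desired. *)
Lemma local_field_exists T u x (Q : set M) : UU (T, u) -> caratheodory F T u -> nbhs x Q ->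
  exists i (r : R) (L : R -> R), [/\ chart_dom i x, 0 < r, integrableR L & forall t, 0 <= L t]
  /\ chart_box i (chart i x) r Q /\
    (forall a b, 0 <= a -> a <= b -> b <= T -> exists f l G,
      local_field i (chart i x) r u a b l f G /\ ((\int[mu]_t l t)%R <= prim L b - prim L a)).
Proof.
move=> hu cu nQ; have [i ci] := cu x; have ix : chart_dom i x := cara_at_dom ci.
case: ci => N [l0 [nN Ni il0 H0]].
have [r0 r00 Hr0] := chart_near ix (filterI nQ nN).
(* Halved, so that the closed cube lies in the open ball of radius [r0]. *)
pose r := r0 / 2; have r_gt0 : 0 < r by rewrite divr_gt0.
have rr0 w : `|w - chart i x| <= r -> `|w - chart i x| < r0.
  by move=> /le_lt_trans; apply; rewrite /r; lra.
pose c := chart i x; pose L t := `|(l0 \_ `[0, T]) t|.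
have iL : integrableR L by exact: (integrable_norm (integrable_itvP il0)).
exists i, r, L; split; first by split => // t; exact: normr_ge0.
split; first by move=> w /rr0/Hr0[? [? _] ?].
move=> a b a0 ab bT.
have [Z [mZ Z0 HZ]] := H0.
(* At the times of [G] the bounds hold pointwise; at all others [f] and [l] are set to zero. *)
pose G := `]a, b[%classic `\` Z.
have mG : measurable G by apply: measurableD.
have HG t : G t -> [/\ a < t, t < b, t \in `[0, T] & forall y z, N y -> N z ->
      `|tcoord (F y (u t)) i| <= l0 t /\
      `|tcoord (F y (u t)) i - tcoord (F z (u t)) i| <= l0 t * `|chart i y - chart i z|].
  move=> [/=]; rewrite in_itv/= => /andP[at_ tb] nZ.
  have tI : t \in `[0, T] by rewrite in_itv/= (le_trans a0 (ltW at_)) (le_trans (ltW tb) bT).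
  by split => //; apply: contrapT => nH; apply: nZ; apply: HZ => /= /(_ tI).
pose rho := box_retract c r.
have rhoP w : `|rho w - c| <= r by apply: box_retract_in; exact: ltW.
have NP w : `|w - c| <= r -> [/\ chart_dom i (chart_inv i w), N (chart_inv i w) & chart i (chart_inv i w) = w].
  by move=> /rr0/Hr0[? [? ?] ?].
pose tc t w := tcoord (F (chart_inv i w) (u t)) i.
pose f t w : 'rV[R]_n := \1_G t *: tc t (rho w).
pose l := L \_ G.
have lE t : G t -> l t = l0 t.
  move=> Gt; rewrite /l patchE mem_set// /L patchE mem_set; last by have [] := HG t Gt.
  have [_ _ _ H] := HG t Gt.
  rewrite ger0_norm//; apply: le_trans (normr_ge0 _) (H _ _ (nbhs_singleton nN) (nbhs_singleton nN)).1.
have lout t : ~ G t -> l t = 0 by move=> nG; rewrite /l patchE memNset.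
have l_ge0 t : 0 <= l t.
  by rewrite /l patchE; case: ifP => // _; exact: normr_ge0.
have il : integrableR l.
  rewrite /integrableR /l -restrict_EFin; apply/integrable_restrict => //=; rewrite setTI.
  exact: integrableR_sub.
exists f, l, G; split; last first.
  have -> : (\int[mu]_t l t)%R = (\int[mu]_(t in G) L t)%R.
    by rewrite [RHS]Rintegral_mkcond.
  rewrite primB// -lee_fin /Rintegral !fineK; last 2 first.
  - by apply: integrable_fin_num => //; exact: integrableR_sub.
  - by apply: integrable_fin_num => //; exact: integrableR_sub.
  apply: ge0_subset_integral => //.
  - by apply: measurable_funTS; case/integrableP : iL.
  - by move=> t _; rewrite lee_fin; exact: normr_ge0.
  - by move=> t /= [+ _]; rewrite /= !in_itv/= => /andP[-> /ltW ->].
split => //.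
- split => //.
  + move=> t w w'; have [Gt|nG] := pselect (G t); last first.
      by rewrite /f indicE memNset// !scale0r subrr normr0 mulr_ge0.
    rewrite /f indicE mem_set// !scale1r lE//.
    have [_ N1 E1] := NP _ (rhoP w); have [_ N2 E2] := NP _ (rhoP w').
    have [_ _ _ /(_ _ _ N1 N2) [_ +]] := HG t Gt.
    rewrite E1 E2 => /le_trans; apply; rewrite -lE// ler_wpM2l//.
    exact: box_retract_lip.
  + move=> xi mxi j.
    have -> : (fun t => f t (xi t) 0 j) = (fun t => tc t (rho (xi t)) 0 j) \_ G.
      apply/funext => t; rewrite patchE /f indicE; case: (t \in G).
        by rewrite scale1r.
      by rewrite scale0r mxE.
    apply/(measurable_restrictT _ mG).
    pose H w v := tcoord (F (chart_inv i w) v) i 0 j.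
    suff : measurable_fun G (fun t => H (rho (xi t)) (u t)) by [].
    (* The field is known to be continuous only relative to the cube and to [U], which is all that
       [comp_measurable] asks. *)
    apply: (@comp_measurable _ _ _ _ [set w | `|w - c| <= r] U) => //.
    * move=> w v wr Uv e e0; have [iw Nw Ew] := NP w wr.
      have [d d0 Hd] := tcoord_continuous iw Uv e0; exists d => // w' v' w'r Uv' ww vv.
      have [iw' Nw' Ew'] := NP w' w'r.
      have := Hd (chart_inv i w') v' iw' Uv'; rewrite Ew Ew' => /(_ ww vv).
      apply: le_lt_trans.
      have := rV_norm_coord (tcoord (F (chart_inv i w') v') i - tcoord (F (chart_inv i w) v) i) j.
      by rewrite !mxE.
    * move=> k; rewrite (_ : (fun t => _) = fun t => Num.max (c 0 k - r) (Num.min (xi t 0 k) (c 0 k + r))); last first.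
        by apply/funext => t; rewrite mxE.
      apply: measurable_funTS; apply: measurable_maxr; first exact: measurable_cst.
      by apply: measurable_minr; [exact: mxi|exact: measurable_cst].
    * move=> k; apply: measurable_funS (UU_measurable hUU k hu) => //.
      by move=> t /HG[_ _ + _].
    * move=> t Gt; split; first exact: rhoP.
      have [_ _ + _] := HG t Gt; rewrite in_itv/= => /andP[t0 tT].
      exact: (UU_val hUU hu).
- move=> t; have [Gt|nG] := pselect (G t); last first.
    by rewrite /f indicE memNset// scale0r normr0.
  rewrite /f indicE mem_set// scale1r lE//.
  have [_ Nr _] := NP _ (rhoP c).
  by have [_ _ _ /(_ _ _ Nr Nr) []] := HG t Gt.
- exists Z; split => // t /= nG; apply: contrapT => nZ; apply: nG => at_ tb.
  by split => //=; rewrite in_itv/= at_.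
- move=> t Gt; have [at_ tb tI Ht] := HG t Gt; split => //.
    by move=> w wr; rewrite /f indicE mem_set// scale1r /rho box_retract_id.
  move=> w wr; have [iw Nw Ew] := NP w (ltW wr).
  have Ut : U (u t).
    by move: tI; rewrite in_itv/= => /andP[t0 tT]; exact: (UU_val hUU hu).
  have [W [G0 [oW Wx sG FG]]] := smoothF iw Ut.
  rewrite Ew in Wx.
  have sh := smooth_on_slice (u t) sG.
  apply: near_eq_differentiable (smooth_on_differentiable sh Wx).
  have nW : nbhs w [set w | W (w, u t)].
    have : nbhs (w, u t) W by exact: open_nbhs_nbhs.
    exact: (continuous_pair_cst (u0 := u t) (w := w)).
  have nr : \forall w' \near w, `|w' - c| <= r.
    apply/nbhs_ballP; exists (r - `|w - c|); first by rewrite /= subr_gt0.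
    move=> w'; rewrite -ball_normE/= distrC => ww'.
    rewrite -(subrKA w) (le_trans (ler_normD _ _))//.
    by rewrite -lerBrDr ltW.
  apply: filterS2 nW nr => w' Ww' w'r.
  have [iw' _ Ew'] := NP w' w'r.
  by rewrite /f indicE mem_set// scale1r /rho box_retract_id// /tc (FG _ _ iw' Ut) Ew'.
Qed.

End local_model.

(** * Frechet normals and their transport *)

Section normals.
Context {R : realType} {n : nat} {M : topologicalType} {A : smooth_atlas R n M}.
Variable P : set M.
Implicit Types (i j : chart_index A) (p q x z : M) (nu : 'rV[R]_n).

(* Frechet normals are covectors in the chart i: diff_correspondence relates
   vectors through J, hence normals through J^T. *)
Definition normal i p nu := forall e : R, 0 < e -> exists2 d : R, 0 < d &
  forall x, chart_dom i x -> P x -> `|chart i x - chart i p| < d ->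
    dot nu (chart i x - chart i p) <= e * `|chart i x - chart i p|.

Definition has_normals i p k := exists V : 'M[R]_(k, n),
  row_free V /\ forall r, normal i p (row r V).

(* At least k independent normals. *)
Definition num_normals p k := exists2 i, chart_dom i p & has_normals i p k.

Lemma mx_entries_bound (J : 'M[R]_n) : exists2 C : R, 0 <= C & forall v : 'rV[R]_n, `|v *m J| <= C * `|v|.
Proof.
pose c := \sum_(i < n) \sum_(j < n) `|J i j|.
have c0 : 0 <= c by rewrite sumr_ge0// => i _; rewrite sumr_ge0.
exists (n%:R * c); first by rewrite mulr_ge0.
move=> v; apply: mulmx_norm_le => // i j.
rewrite /c (bigD1 i)//= (bigD1 j)//= -addrA lerDl addr_ge0// ?sumr_ge0// => k _.
by rewrite sumr_ge0.
Qed.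

(** [J] is a first-order expansion at [q] of a relation sending points of [P] near [q] to points of
    [P]. Asking only for some [x] covers both the backward flow and changes of charts. *)
Definition diff_correspondence i p j q (J : 'M[R]_n) := forall e : R, 0 < e -> exists2 d : R, 0 < d &
  forall z, chart_dom j z -> P z -> `|chart j z - chart j q| < d ->
    exists x, [/\ chart_dom i x, P x &
      `|(chart i x - chart i p) - (chart j z - chart j q) *m J| <= e * `|chart j z - chart j q|].

(** With [w] the displacement at [q] and [v] the one at [p], [dot nu (w *m J)] is [dot nu v] up to
    an error [o(|w|)], while [v] is [O(w)]. *)
Lemma normal_transport i p j q (J : 'M[R]_n) nu : diff_correspondence i p j q J ->
  normal i p nu -> normal j q (nu *m J^T).
Proof.
move=> HJ Hnu e e0; have [C C0 HC] := mx_entries_bound J.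
(* Half of [e] goes to each error: [C + 1] bounds [|v|] in terms of [|w|], and [K] bounds the
   pairing with [nu]. *)
have [e1 e1E] : exists e1, e1 = e / (2 * (C + 1)) by exists (e / (2 * (C + 1))).
have C1 : 0 < C + 1 by rewrite ltr_wpDl.
have e10 : 0 < e1 by rewrite e1E divr_gt0// mulr_gt0.
pose K := n%:R * `|nu| + 1.
have K0 : 0 < K by rewrite ltr_wpDl// mulr_ge0.
have [d1 d10 H1] := Hnu e1 e10.
pose e2 := Num.min 1 (e / (2 * K)).
have e20 : 0 < e2 by rewrite lt_min ltr01 divr_gt0// mulr_gt0.
have e2K : e2 * K <= e / 2.
  apply: (@le_trans _ _ (e / (2 * K) * K)); first by rewrite ler_wpM2r ?(ltW K0)// /e2 ge_min lexx orbT.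
  by rewrite le_eqVlt; apply/orP; left; apply/eqP; field; rewrite gt_eqF.
have [d2 d20 H2] := HJ e2 e20.
exists (Num.min d2 (d1 / (C + 1))); first by rewrite lt_min d20 divr_gt0.
move=> z jz Pz; rewrite lt_min => /andP[zd2 zd1].
have [x [ix Px Hx]] := H2 z jz Pz zd2.
set w := chart j z - chart j q in zd1 zd2 Hx *; set v := chart i x - chart i p in Hx.
have vw : `|v| <= (C + 1) * `|w|.
  rewrite -[v](subrK (w *m J)) (le_trans (ler_normD _ _))// mulrDl addrC lerD//.
  by rewrite (le_trans Hx)// ler_wpM2r// /e2 ge_min lexx.
have vd : `|v| < d1 by apply: le_lt_trans vw _; rewrite mulrC -ltr_pdivlMr.
have := H1 x ix Px vd; rewrite -/v => Hv.
rewrite -dot_mulmx.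
have -> : w *m J = v - (v - w *m J) by rewrite opprB addrC subrK.
rewrite dotBr.
have h1 : dot nu v <= e / 2 * `|w|.
  apply: le_trans Hv _; apply: (@le_trans _ _ (e1 * ((C + 1) * `|w|))).
    by rewrite ler_wpM2l// ltW.
  by rewrite e1E le_eqVlt; apply/orP; left; apply/eqP; field; rewrite gt_eqF.
have h2 : `|dot nu (v - w *m J)| <= e / 2 * `|w|.
  apply: le_trans (dot_norm_le _ _) _; rewrite mulrA.
  apply: (@le_trans _ _ (K * (e2 * `|w|))).
    by apply: ler_pM => //; rewrite ?mulr_ge0 ?lerDl.
  by rewrite mulrA [K * e2]mulrC ler_wpM2r.
have h3 : - dot nu (v - w *m J) <= e / 2 * `|w| by apply: le_trans h2; rewrite -normrN ler_norm.
rewrite [e]splitr mulrDl; exact: lerD.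
Qed.

Lemma has_normals_transport i p j q (J : 'M[R]_n) k : J \in unitmx ->
  diff_correspondence i p j q J -> has_normals i p k -> has_normals j q k.
Proof.
move=> uJ HJ [V [fV HV]]; exists (V *m J^T); split.
  by rewrite /row_free mxrankMfree// row_free_unit unitmx_tr.
by move=> r; rewrite row_mul; exact: normal_transport HJ (HV r).
Qed.

Definition transition_mx i j p : 'M[R]_n := lin1_mx ('d (transition i j) (chart i p)).

Lemma transition_mxE i j p v : v *m transition_mx i j p = 'd (transition i j) (chart i p) v.
Proof. exact: mul_rV_lin1. Qed.

Lemma transition_mx_unit i j p : chart_dom i p -> chart_dom j p ->
  transition_mx i j p \in unitmx.
Proof.
move=> ip jp; have E : transition_mx i j p *m transition_mx j i p = 1%:M.
  apply/row_matrixP => r; rewrite !rowE mulmx1 mulmxA.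
  transitivity ('d (transition j i) (chart j p) ('d (transition i j) (chart i p) (delta_mx 0 r))).
    by rewrite -!transition_mxE.
  exact: transition_diffK.
have [u1 _] := mulmx1_unit E; exact: u1.
Qed.

(** The correspondence here is the identity of [P], read in two charts; the count of normals thus
    does not depend on the chart. *)
Lemma transition_correspondence i j p : chart_dom i p -> chart_dom j p ->
  diff_correspondence i p j p (transition_mx j i p).
Proof.
move=> ip jp e e0.
have [d d0 Hd] := diff_eps (transition_differentiable jp ip) e0.
have ni : nbhs p (chart_dom i) by apply: open_nbhs_nbhs; split => //; exact: chart_dom_open.
have [r r0 Hr] := chart_near jp ni.
exists (Num.min d r); first by rewrite lt_min d0.
move=> z jz Pz; rewrite lt_min => /andP[zd zr].
have iz : chart_dom i z by have [_ + _] := Hr _ zr; rewrite chartK.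
exists z; split => //; have := Hd _ zd.
by rewrite !transitionE// -transition_mxE.
Qed.

Lemma has_normals_chart i j p k : chart_dom i p -> chart_dom j p ->
  has_normals i p k -> has_normals j p k.
Proof.
move=> ip jp; apply: has_normals_transport (transition_correspondence ip jp).
exact: transition_mx_unit.
Qed.

Lemma num_normals0 p : num_normals p 0.
Proof.
have [i ip] := chart_cover A p; exists i => //; exists 0; split; last by case.
by rewrite /row_free mxrank0.
Qed.

Lemma num_normals_le p k : num_normals p k -> (k <= n)%N.
Proof. by move=> [i _ [V [/eqP fV _]]]; have := rank_leq_col V; rewrite fV. Qed.

Lemma num_normals_max p : exists k, num_normals p k /\ forall k', num_normals p k' -> (k' <= k)%N.
Proof.
have ex : exists k, `[< num_normals p k >] by exists 0%N; apply/asboolP; exact: num_normals0.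
have bd k : `[< num_normals p k >] -> (k <= n)%N by move=> /asboolP; exact: num_normals_le.
case: (ex_maxnP ex bd) => k /asboolP Hk kmax; exists k; split => // k' Hk'.
by apply: kmax; apply/asboolP.
Qed.

End normals.

(** * Transport of normals along trajectories *)

Section transport.
Context {R : realType} {n m : nat} {M : topologicalType} {A : smooth_atlas R n M}.
Variables (U : set 'rV[R]_m) (F : forall x : M, 'rV[R]_m -> tangent_vector A x).
Hypothesis smoothF : smooth_control_field U F.
Variable UU : set (control R m).
Hypothesis hUU : UU = U_pc U \/ UU = U_infty U.
Notation mu := (@lebesgue_measure R).
Implicit Types (i j : chart_index A) (x y z : M) (u : R -> 'rV[R]_m) (g : R -> M).

Lemma sol_integral_curve i c r u a b l f G g : a <= b -> local_field F i c r u a b l f G ->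
  sol_on F a b u g -> (forall t, a <= t -> t <= b -> chart_dom i (g t) /\ `|chart i (g t) - c| <= r) ->
  integral_curve f a b (chart i \o g).
Proof.
move=> ab [cf _ mG aeG HG] [_ ac dg] gi; split.
  by apply: ac => // t at_ tb; have [] := gi t at_ tb.
apply: ae_mono (ae_and aeG dg) => t [Gt Ht] at_ tb.
have [it gr] := gi t (ltW at_) (ltW tb).
have [_ _ fE _] := HG t (Gt at_ tb).
rewrite /= fE// chartK//; exact: Ht.
Qed.

Lemma integral_curve_sol i c r u a b l f G xi : a <= b -> local_field F i c r u a b l f G ->
  chart_box i c r setT -> integral_curve f a b xi ->
  (forall t, a <= t -> t <= b -> `|xi t - c| <= r) ->
  sol_on F a b u (chart_inv i \o xi).
Proof.
move=> ab [cf _ mG aeG HG] box [ACxi dxi] xir; apply: sol_on_chart => //.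
  by move=> t at_ tb; have [] := box (xi t) (xir t at_ tb).
apply: ae_mono (ae_and aeG dxi) => t [Gt Ht] at_ tb.
have [_ _ fE _] := HG t (Gt at_ tb).
have := Ht at_ tb; rewrite fE//; apply: xir; exact: ltW.
Qed.

Lemma local_flow_differentiable i c r u a b l f G g : a <= b ->
  local_field F i c r u a b l f G -> n.+1%:R * (\int[mu]_t l t)%R <= 2^-1 ->
  integral_curve f a b (chart i \o g) ->
  (forall t, a <= t -> t <= b -> `|chart i (g t) - c| < r) ->
  exists2 J : 'M[R]_n, J \in unitmx &
  forall e, 0 < e -> exists2 d, 0 < d & forall xi, integral_curve f a b xi -> `|xi b - chart i (g b)| < d ->
    `|(xi a - chart i (g a)) - (xi b - chart i (g b)) *m J| <= e * `|xi b - chart i (g b)|.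
Proof.
move=> ab [cf _ mG aeG HG] l2 [ACg dg] gr.
apply: (flow_differentiable cf ab ACg l2 mG _ _ aeG dg).
  by move=> t /HG[].
move=> t Gt; have [at_ tb _ df] := HG t Gt.
by apply: df; apply: gr; exact: ltW.
Qed.

Variables (T : R) (u : R -> 'rV[R]_m).
Hypotheses (huT : UU (T, u)) (cuT : caratheodory F T u).
Variable P : set M.
(** Closed under backward motion; this is not topological closedness. *)
Hypothesis P_closed : forall x z, reach F UU x z -> P z -> P x.

Lemma local_flow_correspondence i x r a b l f G g : chart_dom i x -> 0 <= a -> a <= b -> b <= T ->
  chart_box i (chart i x) r setT ->
  local_field F i (chart i x) r u a b l f G -> n.+1%:R * (\int[mu]_t l t)%R <= 2^-1 ->
  sol_on F a b u g -> 0 < r ->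
  (forall t, a <= t -> t <= b -> chart_dom i (g t) /\ `|chart i (g t) - chart i x| < r / 2) ->
  exists J : 'M[R]_n, [/\ J \in unitmx, diff_correspondence P i (g a) i (g b) J &
  forall e, 0 < e -> exists2 d, 0 < d & forall xi, integral_curve f a b xi -> `|xi b - chart i (g b)| < d ->
    `|(xi a - chart i (g a)) - (xi b - chart i (g b)) *m J| <= e * `|xi b - chart i (g b)|].
Proof.
move=> ix a0 ab bT box lf l2 sg r0 gr.
have ic : integral_curve f a b (chart i \o g).
  apply: (sol_integral_curve ab lf sg) => t at_ tb; have [it gt] := gr t at_ tb.
  by split => //; apply: ltW (lt_le_trans gt _); lra.
have gr' t : a <= t -> t <= b -> `|chart i (g t) - chart i x| < r.
  by move=> at_ tb; have [_ gt] := gr t at_ tb; lra.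
have [J uJ HJ] := local_flow_differentiable ab lf l2 ic gr'.
exists J; split => // e e0; have [d d0 Hd] := HJ e e0.
(* The solution ends within [r / 4] of [g b], so it remains within [r / 2] of [g] by
   [integral_curve_dist], and [g] is within [r / 2] of the centre. *)
exists (Num.min d (r / 4)); first by rewrite lt_min d0 divr_gt0.
move=> z iz Pz; rewrite lt_min => /andP[zd zr].
have [cf fc mG aeG HG] := lf.
have intl0 : 0 <= (\int[mu]_t l t)%R by apply: Rintegral_ge0 => t _; case: cf.
have l2' : (\int[mu]_t l t)%R <= 2^-1 by apply: le_trans l2; rewrite ler_peMl// ler1n.
(* The extended field can be solved backwards from [z] over all of [[a, b]]; once the solution is
   known to stay in the cube, it is a trajectory of the system. *)
have [xi [xib ACxi dxi]] := caratheodory_exists b (chart i z) cf l2' fc.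
have icxi : integral_curve f a b xi.
  by split; [exact: ACxi|apply: ae_mono dxi].
have [ACg dg] := ic.
have lab := cf.
have xr t : a <= t -> t <= b -> `|xi t - chart i x| <= r.
  move=> at_ tb; have := integral_curve_dist cf ab ACg l2 dg icxi ab (lexx b) at_ tb.
  rewrite xib /= => h1; have [_ h2] := gr t at_ tb.
  rewrite -(subrKA (chart i (g t))) (le_trans (ler_normD _ _))//.
  have h3 : `|chart i z - chart i (g b)| < r / 4 := zr.
  lra.
have sxi := integral_curve_sol ab lf box icxi xr.
have := reach_intro hUU huT cuT a0 ab bT sxi.
rewrite /= xib chartK// => /P_closed/(_ Pz) Px.
have [ixa _ Exa] := box (xi a) (xr a (lexx a) ab).
exists (chart_inv i (xi a)); split => //; rewrite Exa.
by have := Hd xi icxi; rewrite xib => /(_ zd).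
Qed.

End transport.

Section normals_along_trajectories.
Context {R : realType} {n m : nat} {M : topologicalType} {A : smooth_atlas R n M}.
Variables (U : set 'rV[R]_m) (F : forall x : M, 'rV[R]_m -> tangent_vector A x).
Hypothesis smoothF : smooth_control_field U F.
Variable UU : set (control R m).
Hypothesis hUU : UU = U_pc U \/ UU = U_infty U.
Notation mu := (@lebesgue_measure R).
Implicit Types (i j : chart_index A) (x y z : M) (u : R -> 'rV[R]_m) (g : R -> M).

Lemma local_model_at T u g t (Q : set M) : UU (T, u) -> caratheodory F T u -> sol_on F 0 T u g ->
  0 <= t -> t <= T -> nbhs (g t) Q -> forall kappa : R, 0 < kappa ->
  exists i (r d : R), [/\ chart_dom i (g t), 0 < r, 0 < d & chart_box i (chart i (g t)) r Q] /\
   forall a b, 0 <= a -> a <= b -> b <= T -> t - d < a -> b < t + d ->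
    (forall s, a <= s -> s <= b -> chart_dom i (g s) /\ `|chart i (g s) - chart i (g t)| < r / 2) /\
    exists f l G, local_field F i (chart i (g t)) r u a b l f G /\ (\int[mu]_t l t)%R <= kappa.
Proof.
move=> hu cu sg t0 tT nQ kappa kappa0.
have [i [r [L [[ix r0 iL L0] [box HF]]]]] := local_field_exists smoothF hUU hu cu nQ.
have [co _ _] := sg.
have r20 : 0 < r / 2 by rewrite divr_gt0.
have [d1 d10 H1] := co t t0 tT _ (chart_nbhs ix r20).
have [d2 d20 H2] := ACon_cont (prim_ACon (t - 1) (t + 1) iL) kappa0.
(* [d1] keeps [g] within [r / 2] of the centre, [d2 / 2] makes the interval shorter than [d2], and 1
   confines it to [[t - 1, t + 1]], where the modulus of the primitive was taken. *)
pose d := Num.min d1 (Num.min (d2 / 2) 1).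
have d0 : 0 < d by rewrite lt_min d10 lt_min divr_gt0//=.
have dd1 : d <= d1 by rewrite ge_min lexx.
have dd2 : d <= d2 / 2 by rewrite ge_min ge_min lexx orbT.
have d_1 : d <= 1 by rewrite ge_min ge_min lexx !orbT.
exists i, r, d; split => // a b a0 ab bT ta bt; split.
  move=> s as_ sb; apply: H1; rewrite ?(le_trans a0)//; first exact: le_trans bT.
  by rewrite ltr_norml; apply/andP; split; lra.
have [f [l [G [lf il]]]] := HF a b a0 ab bT.
exists f, l, G; split => //; apply: le_trans il _; apply: ltW.
apply: le_lt_trans (ler_norm _) _; apply: H2 => //; lra.
Qed.

Variable P : set M.
Hypothesis P_closed : forall x z, reach F UU x z -> P z -> P x.

(** Short arcs transport independent normals by an invertible matrix, and the property composes
    along the trajectory. *)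
Lemma num_normals_reach x y k : reach F UU x y -> num_normals (A := A) P x k -> num_normals (A := A) P y k.
Proof.
move=> /reach_elim[T [u [g [hu cu sg <- <-]]]]; have T0 := UU_ge0 hUU hu.
move: k; apply: (@cousin _ (fun s t => forall k, num_normals (A := A) P (g s) k -> num_normals (A := A) P (g t) k) 0 T) => //.
  by move=> r s t _ _ _ _ H1 H2 k /H1/H2.
move=> t t0 tT.
have k0 : 0 < (2 * n.+1%:R)^-1 :> R by rewrite invr_gt0 mulr_gt0.
have [i [r [d [[it r0 d0 box] Hd]]]] := local_model_at hu cu sg t0 tT (@filterT _ _ _) k0.
exists d => // a b a0 ab bT ta bt k [j ja Hj].
have [gi [f [l [G [lf il]]]]] := Hd a b a0 ab bT ta bt.
have l2 : n.+1%:R * (\int[mu]_t l t)%R <= 2^-1.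
  by rewrite -ler_pdivlMl// -invfM mulrC.
have [J [uJ HJ _]] := local_flow_correspondence hUU hu cu P_closed it a0 ab bT box lf l2 (sol_on_sub a0 bT sg) r0 gi.
have [ia _] := gi a (lexx a) ab; have [ib _] := gi b ab (lexx b).
exists i => //; apply: (has_normals_transport uJ HJ).
exact: has_normals_chart ja ia Hj.
Qed.

End normals_along_trajectories.

(** * Velocities, and trajectories under constant controls *)

Section velocity.
Context {R : realType} {n : nat}.
Notation mu := (@lebesgue_measure R).

Lemma ACon_derive_bound_cst (V : normedModType R) (f f' : R -> V) (C a b : R) :
  a <= b -> 0 <= C -> ACon a b f ->
  {ae mu, forall t, a < t -> t < b -> is_derive t (1:R) f (f' t) /\ `|f' t| <= C} ->
  `|f b - f a| <= C * (b - a).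
Proof.
move=> ab C0 ACf H.
(* Constants are not integrable on the line, hence the truncation. *)
have iC : integrableR ((fun=> C) \_ `[a, b]).
  rewrite /integrableR -restrict_EFin; apply/integrable_restrict => //=; rewrite setTI.
  apply: continuous_compact_integrable; first exact: segment_compact.
  by apply: continuous_subspaceT => ?; exact: cvg_cst.
apply: le_trans (ACon_derive_bound (f' := f') ab ACf iC _) _.
  apply: ae_mono H => t Ht at_ tb; have [D B] := Ht at_ tb; split => //.
  have tI : `[a, b]%classic t by rewrite /= in_itv/= (ltW at_) (ltW tb).
  rewrite patchE (mem_set tI); exact: B.
rewrite primB// le_eqVlt; apply/orP; left; apply/eqP.
transitivity (\int[mu]_(x in `]a, b]) C)%R.
  apply: eq_Rintegral => t; rewrite inE/= in_itv/= => /andP[at_ tb].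
  have tI : `[a, b]%classic t by rewrite /= in_itv/= (ltW at_) tb.
  by rewrite patchE (mem_set tI).
rewrite Rintegral_cst//= lebesgue_measure_itv/= lte_fin; congr (_ * _).
by move: ab; rewrite le_eqVlt => /predU1P[->|ab]; [rewrite ltxx subrr|rewrite ab].
Qed.

(** The equation holds only almost everywhere; continuity of [v] at [s] turns it into
    differentiability at that very time, one-sided at an end. Subtracting [r *: v s] leaves a curve
    with small derivative near [s]. *)
Lemma ACon_velocity (xi v : R -> 'rV[R]_n) (a b s : R) : a <= s -> s <= b -> ACon a b xi ->
  {ae mu, forall t, a < t -> t < b -> is_derive t (1:R) xi (v t)} ->
  (forall e, 0 < e -> exists2 d, 0 < d & forall t, a <= t -> t <= b -> `|t - s| < d -> `|v t - v s| < e) ->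
  forall e, 0 < e -> exists2 d, 0 < d & forall t, a <= t -> t <= b -> `|t - s| < d ->
    `|xi t - xi s - (t - s) *: v s| <= e * `|t - s|.
Proof.
move=> as_ sb ACxi dxi cv e e0; have [d d0 Hd] := cv e e0; exists d => // t at_ tb td.
pose y r := xi r - r *: v s.
have ACy : ACon a b y.
  have ACid : ACon a b (fun r : R => r *: v s).
    apply: (ACon_lip (f := id) (K := `|v s|)).
      move=> e' e'0; exists e' => // k l r lr _; apply: le_lt_trans.
      by apply: ler_sum => i _; rewrite ger0_norm// subr_ge0; have [] := lr i.
    by move=> p q _ _ _; rewrite -scalerBl normrZ mulrC.
  apply: (ACon_dom (K := 1) ACxi ACid) => p q _ _ _; rewrite mul1r /y.
  have -> : xi q - q *: v s - (xi p - p *: v s) = (xi q - xi p) - (q *: v s - p *: v s).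
    by rewrite !opprD !opprK addrACA.
  exact: ler_normB.
have dy (r : R) : is_derive r (1:R) xi (v r) -> is_derive r (1:R) y (v r - v s).
  move=> D; apply: is_deriveB.
  have := is_derive_line 0 (v s) r.
  by rewrite (_ : (fun r => 0 + r *: v s) = (fun r => r *: v s))//; apply/funext => ?; rewrite add0r.
have B p q : a <= p -> p <= q -> q <= b -> (forall r, p <= r -> r <= q -> `|r - s| < d) ->
    `|y q - y p| <= e * (q - p).
  move=> ap pq qb H; apply: (@ACon_derive_bound_cst _ _ (fun r => v r - v s)) => //; first exact: ltW.
    exact: ACon_sub ACy.
  apply: ae_mono dxi => r Hr pr rq; split.
    by apply: dy; apply: Hr; [exact: le_lt_trans pr|exact: lt_le_trans qb].
  apply/ltW/Hd; [exact: le_trans (ltW pr)|exact: le_trans (ltW rq) qb|].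
  by apply: H; exact: ltW.
have E p q : y q - y p = xi q - xi p - (q - p) *: v s.
  by rewrite /y scalerBl !opprD !opprK addrACA.
have [st|/ltW ts] := leP s t.
  rewrite -E ger0_norm ?subr_ge0//; apply: B => // r sr rt.
  by move: td; rewrite !ger0_norm ?subr_ge0// ?(le_trans sr)//; lra.
rewrite -(normrN (_ - _)) -E opprB [`|t - s|]distrC ger0_norm ?subr_ge0//.
apply: B => // r tr rs.
by move: td; rewrite distrC [`|r - s|]distrC !ger0_norm ?subr_ge0//; lra.
Qed.

End velocity.

Section constant_controls.
Context {R : realType} {n m : nat} {M : topologicalType} {A : smooth_atlas R n M}.
Variables (U : set 'rV[R]_m) (F : forall x : M, 'rV[R]_m -> tangent_vector A x).
Hypothesis smoothF : smooth_control_field U F.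
Variable UU : set (control R m).
Hypothesis hUU : UU = U_pc U \/ UU = U_infty U.
Notation mu := (@lebesgue_measure R).
Implicit Types (i j : chart_index A) (p q x y z : M) (g : R -> M).

(** The maximum [mx] of the distance to [c] satisfies [mx <= (1 + mx) * kappa], and [kappa <= 1/2]
    absorbs half of [mx]. *)
Lemma integral_curve_stay (l : R -> R) (f : R -> 'rV[R]_n -> 'rV[R]_n) (a b kappa : R) (c : 'rV[R]_n) xi :
  a <= b -> caratheodory_field l f -> (forall t, `|f t c| <= l t) ->
  (\int[mu]_t l t)%R <= kappa -> kappa <= 2^-1 -> integral_curve f a b xi -> xi b = c ->
  forall t, a <= t -> t <= b -> `|xi t - c| <= 2 * kappa.
Proof.
move=> ab [il l0 flip _] fc lk k2 [ACxi dxi] xib.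
have ACn : ACon a b (fun t => `|xi t - c|).
  apply: (ACon_lip (K := 1) ACxi) => s t _ _ _; rewrite mul1r.
  by apply: le_trans (ler_dist_dist _ _) _; rewrite opprB addrA subrK.
have [s sab smax] := EVT_max ab (ACon_continuous ACn).
move: sab; rewrite in_itv/= => /andP[as_ sb].
set mx := `|xi s - c| in smax.
have mx0 : 0 <= mx by exact: normr_ge0.
have B : mx <= (1 + mx) * kappa.
  rewrite [X in X <= _](_ : mx = `|xi b - xi s|); last by rewrite /mx xib distrC.
  apply: le_trans (@ACon_derive_bound _ _ xi (fun t => f t (xi t)) (fun t => (1 + mx) * l t) s b sb _ _ _) _.
  - exact: ACon_sub ACxi.
  - exact: integrableRZ.
  - apply: ae_mono dxi => t Ht st tb; split; first by apply: Ht => //; exact: le_lt_trans st.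
    rewrite -[f t (xi t)](subrK (f t c)) addrC (le_trans (ler_normD _ _))// mulrDl mul1r lerD//.
    apply: le_trans (flip _ _ _) _; rewrite mulrC ler_wpM2r//.
    by apply: smax; rewrite in_itv/= (le_trans as_ (ltW st)) ltW.
  rewrite primZ//; rewrite ler_wpM2l ?addr_ge0//; apply: le_trans lk; exact: primBT.
have h : mx <= 2 * kappa.
  have : mx * kappa <= mx * 2^-1 by rewrite ler_wpM2l.
  by move: B; rewrite mulrDl mul1r; lra.
move=> t at_ tb; apply: le_trans (smax t _) h; by rewrite in_itv/= at_.
Qed.

Lemma const_trajectory p (v0 : 'rV[R]_m) : U v0 -> exists i (r b : R) (xi : R -> 'rV[R]_n),
  [/\ chart_dom i p, 0 < r, 0 < b, b <= 1 & chart_box i (chart i p) r setT] /\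
  [/\ xi b = chart i p, ACon 0 b xi, forall t, 0 <= t -> t <= b -> `|xi t - chart i p| < r / 2 &
      sol_on F 0 b (fun=> v0) (chart_inv i \o xi)] /\
  {ae mu, forall t, 0 < t -> t < b -> is_derive t (1:R) xi (tcoord (F (chart_inv i (xi t)) v0) i)} /\
  (forall a' b', 0 <= a' -> a' <= b' -> b' <= b -> exists f l G,
     local_field F i (chart i p) r (fun=> v0) a' b' l f G /\ n.+1%:R * (\int[mu]_t l t)%R <= 2^-1).
Proof.
move=> Uv.
have hu : UU (1, cst v0) by apply: (UU_cst hUU).
have cu : caratheodory F 1 (cst v0) by exact: cara_cst smoothF Uv ler01.
have [i [r [L [[ip r0 iL L0] [box HF]]]]] := local_field_exists smoothF hUU hu cu (filterT : nbhs p setT).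
(* The first bound meets the condition of [flow_differentiable]; the second keeps the curve within
   [2 * kappa <= r / 4] of the centre. *)
pose kappa := Num.min (2 * n.+1%:R)^-1 (r / 8).
have n2 : 0 < (2 * n.+1%:R)^-1 :> R by rewrite invr_gt0 mulr_gt0.
have k0 : 0 < kappa by rewrite lt_min n2 divr_gt0.
have kn : kappa <= (2 * n.+1%:R)^-1 by rewrite ge_min lexx.
have kr : kappa <= r / 8 by rewrite ge_min lexx orbT.
have k2 : kappa <= 2^-1.
  apply: le_trans kn _; rewrite lef_pV2 ?posrE ?mulr_gt0//.
  by rewrite ler_peMr// ler1n.
have nk (s : R) : s <= kappa -> n.+1%:R * s <= 2^-1.
  by move=> sk; rewrite -ler_pdivlMl// -invfM mulrC (le_trans sk).
have [d d0 Hd] := ACon_cont (prim_ACon 0 1 iL) k0.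
pose b := Num.min 1 (d / 2).
have b0 : 0 < b by rewrite lt_min ltr01 divr_gt0.
have b1 : b <= 1 by rewrite ge_min lexx.
have bd : b <= d / 2 by rewrite ge_min lexx orbT.
have HF' a' b' : 0 <= a' -> a' <= b' -> b' <= b -> exists f l G,
     local_field F i (chart i p) r (fun=> v0) a' b' l f G /\ (\int[mu]_t l t)%R <= kappa.
  move=> a'0 ab' b'b; have [f [l [G [lf il]]]] := HF a' b' a'0 ab' (le_trans b'b b1).
  exists f, l, G; split => //; apply: le_trans il _; apply: ltW.
  apply: le_lt_trans (ler_norm _) _; apply: Hd => //; [exact: le_trans b1|lra].
have [f [l [G [lf lk]]]] := HF' 0 b (lexx 0) (ltW b0) (lexx b).
have [cf fc _ _ HG] := lf.
have [xi [xib ACxi dxi]] := caratheodory_exists b (chart i p) cf (le_trans lk k2) fc.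
have icxi : integral_curve f 0 b xi by split; [exact: ACxi|apply: ae_mono dxi].
have stay t : 0 <= t -> t <= b -> `|xi t - chart i p| <= 2 * kappa.
  exact: (integral_curve_stay (ltW b0) cf fc lk k2 icxi xib).
have sxi : sol_on F 0 b (fun=> v0) (chart_inv i \o xi).
  apply: (integral_curve_sol (ltW b0) lf box icxi) => t t0 tb.
  by apply: le_trans (stay t t0 tb) _; lra.
exists i, r, b, xi; split; first by split.
split; first by split => // t t0 tb; apply: le_lt_trans (stay t t0 tb) _; lra.
split.
  have [_ _ _ aeG _] := lf.
  apply: ae_mono (ae_and aeG dxi) => t [Gt Ht] t0 tb; have [_ _ fE _] := HG t (Gt t0 tb).
  rewrite -fE//; apply: le_trans (stay t (ltW t0) (ltW tb)) _; lra.
move=> a' b' a'0 ab' b'b; have [f' [l' [G' [lf' lk']]]] := HF' a' b' a'0 ab' b'b.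
by exists f', l', G'; split => //; exact: nk.
Qed.

Lemma const_velocity_continuous i (r b : R) (c : 'rV[R]_n) xi (v0 : 'rV[R]_m) : U v0 ->
  chart_box i c r setT -> ACon 0 b xi -> (forall t, 0 <= t -> t <= b -> `|xi t - c| <= r) ->
  forall s, 0 <= s -> s <= b -> forall e, 0 < e -> exists2 d : R, 0 < d &
  forall t, 0 <= t -> t <= b -> `|t - s| < d ->
   `|tcoord (F (chart_inv i (xi t)) v0) i - tcoord (F (chart_inv i (xi s)) v0) i| < e.
Proof.
move=> Uv box ACxi xir s s0 sb e e0.
have [is_ _ Es] := box _ (xir s s0 sb).
have [d d0 Hd] := tcoord_continuous smoothF is_ Uv e0.
have [d' d'0 Hd'] := ACon_cont ACxi d0.
exists d' => // t t0 tb td; have [it _ Et] := box _ (xir t t0 tb).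
apply: Hd => //; last by rewrite subrr normr0.
rewrite Et Es; have [st|/ltW ts] := leP s t.
  by apply: Hd' => //; move: td; rewrite ger0_norm// subr_ge0.
by rewrite distrC; apply: Hd' => //; move: td; rewrite distrC ger0_norm// subr_ge0.
Qed.

End constant_controls.

(** * Normals are orthogonal to the admissible velocities *)

Section normal_algebra.
Context {R : realType} {n : nat} {M : topologicalType} {A : smooth_atlas R n M}.
Variable P : set M.
Implicit Types (i : chart_index A) (p : M).

(** Otherwise [V] and [nu] together would be [k + 1] independent normals. *)
Lemma normal_submx i p k (V : 'M[R]_(k, n)) (nu : 'rV[R]_n) :
  chart_dom i p -> row_free V -> (forall r, normal P i p (row r V)) -> normal P i p nu ->
  (forall k', num_normals (A := A) P p k' -> (k' <= k)%N) -> (nu <= V)%MS.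
Proof.
move=> ip fV nV nnu kmax.
have nfree : ~~ row_free (col_mx V nu).
  apply/negP => fC; have : num_normals (A := A) P p (k + 1)%N.
    exists i => //; exists (col_mx V nu); split => // r.
    case: (split_ordP r) => s ->; first by rewrite rowKu; exact: nV.
    by rewrite rowKd (_ : row s nu = nu)//; apply/rowP => j; rewrite mxE ord1.
  by move=> /kmax; rewrite addn1 ltnn.
have VC : (V <= col_mx V nu)%MS by rewrite -addsmxE addsmxSl.
have E : \rank V = \rank (col_mx V nu).
  apply/eqP; rewrite eqn_leq mxrankS//=.
  move: fV nfree; rewrite /row_free => /eqP ->.
  move=> ne; have := rank_leq_row (col_mx V nu); rewrite leq_eqVlt (negbTE ne)/=.
  by rewrite [in X in (_ < X)%N]addn1 ltnS.
have [_ /esym] := mxrank_leqif_sup VC; rewrite E eqxx => CV.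
by apply: submx_trans CV; rewrite -addsmxE addsmxSr.
Qed.

Lemma dot_sub_rows k (V : 'M[R]_(k, n)) (nu w : 'rV[R]_n) : (nu <= V)%MS ->
  (forall r, dot (row r V) w = 0) -> dot nu w = 0.
Proof.
move=> /submxP[D ->] H; rewrite dotC mulmx_sum_row.
have dot_sum (I : finType) (G : I -> 'rV[R]_n) : dot w (\sum_r G r) = \sum_r dot w (G r).
  apply: (big_morph (dot w)) => [x y|]; first exact: dotDr.
  by rewrite /dot big1// => j _; rewrite mxE mulr0.
by rewrite dot_sum big1// => r _; rewrite dotZr dotC H mulr0.
Qed.

End normal_algebra.

Section tangency.
Context {R : realType} {n m : nat} {M : topologicalType} {A : smooth_atlas R n M}.
Variables (U : set 'rV[R]_m) (F : forall x : M, 'rV[R]_m -> tangent_vector A x).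
Hypothesis smoothF : smooth_control_field U F.
Variable UU : set (control R m).
Hypothesis hUU : UU = U_pc U \/ UU = U_infty U.
Notation mu := (@lebesgue_measure R).
Implicit Types (i j : chart_index A) (p q x y z : M) (g : R -> M).

Lemma velocity_small_le (x v : 'rV[R]_n) (h e : R) : 0 < h -> `|x - h *: v| <= e * h ->
  `|x| <= (`|v| + e) * h.
Proof.
move=> h0 H; rewrite -[x](subrK (h *: v)) (le_trans (ler_normD _ _))//.
by rewrite mulrDl addrC lerD// normrZ gtr0_norm// mulrC.
Qed.

(** Restricting to [e <= 1] allows [K] to absorb terms that involve [e] itself. *)
Lemma small_le0 (a K : R) : 0 <= K -> (forall e, 0 < e -> e <= 1 -> a <= e * K) -> a <= 0.
Proof.
move=> K0 H; apply/ler_addgt0Pr => e e0; rewrite add0r.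
have K1 : 0 < K + 1 by rewrite ltr_wpDl.
pose e' := Num.min 1 (e / (K + 1)).
have e'0 : 0 < e' by rewrite lt_min ltr01 divr_gt0.
have e'1 : e' <= 1 by rewrite ge_min lexx.
have e'e : e' <= e / (K + 1) by rewrite ge_min lexx orbT.
apply: le_trans (H e' e'0 e'1) _; apply: (@le_trans _ _ (e / (K + 1) * K)); first by rewrite ler_wpM2r.
by rewrite mulrAC ler_pdivrMr// ler_wpM2l ?lerDl// ltW.
Qed.

(** Frechet normals are polar to the one-sided tangent directions of [P]. *)
Lemma normal_velocity_le (P : set M) i q (nu v : 'rV[R]_n) : chart_dom i q -> normal P i q nu ->
  (forall e, 0 < e -> exists2 d : R, 0 < d & forall h, 0 < h -> h < d -> exists x,
     [/\ chart_dom i x, P x & `|chart i x - chart i q - h *: v| <= e * h]) ->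
  dot nu v <= 0.
Proof.
move=> iq Hnu Hv; apply: (@small_le0 _ (`|v| + 1 + n%:R * `|nu|)).
  by rewrite !addr_ge0// mulr_ge0.
move=> e e0 e1; have [d1 d10 H1] := Hnu e e0; have [d2 d20 H2] := Hv e e0.
have v1 : 0 < `|v| + 1 by rewrite ltr_wpDl.
pose h := Num.min (d1 / (`|v| + 1) / 2) (d2 / 2).
have h0 : 0 < h by rewrite lt_min !divr_gt0.
have hd2 : h < d2 by apply: (@le_lt_trans _ _ (d2 / 2)); [rewrite ge_min lexx orbT|lra].
have hd1 : h < d1 / (`|v| + 1).
  apply: (@le_lt_trans _ _ (d1 / (`|v| + 1) / 2)); first by rewrite ge_min lexx.
  by rewrite ltr_pdivrMr// ltr_pMr ?divr_gt0// ltr1n.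
have [x [ix Px Hx]] := H2 h h0 hd2.
have xq : `|chart i x - chart i q| <= (`|v| + 1) * h.
  apply: le_trans (velocity_small_le h0 Hx) _.
  by rewrite ler_wpM2r ?(ltW h0)// lerD2l.
have xd1 : `|chart i x - chart i q| < d1.
  by apply: le_lt_trans xq _; rewrite mulrC -ltr_pdivlMr.
have H := H1 x ix Px xd1.
rewrite -(ler_pM2r h0).
have -> : dot nu v * h = dot nu (chart i x - chart i q) - dot nu (chart i x - chart i q - h *: v).
  by rewrite [X in _ - X]dotBr dotZr opprB addrC subrK mulrC.
rewrite mulrDr mulrDl lerD//.
  by apply: le_trans H _; rewrite -mulrA ler_wpM2l// ltW.
apply: le_trans (ler_norm _) _; rewrite normrN; apply: le_trans (dot_norm_le _ _) _.
rewrite mulrA -[e * _ * h]mulrA mulrCA; rewrite ler_wpM2l ?mulr_ge0//.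
Qed.

Variable P : set M.
Hypothesis P_closed : forall x z, reach F UU x z -> P z -> P x.

(** The chart is imposed by the trajectory of [const_trajectory]; [normal_tangent] then treats every
    chart. *)
Lemma normal_tangent_chart p (v0 : 'rV[R]_m) : nbhs p [set z | reach F UU p z] -> P p -> U v0 ->
  exists2 i, chart_dom i p & forall nu, normal P i p nu -> dot nu (tcoord (F p v0) i) = 0.
Proof.
move=> np Pp Uv.
have [i [r [b [xi [[ip r0 b0 b1 box] [[xib ACxi xir sxi] [dxi HF]]]]]]] := const_trajectory smoothF hUU p Uv.
have xir' t : 0 <= t -> t <= b -> `|xi t - chart i p| <= r by move=> t0 tb; have := xir t t0 tb; lra.
pose g := chart_inv i \o xi.
have gb : g b = p by rewrite /g /= xib chartK.
have gi t : 0 <= t -> t <= b -> chart_dom i (g t) /\ chart i (g t) = xi t.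
  by move=> t0 tb; have [? _ ?] := box _ (xir' t t0 tb).
have Pg t : 0 <= t -> t <= b -> P (g t).
  move=> t0 tb; apply: (P_closed _ Pp); rewrite -gb.
  exact: (reach_cst smoothF hUU Uv tb (sol_on_sub t0 (lexx b) sxi)).
have [cog _ _] := sxi.
have [d0 d00 Hd0] : exists2 d : R, 0 < d & forall s, 0 <= s -> s <= b -> `|s - b| < d -> reach F UU p (g s).
  by apply: (cog b (ltW b0) (lexx b)); rewrite -/(g b) gb.
(* Close enough to [b] for [p] to reach [g a], yet positive, so that the trajectory also exists
   before [a]. *)
pose a := b - Num.min d0 b / 2.
have mn0 : 0 < Num.min d0 b by rewrite lt_min d00.
have mnd : Num.min d0 b <= d0 by rewrite ge_min lexx.
have mnb : Num.min d0 b <= b by rewrite ge_min lexx orbT.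
have a0 : 0 < a by rewrite /a; lra.
have ab : a < b by rewrite /a; lra.
have pq : reach F UU p (g a).
  by apply: Hd0; rewrite ?ltW// ltr_norml; apply/andP; split; rewrite /a; lra.
have [iq Eq] := gi a (ltW a0) (ltW ab).
pose v t := tcoord (F (g t) v0) i.
have vc s : 0 <= s -> s <= b -> forall e, 0 < e -> exists2 d : R, 0 < d &
    forall t, 0 <= t -> t <= b -> `|t - s| < d -> `|v t - v s| < e.
  exact: (const_velocity_continuous smoothF Uv box ACxi xir').
have vel s : 0 <= s -> s <= b -> forall e, 0 < e -> exists2 d : R, 0 < d &
    forall t, 0 <= t -> t <= b -> `|t - s| < d -> `|xi t - xi s - (t - s) *: v s| <= e * `|t - s|.
  by move=> s0 sb; apply: (ACon_velocity s0 sb ACxi dxi); exact: vc.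
(* The trajectory through g a stays in P on both sides of a. *)
have orth nu : normal P i (g a) nu -> dot nu (v a) = 0.
  move=> Hnu; apply/eqP; rewrite eq_le; apply/andP; split.
    apply: (normal_velocity_le iq Hnu) => e e0.
    have [d dp Hd] := vel a (ltW a0) (ltW ab) e e0.
    exists (Num.min d (b - a)); first by rewrite lt_min dp subr_gt0.
    move=> h h0; rewrite lt_min => /andP[hd hb].
    have ah0 : 0 <= a + h by rewrite addr_ge0// ltW.
    have ahb : a + h <= b by lra.
    have [iah Eah] := gi _ ah0 ahb.
    exists (g (a + h)); split => //; first exact: Pg.
    have := Hd (a + h) ah0 ahb; rewrite addrAC subrr add0r gtr0_norm// => /(_ hd).
    by rewrite Eah Eq.
  rewrite -oppr_le0 -dotNr.
  apply: (normal_velocity_le iq Hnu) => e e0.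
  have [d dp Hd] := vel a (ltW a0) (ltW ab) e e0.
  exists (Num.min d a); first by rewrite lt_min dp.
  move=> h h0; rewrite lt_min => /andP[hd hb].
  have ah0 : 0 <= a - h by rewrite subr_ge0 ltW.
  have ahb : a - h <= b by lra.
  have [iah Eah] := gi _ ah0 ahb.
  exists (g (a - h)); split => //; first exact: Pg.
  have := Hd (a - h) ah0 ahb; rewrite addrAC subrr add0r normrN gtr0_norm// => /(_ hd).
  by rewrite Eah Eq scalerN scaleNr.
have [f [l [G [lf l2]]]] := HF a b (ltW a0) (ltW ab) (lexx b).
have hu : UU (1, cst v0) by apply: (UU_cst hUU).
have cu : caratheodory F 1 (cst v0) by exact: cara_cst smoothF Uv ler01.
have [J [uJ HJ HJI]] : exists J : 'M[R]_n, [/\ J \in unitmx, diff_correspondence P i (g a) i (g b) J &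
  forall e, 0 < e -> exists2 d, 0 < d & forall xi, integral_curve f a b xi -> `|xi b - chart i (g b)| < d ->
    `|(xi a - chart i (g a)) - (xi b - chart i (g b)) *m J| <= e * `|xi b - chart i (g b)|].
  apply: (local_flow_correspondence hUU hu cu P_closed ip (ltW a0) (ltW ab) b1 box lf l2 (sol_on_sub (ltW a0) (lexx b) sxi) r0).
  move=> t at_ tb; have t0 : 0 <= t by rewrite (le_trans (ltW a0)).
  by have [it Et] := gi t t0 tb; rewrite -/(g t) Et; split => //; exact: xir.
have bb0 : 0 <= b by exact: ltW.
have Eb : chart i (g b) = xi b by have [] := gi b bb0 (lexx b).
(* xi (. - h) is again an integral curve; compare its ends to first order in h. *)
have Jv : v b *m J = v a.
  have [C C0 HC] := mx_entries_bound J.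
  apply/eqP; rewrite -subr_eq0 -normr_le0.
  apply: (@small_le0 _ (1 + C + (`|v b| + 1))); first by rewrite !addr_ge0.
  move=> e e0 e1.
  have [d1 d1p H1] := vel a (ltW a0) (ltW ab) e e0.
  have [d2 d2p H2] := vel b bb0 (lexx b) e e0.
  have [d3 d3p H3] := HJI e e0.
  have vb1 : 0 < `|v b| + 1 by rewrite ltr_wpDl.
  (* Below [d1] and [d2] the expansions at [a] and [b] hold; the speed bound [|v b| + 1] brings
     [xi (b - h)] within [d3] of [xi b]; and [h < a] keeps the translated curve in the time domain
     of [xi]. *)
  pose h := Num.min (Num.min d1 d2) (Num.min (d3 / (`|v b| + 1)) a) / 2.
  have hmn : 0 < Num.min (Num.min d1 d2) (Num.min (d3 / (`|v b| + 1)) a).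
    by rewrite !lt_min d1p d2p a0 divr_gt0.
  have h0 : 0 < h by rewrite divr_gt0.
  have h2 : h < Num.min (Num.min d1 d2) (Num.min (d3 / (`|v b| + 1)) a) by rewrite /h; lra.
  move: h2; rewrite !lt_min => /andP[/andP[hd1 hd2] /andP[hd3 ha]].
  have e2 : `|xi (b - h) - xi b + h *: v b| <= e * h.
    have := H2 (b - h); rewrite [b - h - b]addrAC subrr add0r normrN gtr0_norm// scaleNr opprK.
    by apply => //; lra.
  have e1' : `|xi (a - h) - xi a + h *: v a| <= e * h.
    have := H1 (a - h); rewrite [a - h - a]addrAC subrr add0r normrN gtr0_norm// scaleNr opprK.
    by apply => //; lra.
  have bnd : `|xi (b - h) - xi b| <= (`|v b| + 1) * h.
    have := @velocity_small_le (xi (b - h) - xi b) (- v b) h e h0.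
    rewrite scalerN opprK normrN => /(_ e2) /le_trans; apply.
    by rewrite ler_wpM2r ?(ltW h0)// lerD2l.
  have ic : integral_curve f a b (fun t => xi (t - h)).
    split; first by apply: ACon_shift; apply: ACon_sub ACxi; lra.
    have [_ _ _ aeG HG] := lf.
    apply: ae_mono (ae_and aeG (ae_shift (- h) dxi)) => t [Gt Ht] at_ tb.
    have [_ _ fE _] := HG t (Gt at_ tb).
    have th0 : 0 < t - h by lra.
    have thb : t - h < b by lra.
    rewrite fE; last by apply: xir'; exact: ltW.
    have D := Ht th0 thb.
    have Ds : is_derive t (1:R) (fun s : R => s - h) (1:R).
      have := is_derive_line (- h) 1 t; rewrite (_ : (fun s : R => - h + s *: 1) = fun s => s - h)//.
      by apply/funext => s; rewrite addrC /GRing.scale/= mulr1.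
    have dch : differentiable xi (t - h) by apply/derivable1_diffP; case: D.
    have := is_derive_diff_comp Ds dch; rewrite -deriveE//.
    by case: D => _ ->.
  have bnd3 : `|xi (b - h) - xi b| < d3.
    by apply: le_lt_trans bnd _; rewrite mulrC -ltr_pdivlMr.
  have H : `|xi (a - h) - xi a - (xi (b - h) - xi b) *m J| <= e * ((`|v b| + 1) * h).
    have := H3 _ ic; rewrite Eb Eq => /(_ bnd3)/le_trans; apply.
    by rewrite ler_wpM2l// ltW.
  rewrite -(ler_pM2r h0) -[X in _ * X <= _](gtr0_norm h0) -[X in X <= _]mulrC -normrZ.
  set dA := xi (a - h) - xi a in H e1' *; set dB := xi (b - h) - xi b in H e2 *.
  (* Three errors of order [e * h]: that of the flow differential, the expansion at [b] carried by
     [J], and the expansion at [a]. *)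
  have -> : h *: (v b *m J - v a) = (dA - dB *m J) + (dB + h *: v b) *m J - (dA + h *: v a).
    rewrite (mulmxDl dB (h *: v b) J) -(scalemxAl h (v b) J) scalerBr addrA subrK opprD addrA.
    by rewrite [dA + h *: _]addrC addrK.
  apply: (le_trans (ler_normB _ _)); apply: (@le_trans _ _ (e * ((`|v b| + 1) * h) + C * (e * h) + e * h)).
    rewrite lerD//; apply: (le_trans (ler_normD _ _)); rewrite lerD//.
    by apply: (le_trans (HC _)); rewrite ler_wpM2l.
  by rewrite le_eqVlt; apply/orP; left; apply/eqP; ring.
have [k [nk kmax]] := num_normals_max (A := A) P (g a).
have [j ja Hj] := nk.
have [V [fV nV]] := has_normals_chart ja iq Hj.
rewrite gb in HJ.
exists i => // nu nnu.
have vb : v b = tcoord (F p v0) i by rewrite /v gb.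
rewrite -vb; apply: (@dot_sub_rows _ _ _ (V *m J^T)).
  apply: (normal_submx ip _ _ nnu).
  - by move: fV; rewrite /row_free mxrankMfree// row_free_unit unitmx_tr.
  - by move=> r'; rewrite row_mul; exact: normal_transport HJ (nV r').
  (* Since [p] reaches [g a], the point [p] has at most as many independent normals as [g a], so the
     transported family is maximal. *)
  - by move=> k' Hk'; apply: kmax; exact: (num_normals_reach smoothF hUU P_closed pq Hk').
by move=> r'; rewrite row_mul -dot_mulmx Jv; exact: orth.
Qed.

(** Normals transform by the transpose of the matrix that transforms vectors, so the pairing does
    not depend on the chart. *)
Lemma normal_tangent p (v0 : 'rV[R]_m) j nu : nbhs p [set z | reach F UU p z] -> P p -> U v0 ->
  chart_dom j p -> normal P j p nu -> dot nu (tcoord (F p v0) j) = 0.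
Proof.
move=> np Pp Uv jp nnu; have [i ip H] := normal_tangent_chart np Pp Uv.
have := H _ (normal_transport (transition_correspondence P jp ip) nnu).
by rewrite -dot_mulmx transition_mxE /transition -(tcoord_change _ ip jp).
Qed.

End tangency.

(** * Invariance of a compact set through the squared distance *)

Section nearest_point.
Context {R : realType} {n : nat}.
Notation mu := (@lebesgue_measure R).
Implicit Types (v w x y : 'rV[R]_n) (K : set 'rV[R]_n).

Lemma dot_ge0 v : 0 <= dot v v.
Proof. by rewrite sumr_ge0// => j _; rewrite -expr2 sqr_ge0. Qed.

Lemma dot_norm_ge v : `|v| ^+ 2 <= dot v v.
Proof.
have s0 := dot_ge0 v.
rewrite -(sqr_sqrtr s0) ler_sqr ?nnegrE ?sqrtr_ge0//.
apply: rV_norm_le => [|j]; first exact: sqrtr_ge0.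
rewrite -sqrtr_sqr ler_wsqrtr// /dot (bigD1 j)//= expr2 lerDl sumr_ge0// => k _.
by rewrite -expr2 sqr_ge0.
Qed.

Lemma dot_continuous x : continuous (fun w => dot (x - w) (x - w)).
Proof.
apply: (@continuous_big _ _ +%R 0 xpredT (@add_continuous _) _ _ (fun j w => (x - w) 0 j * (x - w) 0 j)) => j _.
have H : continuous (fun w : 'rV[R]_n => (x - w) 0 j).
  move=> z; have -> : (fun w : 'rV[R]_n => (x - w) 0 j) = (fun w => x 0 j - w 0 j).
    by apply/funext => y; rewrite !mxE.
  apply: (@cvgB _ _ _ (nbhs z) _ (fun=> x 0 j) (fun w : 'rV[R]_n => w 0 j)); last exact: coord_continuous.
  exact: cst_continuous.
by move=> w; apply: (@cvgM _ _ (nbhs w) _ (fun w => (x - w) 0 j) (fun w => (x - w) 0 j)); exact: H.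
Qed.

(** An arbitrary selection of Euclidean nearest points, in general neither unique nor continuous. *)
Lemma nearest_point K : compact K -> K !=set0 -> exists pr : 'rV[R]_n -> 'rV[R]_n,
  forall x, K (pr x) /\ forall w, K w -> dot (x - pr x) (x - pr x) <= dot (x - w) (x - w).
Proof.
move=> cK K0.
have H x : exists w0, K w0 /\ forall w, K w -> dot (x - w0) (x - w0) <= dot (x - w) (x - w).
  have [w0 w0K H] := EVT_min_rV K0 cK (continuous_subspaceT (@dot_continuous x)).
  by exists w0; split=> [|w Kw]; [rewrite inE in w0K|apply: H; rewrite inE].
by have [pr Hpr] := choice H; exists pr.
Qed.

(** Freeze [w], the nearest point to [xi t]. The squared distance to [K] is at most the squared
    distance to [w], with equality at time [t], so its right increments are bounded by those of a
    differentiable function. By orthogonality the derivative of the latter is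
    [2 * dot (xi t - w) (f t (xi t) - f t w)], at most [2 * n * l t] times the squared distance, and
    [gronwall0] concludes. *)
Lemma invariant_compact (f : R -> 'rV[R]_n -> 'rV[R]_n) (l : R -> R) a b xi K pr c (r : R) :
  a <= b -> caratheodory_field l f -> 2 * n%:R * (\int[mu]_t l t)%R <= 2^-1 -> integral_curve f a b xi ->
  (forall x, K (pr x) /\ forall w, K w -> dot (x - pr x) (x - pr x) <= dot (x - w) (x - w)) ->
  (forall w, K w -> `|w - c| <= r) -> (forall t, a <= t -> t <= b -> `|xi t - c| <= r) ->
  {ae mu, forall t, a < t -> t < b -> dot (xi t - pr (xi t)) (f t (pr (xi t))) = 0} ->
  K (xi a) -> K (xi b).
Proof.
move=> ab [il l0 flip _] l2 [ACxi dxi] prK Kr xir orth Ka.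
pose D x := dot (x - pr x) (x - pr x).
have D0 x : 0 <= D x by exact: dot_ge0.
have DB x y : D x - D y <= dot (x - pr y) (x - pr y) - dot (y - pr y) (y - pr y).
  by rewrite lerD2r; have [_] := prK x; apply; have [] := prK y.
have r0 : 0 <= r by apply: le_trans (xir a (lexx a) ab).
have tri x w : `|x - c| <= r -> K w -> `|x - w| <= 2 * r.
  move=> xr Kw; rewrite -[x - w](subrKA c) (le_trans (ler_normD _ _))// mulr2n mulrDl !mul1r lerD//.
  by rewrite distrC; exact: Kr.
(* A difference of squares factors as the pairing of [x - y] with a sum of two vectors of norm at
   most [2 * r]. *)
have Dlip x y : `|x - c| <= r -> `|y - c| <= r -> D x - D y <= n%:R * (4 * r) * `|x - y|.
  move=> xr yr; apply: le_trans (DB x y) _; have [Kp _] := prK y.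
  have -> : dot (x - pr y) (x - pr y) - dot (y - pr y) (y - pr y) = dot (x - y) ((x - pr y) + (y - pr y)).
    have -> : x - y = (x - pr y) - (y - pr y) by rewrite opprB addrA subrK.
    move: (x - pr y) (y - pr y) => p1 p2.
    by rewrite dotBl !dotDr [dot p2 p1]dotC opprD addrA addrK.
  apply: le_trans (ler_norm _) _; apply: le_trans (dot_norm_le _ _) _.
  rewrite -mulrA ler_wpM2l// mulrC ler_wpM2r//.
  apply: le_trans (ler_normD _ _) _; have := tri _ _ xr Kp; have := tri _ _ yr Kp; lra.
have ACD : ACon a b (D \o xi).
  apply: (ACon_lip (K := n%:R * (4 * r)) ACxi) => s t as_ st tb /=.
  have sr := xir s as_ (le_trans st tb); have tr := xir t (le_trans as_ st) tb.
  rewrite ler_norml lerNl opprB; apply/andP; split; last exact: Dlip.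
  by rewrite distrC; exact: Dlip.
have Da : D (xi a) = 0.
  apply/eqP; rewrite eq_le D0 andbT; have [_ /(_ _ Ka)] := prK (xi a).
  by rewrite subrr => /le_trans; apply; rewrite /dot big1// => j _; rewrite mxE mulr0.
have n20 : 0 <= 2 * n%:R :> R by rewrite mulr_ge0.
have Db : D (xi b) = 0.
  apply: (@gronwall0 _ (D \o xi) (fun t => 2 * n%:R * l t) a b ab ACD) => //.
  - exact: integrableRZ.
  - by move=> t; rewrite mulr_ge0.
  - by rewrite primZ//; apply: le_trans l2; rewrite ler_wpM2l//; exact: primBT.
  - by move=> t; exact: D0.
  apply: ae_mono (ae_and dxi orth) => t [Ht Ot] at_ tb e ep.
  have dt := Ht at_ tb; have ot := Ot at_ tb; set w := pr (xi t) in ot.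
  have dw : is_derive t (1:R) (fun s => xi s - w) (f t (xi t)).
    have := is_deriveB dt (is_derive_cst w t (1:R)); rewrite subr0.
    exact.
  have [h h0 Hh] := is_derive_increment (is_derive_dot dw dw) ep.
  exists h => // s ts sh sb.
  have := Hh s; rewrite ger0_norm ?subr_ge0// ltrBlDl => /(_ sh) H.
  apply: le_trans (DB (xi s) (xi t)) _; rewrite -/w.
  set d := dot (xi t - w) (f t (xi t)) + _ in H.
  have dle : d <= 2 * n%:R * l t * D (xi t).
    have -> : d = 2 * dot (xi t - w) (f t (xi t) - f t w).
      rewrite /d [dot (f _ _) _]dotC [in RHS]dotBr ot subr0; ring.
    rewrite -mulrA -mulrA ler_wpM2l//.
    apply: le_trans (ler_norm _) _; apply: le_trans (dot_norm_le _ _) _.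
    rewrite ler_wpM2l//; apply: (@le_trans _ _ (`|xi t - w| * (l t * `|xi t - w|))).
      by rewrite ler_wpM2l.
    by rewrite mulrCA -expr2 ler_wpM2l//; exact: dot_norm_ge.
  have H2 := le_trans (ler_norm _) H.
  have st0 : 0 <= s - t by rewrite subr_ge0.
  rewrite /= mulrDl; have := ler_wpM2r st0 dle.
  move: H2; rewrite /GRing.scale/= [_ * d]mulrC; lra.
have [Kp _] := prK (xi b); rewrite (_ : xi b = pr (xi b))//; apply/eqP.
rewrite -subr_eq0 -normr_eq0 -sqrf_eq0 eq_le sqr_ge0 andbT -Db; exact: dot_norm_ge.
Qed.

End nearest_point.

(** * Trajectories that start in [P] remain in [P] *)

Section viability.
Context {R : realType} {n m : nat} {M : topologicalType} {A : smooth_atlas R n M}.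
Variables (U : set 'rV[R]_m) (F : forall x : M, 'rV[R]_m -> tangent_vector A x).
Hypothesis smoothF : smooth_control_field U F.
Variable UU : set (control R m).
Hypothesis hUU : UU = U_pc U \/ UU = U_infty U.
Notation mu := (@lebesgue_measure R).
Implicit Types (i j : chart_index A) (p q x y z : M) (g : R -> M).

(** Minimality gives [2 * dot nu v <= dot v v], which is [o(|v|)]. As [w] is interior to the cube,
    all points of [P] near it are competitors. *)
Lemma proximal_normal (P : set M) i (c x w : 'rV[R]_n) (r : R) : chart_box i c r setT -> `|w - c| < r ->
  (forall w', `|w' - c| <= r -> P (chart_inv i w') -> dot (x - w) (x - w) <= dot (x - w') (x - w')) ->
  normal P i (chart_inv i w) (x - w).
Proof.
move=> box wr Hw e e0.
have [_ _ Ew] := box w (ltW wr).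
exists (Num.min (r - `|w - c|) (e / n.+1%:R)); first by rewrite lt_min subr_gt0 wr divr_gt0.
move=> z iz Pz; rewrite Ew lt_min => /andP[z1 z2].
set v := chart i z - w in z1 z2 *.
have zr : `|chart i z - c| <= r.
  rewrite -[chart i z - c](subrKA w) (le_trans (ler_normD _ _))//.
  by rewrite -/v -lerBrDr ltW.
have := Hw (chart i z) zr; rewrite chartK// => /(_ Pz).
have -> : x - chart i z = (x - w) - v by rewrite /v opprB addrA subrK.
clearbody v; move: (x - w) => nu; rewrite dotBl !dotBr (dotC v nu) => H.
have h : 2 * dot nu v <= dot v v by lra.
have h2 : dot v v <= e * `|v|.
  apply: le_trans (ler_norm _) _; apply: le_trans (dot_norm_le _ _) _.
  rewrite mulrA ler_wpM2r//; apply: (@le_trans _ _ (n.+1%:R * `|v|)).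
    by rewrite ler_wpM2r// ler_nat.
  by rewrite mulrC -ler_pdivlMr// ltW.
have ev : 0 <= e * `|v| by rewrite mulr_ge0// ltW.
lra.
Qed.

Variables P O : set M.
Hypothesis closedP : closed P.
Hypothesis openO : open O.
Hypothesis tangentP : forall p v0 i nu, O p -> P p -> U v0 -> chart_dom i p ->
  normal P i p nu -> dot nu (tcoord (F p v0) i) = 0.

Lemma viable T u g : UU (T, u) -> caratheodory F T u -> sol_on F 0 T u g ->
  (forall t, 0 <= t -> t <= T -> O (g t)) -> P (g 0) -> P (g T).
Proof.
move=> hu cu sg gO; have T0 := UU_ge0 hUU hu.
apply: (@cousin _ (fun s t => P (g s) -> P (g t)) 0 T) => //; first by move=> r s t _ _ _ _ H1 H2 /H1/H2.
move=> t t0 tT.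
have nO : nbhs (g t) O by apply: open_nbhs_nbhs; split => //; exact: gO.
(* This makes [2 * n] times the integral of [l] at most 1/2, as [invariant_compact] asks. *)
have k0 : 0 < (4 * n.+1%:R)^-1 :> R by rewrite invr_gt0 mulr_gt0.
have [i [r [d [[it r0 d0 box] Hd]]]] := local_model_at smoothF hUU hu cu sg t0 tT nO k0.
have [cog _ _] := sg.
(* [K] sees [P] only inside the cube, so nearest points must be interior. They lie within
   [rho + n.+1 * (2 * rho)] of the centre, which is less than [n.+2 * (2 * rho) = r]. *)
pose rho := r / (2 * n.+2%:R).
have rho0 : 0 < rho by rewrite divr_gt0// mulr_gt0.
have [d1 d10 Hd1] := cog t t0 tT _ (chart_nbhs it rho0).
exists (Num.min d d1); first by rewrite lt_min d0.
move=> a b a0 ab bT ta bt Pa.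
have dd : Num.min d d1 <= d by rewrite ge_min lexx.
have dd1 : Num.min d d1 <= d1 by rewrite ge_min lexx orbT.
have ta' : t - d < a by lra.
have bt' : b < t + d by lra.
have [gi [f [l [G [lf il]]]]] := Hd a b a0 ab bT ta' bt'.
have [cf _ _ aeG HG] := lf.
set c := chart i (g t) in box gi lf HG.
have gr s : a <= s -> s <= b -> `|chart i (g s) - c| <= r.
  by move=> as_ sb; have [_] := gi s as_ sb; lra.
have gi' s : a <= s -> s <= b -> chart_dom i (g s) /\ `|chart i (g s) - c| <= r.
  by move=> as_ sb; have [? _] := gi s as_ sb; split => //; exact: gr.
have grho s : a <= s -> s <= b -> `|chart i (g s) - c| < rho.
  move=> as_ sb; have [|||//] := Hd1 s; [exact: le_trans as_|exact: le_trans bT|].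
  rewrite ltr_norml; apply/andP; split; lra.
pose K := [set w : 'rV[R]_n | `|w - c| <= r /\ P (chart_inv i w)].
have Kg s : a <= s -> s <= b -> P (g s) -> K (chart i (g s)).
  by move=> as_ sb Ps; have [is_ ?] := gi' s as_ sb; split => //; rewrite chartK.
(* For closedness: outside the cube the norm separates; inside, [chart_inv] is continuous and the
   complement of [P] is open. *)
have cK : compact K.
  apply: bounded_closed_compact.
    exists (r + `|c|); split; first exact: num_real.
    move=> B rB w [wc _] /=; rewrite -[w](subrK c) (le_trans (ler_normD _ _))//.
    by apply: le_trans (ltW rB); rewrite lerD2r.
  rewrite closedE => w H; apply: contrapT => nK; apply: H.
  have [wr|wr] := leP `|w - c| r; last first.
    apply/nbhs_ballP; exists (`|w - c| - r); first by rewrite /= subr_gt0.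
    move=> w'; rewrite -ball_normE/= => h [w'c _].
    have := ler_normD (w - w') (w' - c); rewrite subrKA; lra.
  have [iw _ Ew] := box w wr.
  have nP : nbhs (chart_inv i w) (~` P).
    apply: open_nbhs_nbhs; split; first exact: closed_openC.
    by move=> Pw; apply: nK.
  have N : \forall w' \near w, ~ P (chart_inv i w').
    by have := chart_inv_continuous iw; rewrite Ew => /(_ _ nP).
  by apply: filterS N => w' nPw' [_ Pw'].
have [pr Hpr] := nearest_point cK (ex_intro _ _ (Kg a (lexx a) ab Pa)).
suff [_ Pb] : K (chart i (g b)).
  by move: Pb; rewrite chartK//; have [] := gi b ab (lexx b).
have l2 : 2 * n%:R * (\int[mu]_t l t)%R <= 2^-1.
  have [_ l0 _ _] := cf.
  apply: (@le_trans _ _ (2 * n.+1%:R * (4 * n.+1%:R)^-1)).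
    apply: ler_pM => //; rewrite ?mulr_ge0//; first exact: Rintegral_ge0.
    by rewrite ler_wpM2l// ler_nat.
  by rewrite le_eqVlt; apply/orP; left; apply/eqP; field; rewrite nat1r pnatr_eq0.
apply: (invariant_compact (xi := chart i \o g) ab cf l2 _ Hpr (c := c) (r := r)) => //.
- exact: (sol_integral_curve ab lf (sol_on_sub a0 bT sg) gi').
- by move=> w [].
- apply: ae_mono aeG => s Gs as_ sb /=.
  have [_ _ fE _] := HG s (Gs as_ sb).
  set x := chart i (g s); have [[wr Pw] wmin] := Hpr x; set w := pr x in wr Pw wmin *.
  rewrite fE//; have [iw Ow Ew] := box w wr.
  have as' := ltW as_; have sb' := ltW sb.
  (* The point [g a] lies in [K] and competes with [w]. Passing between the Euclidean and the sup
     norm costs a factor [n] on squares, and [n] is at most the square of [n.+1]. *)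
  have xw : `|x - w| <= n.+1%:R * `|x - chart i (g a)|.
    rewrite -ler_sqr ?nnegrE ?mulr_ge0//.
    apply: le_trans (dot_norm_ge _) _; apply: le_trans (wmin _ (Kg a (lexx a) ab Pa)) _.
    apply: le_trans (ler_norm _) _; apply: le_trans (dot_norm_le _ _) _.
    rewrite -expr2 exprMn ler_wpM2r ?sqr_ge0//.
    rewrite (@le_trans _ _ n.+1%:R) ?ler_nat// expr2 -natrM ler_nat.
    exact: leq_pmulr.
  have xa : `|x - chart i (g a)| < 2 * rho.
    rewrite -(subrKA c) (le_lt_trans (ler_normD _ _))// mulr2n mulrDl mul1r ltrD//; first exact: grho.
    by rewrite distrC; exact: grho.
  have wc : `|w - c| < r.
    rewrite -(subrKA x) (le_lt_trans (ler_normD _ _))// distrC.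
    have h1 : `|x - c| < rho := grho s as' sb'.
    have h2 : `|x - w| <= n.+1%:R * (2 * rho) by apply: le_trans xw _; rewrite ler_wpM2l// ltW.
    have h3 : r = n.+2%:R * (2 * rho) by rewrite /rho mulrA [n.+2%:R * 2]mulrC mulrCA mulfV ?mulr1// mulf_neq0// pnatr_eq0.
    have h4 : n.+2%:R * (2 * rho) = 2 * rho + n.+1%:R * (2 * rho) by rewrite -[n.+2]add1n natrD mulrDl mul1r.
    lra.
  apply: (tangentP Ow Pw _ iw).
    by apply: (UU_val hUU hu); [exact: le_trans as'|exact: le_trans bT].
  apply: (proximal_normal _ wc) => [w' /box[]//|w' w'r Pw'].
  by apply: wmin; split.
by apply: Kg.
Qed.

End viability.

Theorem theorem1 (R : realType) (n m : nat) (M : topologicalType)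
    (A : smooth_atlas R n M)
    (hausdorffM : hausdorff_space M)
    (second_countableM : @second_countable M)
    (connectedM : connected [set: M])
    (U : set 'rV[R]_m)
    (F : forall x : M, 'rV[R]_m -> tangent_vector A x)
    (smoothF : smooth_control_field U F)
    (UU : set (control R m))
    (hUU : UU = U_pc U \/ UU = U_infty U) :
  locally_controllable F UU -> controllable F UU.
Proof.
move=> lc.
have sym y x : reach F UU y x -> reach F UU x y.
  move=> /reach_elim[T [u [g [hu cu sg g0 <-]]]].
  have gO t : 0 <= t -> t <= T -> reach F UU y (g t).
    move=> t0 tT; rewrite -g0.
    exact: (reach_intro hUU hu cu (lexx 0) t0 tT (sol_on_sub (lexx 0) tT sg)).
  apply: (@viable _ _ _ _ _ _ _ smoothF _ hUU [set z | reach F UU z y] [set z | reach F UU y z]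
    (reach_backward_closed hUU lc) (reach_open hUU _ lc) _ _ _ _ hu cu sg gO).
    move=> p v0 i nu yp py Uv ip; apply: (normal_tangent smoothF hUU) => //.
      by move=> z w zw wy; exact: (reach_trans hUU zw wy).
    exact: lc.
  by rewrite g0; exact: (reach_refl _ lc).
move=> x; apply: connectedM.
- by exists x; exact: (reach_refl _ lc).
- by exists (attainable F UU x); rewrite ?setTI//; exact: (reach_open hUU _ lc).
exists (attainable F UU x); rewrite ?setTI//.
(* Symmetry rewrites the forward set, known to be open, as a backward set, known to be closed. *)
have -> : attainable F UU x = [set z | reach F UU z x].
  by apply/seteqP; split => z; exact: sym.
exact: (reach_backward_closed hUU lc).
Qed.
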